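(* Let $K\subseteq\overline{\mathbb{Q}}$ be a number field, let $d$ be a positive integer, and let $F=\left(\left(K^{ab}\right)^{sa}\right)^{(d)}$. Then $\mathbb{G}_m(F)/\mathbb{G}_m(F)_{\mathrm{tors}}=F^*/(F^* )_{\mathrm{tors}}$ is free abelian, but $F$ does not satisfy the Bogomolov property with respect to the Weil height.
   Context: $\overline{\mathbb{Q}}$ is a fixed algebraic closure of $\mathbb{Q}$; all algebraic extensions of $\mathbb{Q}$ are taken inside it. For a subfield $L\subseteq\overline{\mathbb{Q}}$: $L^{ab}$ is the maximal abelian extension of $L$; $L^{(d)}$ is the compositum of all extensions of $L$ of degree at most $d$; $L^{sa}$ is the field obtained by adjoining to $L$ all roots of all irreducible polynomials in $L[X]$ (of any degree) whose Galois group over $L$ is a symmetric or alternating group. For an abelian group $A$, $A_{\mathrm{tors}}$ denotes its torsion subgroup. $F$ satisfies the Bogomolov property with respect to the Weil height if there exists $\epsilon>0$ such that every element of $F^*$ that is not a root of unity has absolute logarithmic Weil height at least $\epsilon$. *)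

(* Defs.v *)
From HB Require Import structures.
From mathcomp Require Import all_boot all_order all_algebra all_fingroup.
From mathcomp Require Import all_solvable all_field finmap complex ring_quotient.
From mathcomp Require Import all_classical all_reals all_analysis.

Set Implicit Arguments.
Unset Strict Implicit.
Unset Printing Implicit Defensive.

Import Order.TTheory GRing.Theory Num.Theory.

Local Open Scope classical_set_scope.
Local Open Scope ring_scope.

(* algC is the fixed algebraic closure of the rationals; its subfields are the
   predicates [L : divringClosed algC], and [subfield L] is [L] as a field. *)

Definition subfield (L : divringClosed algC) := {x : algC | x \in L}.

HB.instance Definition _ L := SubChoice.on (subfield L).
HB.instance Definition _ (L : divringClosed algC) :=
  [SubChoice_isSubIntegralDomain of subfield L by <:].
HB.instance Definition _ (L : divringClosed algC) :=
  [SubIntegralDomain_isSubField of subfield L by <:].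

Definition gen_field (S : set algC) : {pred algC} :=
  [pred x | `[< forall M : divringClosed algC,
                  (forall y, S y -> y \in M) -> x \in M >]].

Fact gen_field_divring_closed S : divring_closed (gen_field S).
Proof.
split=> [|x y /asboolP hx /asboolP hy|x y /asboolP hx /asboolP hy];
  apply/asboolP=> M SM; first exact: rpred1.
  by rewrite rpredB ?hx ?hy.
by rewrite rpred_div ?hx ?hy.
Qed.

HB.instance Definition _ S :=
  GRing.isDivringClosed.Build algC (gen_field S) (gen_field_divring_closed S).

Lemma mem_gen_field (S : set algC) x : S x -> x \in gen_field S.
Proof. by move=> Sx; apply/asboolP=> M; apply. Qed.

Definition adjoin (L : divringClosed algC) (S : set algC) : divringClosed algC :=
  gen_field ([set x | x \in L] `|` S).

Definition has_degree (L M : divringClosed algC) (n : nat) : Prop :=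
  {subset L <= M} /\
  exists e : 'I_n -> algC, (forall i, e i \in M) /\
    forall x, x \in M ->
      exists! c : 'rV[subfield L]_n, x = \sum_(i < n) val (c 0 i) * e i.

Definition number_field (K : divringClosed algC) : Prop :=
  exists n, has_degree Crat K n.

(* Only meaningful when M is a finite extension of L. *)
Definition degree (L M : divringClosed algC) : nat :=
  xget 0%N [set n | has_degree L M n].

Definition root_set (L : divringClosed algC) (f : {poly subfield L}) : set algC :=
  [set x | root (map_poly val f) x].

Definition aut_over (L M : divringClosed algC) : set (subfield M -> subfield M) :=
  [set s | [/\ zmod_morphism s, monoid_morphism s, bijective s &
            forall x, val x \in L -> s x = x]].
Arguments aut_over : clear implicits.

(* Extensions are algebraic and separable here, so Galois means normal. *)
Definition galois_ext (L M : divringClosed algC) : Prop :=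
  {subset L <= M} /\
  forall (f : {poly subfield L}) x, irreducible_poly f ->
    root_set f x -> x \in M -> forall y, root_set f y -> y \in M.

Definition abelian_ext (L M : divringClosed algC) : Prop :=
  galois_ext L M /\
  forall s t, aut_over L M s -> aut_over L M t -> s \o t = t \o s.

Definition gal_isog (L M : divringClosed algC) (gT : finGroupType)
    (G : {set gT}) : Prop :=
  exists phi : gT -> subfield M -> subfield M,
    set_bij [set g | g \in G] (aut_over L M) phi /\
    {in G &, forall g h, phi (g * h)%g = phi g \o phi h}.

(* The Galois group of f is that of its splitting field inside algC, compared
   with Sym and Alt as abstract groups; the degree m is not tied to deg f. *)
Definition sym_or_alt (L : divringClosed algC) (f : {poly subfield L}) : Prop :=
  exists m, gal_isog L (adjoin L (root_set f)) ('Sym_('I_m))%g \/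
            gal_isog L (adjoin L (root_set f)) ('Alt_('I_m))%g.

Definition field_ab (L : divringClosed algC) : divringClosed algC :=
  adjoin L [set x | exists2 M, abelian_ext L M & x \in M].

Definition field_sa (L : divringClosed algC) : divringClosed algC :=
  adjoin L [set x | exists f : {poly subfield L},
                      [/\ irreducible_poly f, sym_or_alt f & root_set f x]].

Definition field_deg (L : divringClosed algC) (d : nat) : divringClosed algC :=
  adjoin L [set x | exists M n, [/\ has_degree L M n, (n <= d)%N & x \in M]].

(* The multiplicative group of a field, written additively. *)
Definition Gm (F : fieldType) := {x : F | x != 0}.

Section Gm.
Variable F : fieldType.
HB.instance Definition _ := SubChoice.on (Gm F).

Definition Gm_mul (x y : Gm F) : Gm F :=
  exist _ (val x * val y) (mulf_neq0 (valP x) (valP y)).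
Definition Gm_inv (x : Gm F) : Gm F :=
  exist _ (val x)^-1 (invr_neq0 (valP x)).
Definition Gm_one : Gm F := exist _ 1 (oner_neq0 F).

Fact Gm_mulA : associative Gm_mul.
Proof. by move=> x y z; apply: val_inj; rewrite /= mulrA. Qed.
Fact Gm_mulC : commutative Gm_mul.
Proof. by move=> x y; apply: val_inj; rewrite /= mulrC. Qed.
Fact Gm_mul1 : left_id Gm_one Gm_mul.
Proof. by move=> x; apply: val_inj; rewrite /= mul1r. Qed.
Fact Gm_mulV : left_inverse Gm_one Gm_inv Gm_mul.
Proof. by move=> x; apply: val_inj; rewrite /= mulVf // (valP x). Qed.

HB.instance Definition _ :=
  GRing.isZmodule.Build (Gm F) Gm_mulA Gm_mulC Gm_mul1 Gm_mulV.
End Gm.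

Definition tors (A : zmodType) : {pred A} :=
  [pred x | `[< exists2 n, (0 < n)%N & x *+ n = 0 >]].

Fact tors_zmod_closed (A : zmodType) : zmod_closed (@tors A).
Proof.
split=> [|x y /asboolP[m m0 xm] /asboolP[n n0 yn]]; apply/asboolP.
  by exists 1%N.
exists (m * n)%N; first by rewrite muln_gt0 m0.
by rewrite mulrnBl mulrnA xm mul0rn mulnC mulrnA yn mul0rn subr0.
Qed.

HB.instance Definition _ (A : zmodType) :=
  GRing.isZmodClosed.Build A (@tors A) (@tors_zmod_closed A).

Definition mod_tors (A : zmodType) : zmodType := Quotient.quot (@tors A).

Definition free_abelian (A : zmodType) : Prop :=
  exists B : set A, forall x,
    exists! c : {fsfun A -> int with 0},
      (forall b, b \in finsupp c -> B b) /\
      x = \sum_(b <- finsupp c) b *~ c b.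

Section Height.
Variables (R : realType) (K : divringClosed algC).

Definition embeddings : set (subfield K -> R[i]) :=
  [set s | zmod_morphism s /\ monoid_morphism s].

(* Normalised discrete valuations of K; for a number field they correspond to
   the finite places. The value at 0, in truth +oo, is set to 0 so that each
   place is counted once. *)
Definition valuations : set (subfield K -> int) :=
  [set v | [/\ v 0 = 0,
    {in [pred x | x != 0] &, {morph v : x y / x * y >-> x + y}},
    forall x y : subfield K, x != 0 -> y != 0 -> x + y != 0 ->
      Num.min (v x) (v y) <= v (x + y) &
    exists2 x : subfield K, x != 0 & v x = 1]].

Definition residue_field (v : subfield K -> int) : set (set (subfield K)) :=
  [set [set y | y = x \/ 0 < v (y - x)] | x in [set x | 0 <= v x]].

Definition residue_card (v : subfield K -> int) : nat :=
  #|` fset_set (residue_field v)|.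

End Height.
Arguments embeddings : clear implicits.
Arguments valuations : clear implicits.

(* The absolute value of x at the place v, raised to the local degree of v, is
   residue_card v ^ (- v x) if v is finite, while the infinite places
   contribute one factor |s x| for each complex embedding s. *)
Definition height_in (R : realType) (K : divringClosed algC)
    (x : subfield K) : R :=
  (degree Crat K)%:R^-1 *
  (\sum_(s \in embeddings R K) ln (Num.max 1 (ComplexField.Normc.normc (s x)))
   + \sum_(v \in valuations K)
       ln (Num.max 1 ((residue_card v)%:R ^ (- v x) : R))).

(* The sum does not depend on the number field containing x; take Q(x). *)
Definition weil_height (R : realType) (x : algC) : R :=
  @height_in R (gen_field [set x])
    (Sub x (mem_gen_field (erefl : [set x] x))).

Definition bogomolov (R : realType) (F : divringClosed algC) : Prop :=
  exists2 eps : R, 0 < eps &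
    forall x : algC, x \in F -> x != 0 ->
      (forall n, (0 < n)%N -> x ^+ n != 1) -> eps <= weil_height R x.

(* Main.v *)
Require Import Defs.
From Stdlib Require List.
From HB Require Import structures.
From mathcomp Require Import all_boot all_order all_algebra all_fingroup.
From mathcomp Require Import all_solvable all_field finmap ring_quotient.
From mathcomp Require Import all_classical all_reals all_analysis complex.
From mathcomp Require Import zify ring lra.
Import Defs.

Set Implicit Arguments.
Unset Strict Implicit.
Unset Printing Implicit Defensive.

Import Order.TTheory GRing.Theory Num.Theory.

Local Open Scope classical_set_scope.
Local Open Scope ring_scope.

(** Write [L] for the abelian closure of [K] and [F] for the whole tower. Everything
    is read off the group [autC] of automorphisms of the field of algebraic numbers:
    embeddings of subfields extend to it ([extend_embedding]), a subfield of any degree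
    is the fixed field of the automorphisms that fix it ([galC_fixed]), and commutators
    of automorphisms fixing [K] fix [L] ([galC_ab_comm]).

    Freeness. By Pontryagin's criterion a countable torsion-free abelian group is free
    as soon as every finitely generated subgroup has a finitely generated pure closure
    ([free_of_finite_rank]). Given finitely many elements of [F], let [M] be a number
    field that contains them and [K], and is Galois over the rationals. The point is that
    there is a single exponent [e] such that, whenever a positive power of [x] in [F] lies
    in [M], already [x ^+ e] lies in [M] up to a root of unity ([radical_closure_bound]).
    Let [N] be the group of automorphisms fixing [L] and [M]. As [L] contains all roots of
    unity, [s x / x] is a homomorphism in [s] on [N]. The top layer of the tower has
    exponent dividing [d`!], so the action on [x ^+ d`!] only depends on the image of [N]
    in the Galois group of the middle layer over [L], a normal subgroup of a subdirect
    product of symmetric and alternating groups. Abelian quotients of such a group have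
    exponent dividing 24 ([pow24_commutators]), because everything that is not killed by
    24th powers is built from perfect alternating groups. Hence [N] fixes a bounded power
    of [x]; this power generates an abelian extension of [M], and Schinzel's theorem on
    abelian radicals shows that a further power, bounded by the roots of unity of [M], is
    in [M] ([schinzel_abelian_radical]). Inside [M] the pure closure is finitely generated
    by Northcott's theorem ([finite_galois_pure_fg]), and multiplication by [e] transports
    this to [F] ([mod_tors_fg]).

    Small heights. For a prime [n] at least 5 there is a monic integral polynomial of
    degree [n] with coefficients from 0 to 5 that is irreducible modulo 2 and the product
    of a quadratic and an irreducible factor of odd degree [n - 2] modulo 3. Frobenius
    elements at 2 and 3 ([frobenius_lift]) give a cycle of length [n] and a transposition
    in its Galois group over the rationals, which is therefore the symmetric group
    ([sym_poly_ex]). When [n] is large with respect to [K], every element of order [n] is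
    still induced by an automorphism fixing [K], so the group over [K] contains the
    alternating group; the latter being perfect, the same holds over [L]
    ([Alt_perms_over_ab]). So the roots lie in the middle layer. They are not roots of
    unity, since automorphisms commute on roots of unity. They are algebraic integers, so
    their height is the logarithm of the Mahler measure divided by [n], and Landau's
    inequality bounds it by a constant times [ln n / n] ([weil_height_le]). *)

(** * The automorphism group of the field of algebraic numbers *)

(** Automorphisms are packed into a type of their own so that they form a group;
injective endomorphisms suffice, since an endomorphism of an algebraic
extension of the rationals is onto. *)
Record autC := AutC {
  aut_fun :> algC -> algC;
  aut_zmod : zmod_morphism aut_fun;
  aut_monoid : monoid_morphism aut_fun }.

HB.instance Definition _ (s : autC) :=
  GRing.isZmodMorphism.Build algC algC (aut_fun s) (aut_zmod s).
HB.instance Definition _ (s : autC) :=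
  GRing.isMonoidMorphism.Build algC algC (aut_fun s) (aut_monoid s).
HB.instance Definition _ := gen_eqMixin autC.
HB.instance Definition _ := gen_choiceMixin autC.

Lemma autP (s t : autC) : (forall x, s x = t x) -> s = t.
Proof.
case: s t => [s sz sm] [t tz tm] /= /funext st; move: sz sm; rewrite st => sz sm.
by congr AutC; apply: Prop_irrelevance.
Qed.

Definition aut_of (f : {rmorphism algC -> algC}) : autC :=
  AutC (raddfB f) (rmorphism_monoidP f).

Definition aut_mul (s t : autC) : autC := aut_of (s \o t).
Definition aut_one : autC := aut_of idfun.
Definition aut_inv (s : autC) : autC := aut_of (algC_invaut s).

Fact aut_mulA : associative aut_mul.
Proof. by move=> r s t; apply: autP. Qed.
Fact aut_mul1 : left_id aut_one aut_mul.
Proof. by move=> s; apply: autP. Qed.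
Fact aut_mulr1 : right_id aut_one aut_mul.
Proof. by move=> s; apply: autP. Qed.
Fact aut_mulV : left_inverse aut_one aut_inv aut_mul.
Proof. by move=> s; apply: autP => x /=; rewrite algC_autK. Qed.
Fact aut_mulrV : right_inverse aut_one aut_inv aut_mul.
Proof. by move=> s; apply: autP => x /=; rewrite algC_invautK. Qed.

HB.instance Definition _ :=
  isGroup.Build autC aut_mulA aut_mul1 aut_mulr1 aut_mulV aut_mulrV.

Lemma autM (s t : autC) x : (s * t)%g x = s (t x).
Proof. by []. Qed.

Lemma aut1 x : (1%g : autC) x = x.
Proof. by []. Qed.

Lemma autVK (s : autC) : cancel s (s^-1)%g.
Proof. exact: algC_autK. Qed.

Lemma autKV (s : autC) : cancel (s^-1)%g s.
Proof. exact: algC_invautK. Qed.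

Definition fixes_pointwise (S : set algC) : set autC := [set s | forall x, S x -> s x = x].

(** * Minimal polynomials and extension of embeddings *)

(** A nonzero polynomial of least size vanishing at [x] does all this: the
remainder of any other one has smaller size, and a factor of it that does not
vanish at [x] leaves a cofactor that does. *)
Lemma minpoly_rmorph (F : fieldType) (K : fieldType) (f : {rmorphism F -> K}) (x : K) :
  (exists2 q : {poly F}, q != 0 & root (map_poly f q) x) ->
  exists p : {poly F}, [/\ irreducible_poly p, p \is monic, root (map_poly f p) x &
    forall q : {poly F}, root (map_poly f q) x -> p %| q].
Proof.
move=> [q0 q0n0 rq0].
pose P n := exists p : {poly F}, [/\ p != 0, size p = n & root (map_poly f p) x].
have exP : exists n, `[< P n >] by exists (size q0); apply/asboolP; exists q0.
have [n /asboolP[p0 [p0n0 szp0 rp0]] minn] := ex_minnP exP.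
pose p := (lead_coef p0)^-1 *: p0.
have lc0 : (lead_coef p0)^-1 != 0 by rewrite invr_eq0 lead_coef_eq0.
have szp : size p = n by rewrite size_scale.
have rp : root (map_poly f p) x by rewrite map_polyZ rootZ ?fmorph_eq0.
have mp : p \is monic by rewrite monicE lead_coefZ mulVf // lead_coef_eq0.
have pn0 : p != 0 := monic_neq0 mp.
have minp q : root (map_poly f q) x -> p %| q.
  move=> rq; apply: contraT => npq.
  have: (n <= size (q %% p)%R)%N.
    apply: minn; apply/asboolP; exists (q %% p); split=> //.
    move: rq; rewrite {1}(Pdiv.Field.divp_eq q p) rmorphD rmorphM /= rootE hornerD hornerM.
    by rewrite (rootP rp) mulr0 add0r.
  by rewrite leqNgt -szp ltn_modp pn0.
exists p; split=> //; split.
  by rewrite -(size_map_poly f) (root_size_gt1 _ rp) // map_poly_eq0.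
move=> q sq1 /[dup] qp /dvdpP[r Dp]; rewrite /eqp qp /=.
move: pn0 (rp); rewrite {1 2}Dp mulf_eq0 negb_or => /andP[rn0 qn0].
rewrite rmorphM rootM => /orP[/minp/(dvdp_leq rn0)|/minp //].
rewrite Dp size_mul //; move: sq1 qn0; rewrite -size_poly_gt0.
by case: (size q) => [|[|k]] // _ _; rewrite !addnS ltnNge leq_addr.
Qed.

Lemma Crat_sub (E : divringClosed algC) : {subset Crat <= E}.
Proof.
move=> _ /CratP[a ->]; rewrite -[a]divq_num_den rmorph_div /= ?unitfE ?intr_eq0 ?denq_neq0 //.
by rewrite !ratr_int rpred_div ?rpred_int.
Qed.

Lemma lift_poly (E : divringClosed algC) (q : {poly algC}) :
  q \is a polyOver E -> exists p : {poly subfield E}, map_poly val p = q.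
Proof.
move=> /polyOverP Eq; exists (\poly_(i < size q) (Sub q`_i (Eq i) : subfield E)).
apply/polyP=> i; rewrite coef_map coef_poly /=.
by case: ltnP => [_ //|/(nth_default 0)->].
Qed.

Lemma minpoly_subfield (E : divringClosed algC) (x : algC) :
  exists p : {poly subfield E}, [/\ irreducible_poly p, p \is monic, root (map_poly val p) x &
    forall q : {poly subfield E}, root (map_poly val q) x -> p %| q].
Proof.
apply: minpoly_rmorph; have [r Dr] : exists r : {poly subfield E}, map_poly val r = minCpoly x.
  apply: lift_poly; have [r [-> _ _]] := minCpolyP x.
  by apply/polyOverP=> i; rewrite coef_map; apply/Crat_sub/CratP; exists r`_i.
exists r; last by rewrite Dr root_minCpoly.
by rewrite -(map_poly_eq0 (val : {rmorphism subfield E -> algC})) Dr minCpoly_eq0.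
Qed.

(** Graphs of embeddings of a subfield of [algC] in [algC]. Keeping the field and
the embedding in one set of pairs makes unions of chains painless. As [x / 0]
is [0], closure under division costs nothing at [0]. *)
Definition partial_hom (G : set (algC * algC)) :=
  [/\ G (1, 1),
      forall x y x' y', G (x, x') -> G (y, y') -> G (x - y, x' - y'),
      forall x y x' y', G (x, x') -> G (y, y') -> G (x / y, x' / y') &
      forall y, G (0, y) -> y = 0].

(** The simple extension step: sending [x] to a conjugate root [y] is well defined
on polynomial expressions, and these are closed under division by Bezout. *)
Lemma partial_hom_root (E : divringClosed algC) (phi : {rmorphism subfield E -> algC})
    (p : {poly subfield E}) (x y : algC) :
    (forall q, root (map_poly val q) x = (p %| q)) -> irreducible_poly p ->
    root (map_poly phi p) y ->
  partial_hom [set z | exists q : {poly subfield E},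
          z = ((map_poly val q).[x], (map_poly phi q).[y])].
Proof.
move=> minp irr ry; split.
- by exists 1; rewrite !rmorph1 !hornerE.
- by move=> _ _ _ _ [q [-> ->]] [r [-> ->]]; exists (q - r); rewrite !rmorphB /= !hornerE.
- move=> _ _ _ _ [q [-> ->]] [r [-> ->]].
  suff [s [sx sy]] : exists s : {poly subfield E}, (map_poly val s).[x] = ((map_poly val r).[x])^-1 /\
      (map_poly phi s).[y] = ((map_poly phi r).[y])^-1.
    by exists (q * s); rewrite !rmorphM /= !hornerM sx sy.
  have [pr|npr] := boolP (p %| r).
    exists 0; rewrite !rmorph0 !horner0; have: root (map_poly val r) x by rewrite minp.
    move=> /rootP->; have [t ->] := dvdpP _ _ pr.
    by rewrite rmorphM hornerM /= (rootP ry) mulr0 invr0.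
  have : coprimep p r by rewrite irreducible_poly_coprime.
  move=> /Bezout_eq1_coprimepP[[u v] /= uv1]; exists v.
  have rt (psi : {rmorphism subfield E -> algC}) t : root (map_poly psi p) t ->
      (map_poly psi v).[t] = ((map_poly psi r).[t])^-1.
    move=> rt; have /(congr1 (fun f => (map_poly psi f).[t])) := uv1.
    rewrite rmorphD !rmorphM rmorph1 /= !hornerE (rootP rt) mulr0 add0r => h.
    have rn0 : (map_poly psi r).[t] != 0.
      by apply: contra_eq_neq h => ->; rewrite mulr0 eq_sym oner_eq0.
    by apply: (mulIf rn0); rewrite h mulVf.
  split; last exact: rt.
  have rx : root (map_poly val p) x by rewrite minp.
  exact: (rt val x rx).
move=> z [q [/esym/eqP]]; rewrite -/(root _ _) minp => /dvdpP[t ->] ->.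
by rewrite rmorphM hornerM /= (rootP ry) mulr0.
Qed.

Lemma partial_hom_ker G x x' y' : partial_hom G -> G (x, x') -> G (x, y') -> x' = y'.
Proof.
move=> [_ GB _ G0] Gx Gy; apply/eqP; rewrite -subr_eq0; apply/eqP/G0.
by rewrite -(subrr x); apply: GB.
Qed.

Lemma partial_hom_rmorphism G : partial_hom G ->
  exists (E : divringClosed algC) (phi : {rmorphism subfield E -> algC}),
    (forall x, x \in E <-> exists y, G (x, y)) /\
    (forall z, G (val z, phi z)).
Proof.
move=> pG; have [G1 GB GD G0] := pG.
pose P : {pred algC} := [pred x | `[< exists y, G (x, y) >]].
have PP : divring_closed P.
  split=> [|x y /asboolP[x' ?] /asboolP[y' ?]|x y /asboolP[x' ?] /asboolP[y' ?]].
  - by apply/asboolP; exists 1.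
  - by apply/asboolP; exists (x' - y'); apply: GB.
  - by apply/asboolP; exists (x' / y'); apply: GD.
pose E : divringClosed algC := HB.pack P (GRing.isDivringClosed.Build algC P PP).
have memE x : x \in E <-> exists y, G (x, y) by split=> /asboolP.
have phiP (z : subfield E) : {y | G (val z, y)} by apply/cid/memE/valP.
pose phi z := sval (phiP z).
have Gphi z : G (val z, phi z) := svalP (phiP z).
have phiB : zmod_morphism phi.
  by move=> x y; apply: (partial_hom_ker pG (Gphi _)); rewrite rmorphB; apply: GB; exact: Gphi.
have GM x y x' y' : G (x, x') -> G (y, y') -> G (x * y, x' * y').
  have GV z z' : G (z, z') -> G (z^-1, z'^-1).
    by move=> Gz; rewrite -[z^-1]div1r -[z'^-1]div1r; apply: GD.
  by move=> Gx /GV Gy; rewrite -[y]invrK -[y']invrK; apply: GD.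
have phiM : monoid_morphism phi.
  split; first by apply: (partial_hom_ker pG (Gphi _)); rewrite rmorph1.
  by move=> x y; apply: (partial_hom_ker pG (Gphi _)); rewrite rmorphM; apply: GM; exact: Gphi.
pose f : {rmorphism subfield E -> algC} := HB.pack phi
  (GRing.isZmodMorphism.Build _ _ phi phiB) (GRing.isMonoidMorphism.Build _ _ phi phiM).
by exists E, f.
Qed.

Lemma partial_hom_step G x : partial_hom G ->
  exists H, [/\ partial_hom H, G `<=` H & exists y, H (x, y)].
Proof.
move=> pG; have [E [phi [memE Gphi]]] := partial_hom_rmorphism pG.
have [p [irr mp rp minp]] := minpoly_subfield E x.
have [y ry] : exists y, root (map_poly phi p) y.
  by apply/closed_rootP; rewrite size_map_poly gtn_eqF ?irr.
exists [set z | exists q : {poly subfield E},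
  z = ((map_poly val q).[x], (map_poly phi q).[y])]; split.
- apply: partial_hom_root irr ry => q; apply/idP/idP => [/minp //|/dvdpP[r ->]].
  by rewrite rmorphM rootM rp orbT.
- move=> [a b] Gab; have Ea : a \in E by apply/memE; exists b.
  exists (Sub a Ea)%:P; rewrite !map_polyC !hornerC; congr (_, _).
  exact: partial_hom_ker pG Gab (Gphi (Sub a Ea)).
- by exists (map_poly phi 'X).[y], 'X; rewrite !map_polyX !hornerX.
Qed.

(** Stated relatively to a fixed graph [G0], because Zorn's lemma also asks for an
upper bound of the empty chain. *)
Lemma partial_hom_union G0 (F : set (set (algC * algC))) : partial_hom G0 ->
  (forall G, F G -> partial_hom (G0 `|` G)) -> total_on F subset ->
  partial_hom (G0 `|` \bigcup_(G in F) G).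
Proof.
move=> pG0 FP totF; set U := _ `|` _.
have two a b : U a -> U b -> exists2 H, partial_hom H & [/\ H a, H b & H `<=` U].
  have sU G : F G -> G0 `|` G `<=` U.
    by move=> FG z [?|?]; [left | right; exists G].
  case=> [a0|[A FA Aa]] [b0|[B FB Bb]].
  - by exists G0 => //; split=> // z; left.
  - by exists (G0 `|` B); [apply: FP | split; [left|right|apply: sU]].
  - by exists (G0 `|` A); [apply: FP | split; [right|left|apply: sU]].
  - have [AB|BA] := totF _ _ FA FB.
      by exists (G0 `|` B); [apply: FP | split; [right; apply: AB|right|apply: sU]].
    by exists (G0 `|` A); [apply: FP | split; [right|right; apply: BA|apply: sU]].
split.
- by left; have [] := pG0.
- by move=> x y x' y' Ux /(two _ _ Ux)[H [_ HB _ _] [Hx Hy]]; apply; apply: HB.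
- by move=> x y x' y' Ux /(two _ _ Ux)[H [_ _ HD _] [Hx Hy]]; apply; apply: HD.
- by move=> y Uy; have [H [_ _ _ H0] [Hy _ _]] := two _ _ Uy Uy; apply: H0.
Qed.

(** Zorn's lemma gives a maximal graph; by the simple extension step its domain
is everything. *)
Lemma partial_hom_extend_aut G0 : partial_hom G0 -> exists s : autC, forall x y, G0 (x, y) -> s x = y.
Proof.
move=> pG0.
have [F FP totF|G [pG maxG]] := @Zorn_bigcup _ [set G | partial_hom (G0 `|` G)].
  exact: partial_hom_union.
have [E [phi [memE Gphi]]] := partial_hom_rmorphism pG.
have allE x : x \in E.
  have [H [pH GH [y Hy]]] := partial_hom_step x pG.
  apply/memE; exists y; apply: contrapT => nGy.
  have sGH : G `<=` H by move=> z Gz; apply: GH; right.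
  have : partial_hom (G0 `|` H) by rewrite (setUidr _) // => z G0z; apply: GH; left.
  apply: maxG; split=> // HG; apply: nGy; right; exact: HG.
pose s x := phi (Sub x (allE x)).
have sG x : (G0 `|` G) (x, s x) := Gphi (Sub x (allE x)).
have sB : zmod_morphism s.
  by move=> x y; rewrite /s -rmorphB; apply: congr1; apply: val_inj.
have sM : monoid_morphism s.
  split; first by rewrite /s -[RHS](rmorph1 phi); apply: congr1; apply: val_inj.
  by move=> x y; rewrite /s -rmorphM; apply: congr1; apply: val_inj.
exists (AutC sB sM) => x y G0xy; apply: partial_hom_ker pG (sG x) _; by left.
Qed.

Lemma extend_embedding (M : divringClosed algC) (f : subfield M -> algC) :
  zmod_morphism f -> monoid_morphism f -> exists s : autC, forall x, s (val x) = f x.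
Proof.
move=> fB [f1 fM].
pose g : {rmorphism subfield M -> algC} := HB.pack f
  (GRing.isZmodMorphism.Build _ _ f fB) (GRing.isMonoidMorphism.Build _ _ f (f1, fM)).
have [|s sP] := @partial_hom_extend_aut [set z | exists x, z = (val x, g x)].
  split; first by exists 1; rewrite !rmorph1.
  - by move=> _ _ _ _ [x [-> ->]] [y [-> ->]]; exists (x - y); rewrite !rmorphB.
  - by move=> _ _ _ _ [x [-> ->]] [y [-> ->]]; exists (x / y); rewrite !fmorph_div.
  - by move=> y [x [/esym x0 ->]]; have -> : x = 0; [exact: val_inj | exact: (rmorph0 g)].
by exists s => x; apply: sP; exists x.
Qed.

Definition galC (L : divringClosed algC) : set autC := [set s | forall x, x \in L -> s x = x].

Lemma map_poly_Gal L (s : autC) (p : {poly subfield L}) : galC L s ->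
  map_poly s (map_poly val p) = map_poly val p.
Proof.
by move=> Ls; apply/polyP=> i; rewrite !coef_map; apply/Ls/valP.
Qed.

Lemma galC_root L (s : autC) (p : {poly subfield L}) x : galC L s ->
  root (map_poly val p) (s x) = root (map_poly val p) x.
Proof. by move=> Ls; rewrite -{1}(map_poly_Gal p Ls) fmorph_root. Qed.

Lemma galC_trans L (p : {poly subfield L}) x y : irreducible_poly p ->
  root (map_poly val p) x -> root (map_poly val p) y ->
  exists2 s, galC L s & s x = y.
Proof.
move=> irr rx ry.
have minp q : root (map_poly val q) x = (p %| q).
  apply/idP/idP => [rq|/dvdpP[r ->]]; last by rewrite rmorphM rootM rx orbT.
  apply: contraT; rewrite -irreducible_poly_coprime // => cpq.
  have : coprimep (map_poly (val : {rmorphism subfield L -> algC}) p) (map_poly val q).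
    by rewrite coprimep_map.
  by move=> /coprimep_root/(_ rx); rewrite (rootP rq) eqxx.
have [s sP] := partial_hom_extend_aut (partial_hom_root minp irr ry).
exists s => [z Lz|].
  by apply: sP; exists (Sub z Lz)%:P; rewrite !map_polyC !hornerC.
by apply: sP; exists 'X; rewrite !map_polyX !hornerX.
Qed.

(** The Galois correspondence for extensions of arbitrary degree. The minimal
polynomial of [x] has no other root than [x], and in characteristic zero its
second coefficient then determines [x]. *)
Lemma galC_fixed L x : (forall s, galC L s -> s x = x) -> x \in L.
Proof.
move=> fx; have [p [irr mp rp minp]] := minpoly_subfield L x.
pose q := map_poly (val : {rmorphism subfield L -> algC}) p.
have all_rx y : root q y -> y = x.
  by move=> ry; have [s Ls <-] := galC_trans irr rp ry; apply: fx.
have [rs Dq] := closed_field_poly_normal (q : {poly algC}).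
have mq : q \is monic by rewrite map_monic.
rewrite (monicP mq) scale1r in Dq.
have srs : rs = nseq (size rs) x.
  by apply/all_pred1P/allP => y; rewrite -root_prod_XsubC -Dq => /all_rx ->; apply: eqxx.
have sz : size rs != 0%N.
  rewrite -eqSS -(size_prod_XsubC rs id) -Dq size_map_poly gtn_eqF //; exact: irr.1.
have := coefPn_prod_XsubC sz; rewrite -Dq coef_map /= {2}srs.
rewrite big_nseq iter_addr_0 => Dx.
have : x *+ size rs \in L by rewrite -[_ *+ _]opprK -Dx rpredN; apply: valP.
rewrite -mulr_natr => Lx; rewrite -[x](mulfK (x := (size rs)%:R)) ?pnatr_eq0 //.
by rewrite rpred_div ?rpred_nat.
Qed.

Section Tower.
Implicit Types (K L M : divringClosed algC) (S : set algC) (s t : autC).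

(** * Automorphisms and the fields of the tower *)

Lemma gen_field_sub (S : set algC) (M : divringClosed algC) :
  (forall y, S y -> y \in M) -> {subset gen_field S <= M}.
Proof. by move=> SM x /asboolP; apply. Qed.

Lemma gen_field_ind (S : set algC) (P : set algC) :
  P 1 -> (forall x y, P x -> P y -> P (x - y)) -> (forall x y, P x -> P y -> P (x / y)) ->
  (forall x, S x -> P x) -> forall x, x \in gen_field S -> P x.
Proof.
move=> P1 PB PD SP x.
pose Q : {pred algC} := [pred x | `[< P x >]].
have QP : divring_closed Q.
  split=> [|u v /asboolP Pu /asboolP Pv|u v /asboolP Pu /asboolP Pv]; apply/asboolP => //.
    exact: PB.
  exact: PD.
pose E : divringClosed algC := HB.pack Q (GRing.isDivringClosed.Build algC Q QP).
by move=> /(@gen_field_sub S E) h; apply/asboolP/h => y Sy; apply/asboolP/SP.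
Qed.

Lemma sub_adjoin L S : {subset L <= adjoin L S}.
Proof. by move=> x Lx; apply: mem_gen_field; left. Qed.

Lemma mem_adjoin L S x : S x -> x \in adjoin L S.
Proof. by move=> Sx; apply: mem_gen_field; right. Qed.

Lemma adjoin_ind (L : divringClosed algC) (S : set algC) (P : set algC) :
  (forall x, x \in L -> P x) -> (forall x y, P x -> P y -> P (x - y)) ->
  (forall x y, P x -> P y -> P (x / y)) ->
  (forall x, S x -> P x) -> forall x, x \in adjoin L S -> P x.
Proof.
move=> PL PB PD SP; apply: gen_field_ind => //; first by apply: PL; apply: rpred1.
by move=> x [/PL|/SP].
Qed.

Lemma aut_eq_adjoin L S (s t : autC) : (forall x, x \in L -> s x = t x) ->
  (forall x, S x -> s x = t x) -> forall x, x \in adjoin L S -> s x = t x.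
Proof.
move=> sL sS; apply: adjoin_ind => // x y sx sy; first by rewrite !rmorphB /= sx sy.
by rewrite !fmorph_div /= sx sy.
Qed.

Lemma aut_stable_adjoin L S (s : autC) (M : divringClosed algC) :
  (forall x, x \in L -> s x \in M) -> (forall x, S x -> s x \in M) ->
  forall x, x \in adjoin L S -> s x \in M.
Proof.
move=> sL sS; apply: (@adjoin_ind L S [set x | s x \in M]) => //= x y sx sy.
  by rewrite !rmorphB /= rpredB.
by rewrite !fmorph_div /= rpred_div.
Qed.

Lemma galC_adjoin L S s : galC (adjoin L S) s <-> galC L s /\ fixes_pointwise S s.
Proof.
split=> [h|[h1 h2]]; first by split=> x ?; apply: h; [apply: sub_adjoin | apply: mem_adjoin].
by apply: (aut_eq_adjoin (t := 1%g)).
Qed.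

Lemma galC_sub L M s : {subset L <= M} -> galC M s -> galC L s.
Proof. by move=> LM Ms x /LM/Ms. Qed.

Lemma galCM L s t : galC L s -> galC L t -> galC L (s * t)%g.
Proof. by move=> Ls Lt x Lx; rewrite autM Lt ?Ls. Qed.

Lemma galC1 L : galC L 1%g. Proof. by []. Qed.

Lemma galCV L s : galC L s -> galC L s^-1%g.
Proof. by move=> Ls x Lx; rewrite -{1}[x]Ls ?autVK. Qed.

Lemma galCX L s n : galC L s -> galC L (s ^+ n)%g.
Proof.
by move=> Ls; elim: n => [|n IHn] //; rewrite expgS; apply: galCM.
Qed.

Lemma galois_stable L M s x : galois_ext L M -> galC L s -> x \in M -> s x \in M.
Proof.
move=> [_ nM] Ls Mx; have [p [irr _ rp _]] := minpoly_subfield L x.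
by apply: (nM p x) => //; rewrite /root_set /= galC_root.
Qed.

(** Outside [M] the value is irrelevant; [insubd] makes the restriction a total
function without a proof of stability in its type. *)
Definition restr (M : divringClosed algC) (s : autC) (z : subfield M) : subfield M :=
  insubd z (s (val z)).

Lemma restrE M s (z : subfield M) : s (val z) \in M -> val (restr s z) = s (val z).
Proof. by move=> h; rewrite val_insubd h. Qed.

Lemma restr_aut_over L M s : (forall x, x \in M -> s x \in M) ->
  (forall x, x \in M -> s^-1%g x \in M) -> galC L s ->
  aut_over L M (restr s).
Proof.
move=> sM sVM Ls.
have rE (z : subfield M) : val (restr s z) = s (val z) by apply: restrE; apply: sM; apply: valP.
split.
- by move=> x y; apply: val_inj; rewrite rmorphB /= !rE rmorphB.
- split; first by apply: val_inj; rewrite rE !rmorph1.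
  by move=> x y; apply: val_inj; rewrite rmorphM /= !rE rmorphM.
- exists (restr (s^-1)%g) => z; apply: val_inj; rewrite !restrE ?autVK ?autKV //;
    by rewrite ?sM ?sVM // ?sM ?sVM //; apply: valP.
- by move=> x Lx; apply: val_inj; rewrite rE Ls.
Qed.

Lemma aut_over_extend L M (s : subfield M -> subfield M) : {subset L <= M} -> aut_over L M s ->
  exists2 t : autC, galC L t & forall z, t (val z) = val (s z).
Proof.
move=> LM [sB [s1 sM] _ sL].
have [||t tP] := @extend_embedding M (val \o s).
- by move=> x y; rewrite [LHS]/= sB -rmorphB.
- by split=> [|x y]; rewrite [LHS]/= ?s1 ?sM // -?rmorphM -?rmorph1.
exists t => // x Lx; have Mx := LM _ Lx.
by have := tP (Sub x Mx); rewrite /= sL.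
Qed.

(** Automorphisms fixing [K] commute on every abelian extension of [K], hence on
the field that these generate. In other words a commutator of such automorphisms
fixes that field, which is how the abelian closure enters both halves of the
proof. *)
Lemma galC_ab_comm K s t x : galC K s -> galC K t -> x \in field_ab K ->
  s (t x) = t (s x).
Proof.
move=> Ks Kt; rewrite -!autM; apply: aut_eq_adjoin => {}x.
  by move=> Kx; rewrite !autM !(Ks, Kt).
move=> [M [gM cM] Mx]; rewrite !autM.
have st r y : galC K r -> y \in M -> r y \in M by apply: galois_stable.
have ro r : galC K r -> aut_over K M (restr r).
  by move=> Kr; apply: restr_aut_over => // y; apply: st => //; apply: galCV.
have /(congr1 (fun f => val (f (Sub x Mx : subfield M)))) := cM _ _ (ro _ Ks) (ro _ Kt).
have rE r (z : subfield M) : galC K r -> val (restr r z) = r (val z).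
  by move=> Kr; apply: restrE; apply: st => //; apply: valP.
by rewrite [LHS]/= [RHS]/= !rE.
Qed.

(** An automorphism raises all the roots of unity of a given order to the same
power; this is why cyclotomic extensions are abelian. *)
Lemma unity_aut (s : autC) (x : algC) n : (0 < n)%N -> x ^+ n = 1 ->
  exists k, s x = x ^+ k.
Proof.
move=> n0 xn; have [m mx _] := prim_order_exists n0 xn.
have /(prim_rootP mx)[i ->] : s x ^+ m = 1 by rewrite -rmorphXn prim_expr_order ?rmorph1.
by exists i.
Qed.

Lemma unity_mem_ab K x n : (0 < n)%N -> x ^+ n = 1 -> x \in field_ab K.
Proof.
move=> n0 xn; pose M := adjoin K [set x].
have KM : {subset K <= M} := @sub_adjoin _ _.
have Mx : x \in M by apply: mem_adjoin.
have stM s y : galC K s -> y \in M -> s y \in M.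
  move=> Ks; apply: aut_stable_adjoin => [z Kz|z ->]; first by rewrite Ks ?KM.
  by have [k ->] := unity_aut s n0 xn; rewrite rpredX.
apply: mem_adjoin; exists M => //; split.
  split=> // f z irr rz Mz y ry.
  by have [s Ks <-] := galC_trans irr rz ry; apply: stM.
move=> s t so to; have [u Ku uP] := aut_over_extend KM so.
have [v Kv vP] := aut_over_extend KM to.
apply: funext => z; apply: val_inj; rewrite /= -uP -vP -vP -uP -!autM.
apply: (@aut_eq_adjoin K [set x]) (valP z) => [y Ky|_ ->].
  by rewrite !autM !(Ku, Kv).
rewrite !autM; have [k ux] := unity_aut u n0 xn; have [l vx] := unity_aut v n0 xn.
by rewrite ux vx !rmorphXn /= ux vx -!exprM mulnC.
Qed.

(** The [n.+1] first powers of [x] have coordinate vectors of length [n], so they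
are linearly dependent. *)
Lemma has_degree_poly L M n x : has_degree L M n -> x \in M ->
  exists p : {poly subfield L}, [/\ p != 0, (size p <= n.+1)%N & root (map_poly val p) x].
Proof.
move=> [LM [e [Me eP]]] Mx.
have cP (i : 'I_n.+1) : {c : 'rV[subfield L]_n | x ^+ i = \sum_(j < n) val (c 0 j) * e j}.
  by apply: cid; have [|c [-> _]] := eP (x ^+ i); [rewrite rpredX | exists c].
pose A := \matrix_(i < n.+1) sval (cP i).
have /rowV0Pn[v /sub_kermxP vA v0] : kermx A != 0.
  rewrite kermx_eq0 /row_free neq_ltn (leq_ltn_trans (rank_leq_col A)) //.
exists (rVpoly v); split.
- by apply: contraNneq v0 => v0; rewrite -[v]rVpolyK v0 linear0.
- exact: size_poly.
rewrite rootE (@horner_coef_wide _ n.+1) ?size_map_poly ?size_poly //.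
rewrite [X in X == _](_ : _ = \sum_(j < n) val ((v *m A) 0 j) * e j); last first.
  rewrite [LHS](_ : _ = \sum_(i < n.+1) val (v 0 i) * x ^+ i); last first.
    by apply: eq_bigr => i _; rewrite coef_map coef_rVpoly_ord.
  under eq_bigr => i _ do rewrite (svalP (cP i)) mulr_sumr.
  rewrite exchange_big; apply: eq_bigr => j _.
  rewrite [in RHS]mxE (rmorph_sum (\val : {rmorphism subfield L -> algC})) mulr_suml; apply: eq_bigr => i _.
  by rewrite !mxE rmorphM mulrA.
by rewrite vA big1 // => j _; rewrite mxE rmorph0 mul0r.
Qed.

Lemma autX (s : autC) n x : (s ^+ n)%g x = iter n s x.
Proof. by elim: n x => [|n IHn] x //; rewrite expgS autM IHn. Qed.

(** Among [n.+1] iterates of [x], all roots of [p], two coincide. *)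
Lemma galC_orbit L (p : {poly subfield L}) x s n : galC L s -> p != 0 -> (size p <= n.+1)%N ->
  root (map_poly val p) x -> exists2 k, (0 < k <= n)%N & (s ^+ k)%g x = x.
Proof.
move=> Ls p0 sp rx; pose q := map_poly (val : {rmorphism subfield L -> algC}) p.
pose rs := [seq (s ^+ i)%g x | i <- iota 0 n.+1].
have [urs|/(uniqPn 0)] := boolP (uniq rs).
  have: (size rs < size q)%N.
    apply: max_poly_roots => //; first by rewrite map_poly_eq0.
    by apply/allP => _ /mapP[i _ ->]; rewrite galC_root //; apply: galCX.
  by rewrite size_map size_iota size_map_poly ltnNge sp.
move=> [i [j [ij]]]; rewrite size_map size_iota => jn.
rewrite !(nth_map 0) ?size_iota ?(ltn_trans ij) // !nth_iota ?(ltn_trans ij) //.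
rewrite !add0n => eij; exists (j - i)%N.
  by rewrite subn_gt0 ij (leq_trans (leq_subr _ _)).
apply: (can_inj (autVK (s ^+ i)%g)); rewrite -autM -expgnDr subnKC //; exact: ltnW.
Qed.

(** The last layer of the tower has exponent dividing [d`!]: an element of degree
at most [d] lies in an orbit of size at most [d] under any automorphism. *)
Lemma galC_deg L d s : galC L s -> galC (field_deg L d) (s ^+ d`!)%g.
Proof.
move=> Ls; apply/galC_adjoin; split; first exact: galCX.
move=> x [M [n [hM nd Mx]]]; have [p [p0 sp rp]] := has_degree_poly hM Mx.
have [k /andP[k0 kn] kx] := galC_orbit Ls p0 sp rp.
have /dvdnP[m ->] : (k %| d`!)%N by rewrite dvdn_fact // k0 (leq_trans kn).
rewrite mulnC expgM autX; elim: m => // m IHm.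
by rewrite iterS IHm.
Qed.

End Tower.

(** * Subdirect products of symmetric and alternating groups *)

Lemma Alt_perfect n : (4 < n)%N -> (('Alt_('I_n))^`(1) = 'Alt_('I_n))%g.
Proof.
move=> n4; have sA : simple ('Alt_('I_n))%g by apply: simple_Alt5; rewrite card_ord.
have [_ /(_ _ (der_normal 1 _))[A1|//]] := simpleP _ sA.
by have := @solvable_AltF 'I_n; rewrite card_ord n4 => /(_ isT)/negP[]; apply/abelian_sol/derG1P.
Qed.

Lemma fact_dvdn m n : (m <= n)%N -> (m`! %| n`!)%N.
Proof. by move=> mn; rewrite -(bin_fact mn) mulnCA dvdn_mulr. Qed.

Lemma expg24_small n (g : 'S_n) : (n < 5)%N -> (g ^+ 24 = 1)%g.
Proof.
move=> n5; apply/eqP; rewrite -order_dvdn.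
apply: (@dvdn_trans #|[set: 'S_n]%G|); first by apply: order_dvdG; rewrite inE.
rewrite cardsT card_Sn.
by apply: (@dvdn_trans 4`!) => //; apply: fact_dvdn.
Qed.

Section SubdirectSymmetric.
Variable T : groupType.
Implicit Types (G N Q B : set T).
Local Open Scope group_scope.

Definition subgrp G := [/\ G 1, forall s t, G s -> G t -> G (s * t) & forall s, G s -> G s^-1].

(** A surjective homomorphism from a subgroup [G] of a possibly infinite group;
nothing is asked outside [G]. *)
Definition grp_hom (hT : finGroupType) G (rho : T -> hT) (H : {set hT}) :=
  [/\ forall s, G s -> rho s \in H,
      {in [pred s | `[< G s >]] &, {morph rho : s t / s * t}} &
      forall h, h \in H -> exists2 s, G s & rho s = h].

(** One factor of the subdirect product. The image of [Q] is a normal subgroup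
made of even permutations, so it is trivial or a perfect alternating group. In
the second case every element of [Q] differs from a product of commutators by an
element with trivial image. *)
Lemma even_image_step G Q B n (rho : T -> 'S_n) (H : {set 'S_n}) :
  subgrp G -> subgrp Q -> subgrp B ->
  (forall s, Q s -> G s) -> (forall s g, Q s -> G g -> Q (s ^ g)) ->
  (forall s t, Q s -> Q t -> B [~ s, t]) ->
  grp_hom G rho H -> (H = 'Sym_('I_n) \/ H = 'Alt_('I_n)) ->
  (forall s, Q s -> ~~ odd_perm (rho s)) -> ((n < 5)%N -> forall s, Q s -> rho s = 1) ->
  (forall s, Q s -> rho s = 1 -> B s) ->
  forall s, Q s -> B s.
Proof.
move=> [G1 GM GV] [Q1 QM QV] [B1 BM BV] QG QJ QB [rhoG rhoM rhoS] HE evQ smallQ kerQ.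
have [/smallQ sQ s Qs|n5] := ltnP n 5; first by apply: kerQ => //; apply: sQ.
have rM s t : G s -> G t -> rho (s * t) = rho s * rho t.
  by move=> Gs Gt; apply: rhoM; apply/asboolP.
have r1 : rho 1 = 1 by apply: (mulgI (rho 1)); rewrite -rM // !mulg1.
have rV s : G s -> rho s^-1 = (rho s)^-1.
  by move=> Gs; apply: (mulgI (rho s)); rewrite -rM ?mulgV //; apply: GV.
pose imQ := [set g : 'S_n | `[< exists2 s, Q s & rho s = g >]]%SET.
have memQ g : reflect (exists2 s, Q s & rho s = g) (g \in imQ).
  by rewrite inE; apply: asboolP.
pose imB := [set g : 'S_n | `[< exists2 s, Q s /\ B s & rho s = g >]]%SET.
have memB g : reflect (exists2 s, Q s /\ B s & rho s = g) (g \in imB).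
  by rewrite inE; apply: asboolP.
have gQ : group_set imQ.
  apply/group_setP; split; first by apply/memQ; exists 1.
  move=> _ _ /memQ[s Qs <-] /memQ[t Qt <-]; apply/memQ; exists (s * t); first exact: QM.
  by rewrite rM //; apply: QG.
have gB : group_set imB.
  apply/group_setP; split; first by apply/memB; exists 1.
  move=> _ _ /memB[s [Qs Bs] <-] /memB[t [Qt Bt] <-]; apply/memB; exists (s * t).
    by split; [apply: QM | apply: BM].
  by rewrite rM //; apply: QG.
have AltH : 'Alt_('I_n) \subset H.
  by case: HE => ->; [apply: Alt_subset | apply: subxx].
have nQ : normal (Group gQ) 'Alt_('I_n).
  apply/andP; split.
    by apply/fintype.subsetP => g /memQ[s Qs <-]; rewrite Alt_even evQ.
  apply/fintype.subsetP => g /(fintype.subsetP AltH)/rhoS[t Gt <-]; rewrite inE.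
  apply/fintype.subsetP => _ /imsetP[h /memQ[s Qs <-] ->]; apply/memQ; exists (s ^ t).
    exact: QJ.
  by rewrite /conjg !rM ?rV //; [apply: QG | apply: GV | apply: GM => //; apply: QG].
have sA : simple ('Alt_('I_n))%g by apply: simple_Alt5; rewrite card_ord.
have [_ /(_ _ nQ)[]imQE] := simpleP _ sA.
  move=> s Qs; apply: kerQ => //.
  have : rho s \in Group gQ by apply/memQ; exists s.
  by rewrite imQE => /set1P.
have AB : 'Alt_('I_n) \subset Group gB.
  rewrite -{1}Alt_perfect // gen_subG; apply/fintype.subsetP => _ /imset2P[g h Ag Ah ->].
  move: Ag Ah; rewrite -imQE => /memQ[s Qs <-] /memQ[t Qt <-]; apply/memB; exists [~ s, t].
    split; last exact: QB.
    by rewrite /commg; apply: QM; [exact: QV | apply: QJ => //; apply: QG].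
  have [Gs Gt] := (QG _ Qs, QG _ Qt).
  by rewrite /commg /conjg !rM ?rV //; auto 10.
move=> s Qs; have : rho s \in Group gQ by apply/memQ; exists s.
rewrite imQE => /(fintype.subsetP AB)/memB[t [Qt Bt] ets].
have Qts : Q (t^-1 * s) by apply: QM => //; apply: QV.
rewrite -(mulKVg t s); apply: BM => //; apply: kerQ => //.
by rewrite rM ?rV ?ets ?mulVg //; [apply: QG | apply: GV; apply: QG | apply: QG].
Qed.

Definition sym_or_alt_hom G (r : {n & T -> 'S_n}) :=
  exists2 H, grp_hom G (tagged r) H & (H = 'Sym_('I_(tag r)) \/ H = 'Alt_('I_(tag r))).

(** Peeling the factors off one at a time, with [Q] replaced by the kernel of the
factor just treated, which is again normal. *)
Lemma even_image_commutators G Q B (rs : seq {n & T -> 'S_n}) :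
  subgrp G -> subgrp Q -> subgrp B ->
  (forall s, Q s -> G s) -> (forall s g, Q s -> G g -> Q (s ^ g)) ->
  (forall s t, Q s -> Q t -> B [~ s, t]) ->
  (forall r, List.In r rs -> [/\ sym_or_alt_hom G r, (forall s, Q s -> ~~ odd_perm (tagged r s)) &
     ((tag r < 5)%N -> forall s, Q s -> tagged r s = 1)]) ->
  (forall s, Q s -> (forall r, List.In r rs -> tagged r s = 1) -> B s) ->
  forall s, Q s -> B s.
Proof.
move=> sG; elim: rs Q => [|r rs IHrs] Q sQ sB QG QJ QB rsP kerB.
  by move=> s Qs; apply: kerB.
have rin : List.In r (r :: rs) by left.
have [hr ev small] := rsP r rin; have [H hH HE] := hr.
have [[G1 GM GV] [Q1 QM QV]] := (sG, sQ); have [_ hM _] := hH.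
have rM s t : G s -> G t -> tagged r (s * t) = tagged r s * tagged r t.
  by move=> Gs Gt; apply: hM; apply/asboolP.
have r1 : tagged r 1 = 1 by apply: (mulgI (tagged r 1)); rewrite -rM // !mulg1.
have rV s : G s -> tagged r s^-1 = (tagged r s)^-1.
  by move=> Gs; apply: (mulgI (tagged r s)); rewrite -rM ?mulgV //; apply: GV.
apply: (even_image_step sG sQ sB QG QJ QB hH HE ev small) => s Qs rs1.
apply: (IHrs [set s | Q s /\ tagged r s = 1]) => //.
- split=> [//|u v [Qu ru] [Qv rv]|u [Qu ru]].
    by split; [apply: QM | rewrite rM ?ru ?rv ?mulg1 //; apply: QG].
  by split; [apply: QV | rewrite rV ?ru ?invg1 //; apply: QG].
- by move=> u [/QG].
- move=> u g [Qu ru] Gg; split; first exact: QJ.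
  have Gu := QG _ Qu.
  by rewrite /conjg !rM ?rV ?ru ?mul1g ?mulVg //; auto 10.
- by move=> u v [Qu _] [Qv _]; apply: QB.
- move=> r' r'rs; have [h1 h2 h3] := rsP r' (@or_intror (r = r') _ r'rs).
  by split=> //; [move=> u [Qu _]; apply: h2 | move=> h u [Qu _]; apply: h3].
- move=> u [Qu ru] h; apply: kerB => // r' [<- //|]; exact: h.
Qed.

(** A normal subgroup of a subdirect product of symmetric and alternating groups
has abelian quotients of exponent dividing 24. The subgroup generated by the 24th
powers has even images, and trivial images in the degrees below 5, where 24 kills
the whole group; this excludes the solvable factors and leaves perfect ones. *)
Lemma pow24_commutators G N B (rs : seq {n & T -> 'S_n}) :
  subgrp G -> subgrp N -> subgrp B ->
  (forall s, N s -> G s) -> (forall s g, N s -> G g -> N (s ^ g)) ->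
  (forall s t, N s -> N t -> B [~ s, t]) ->
  (forall r, List.In r rs -> sym_or_alt_hom G r) ->
  (forall s, N s -> (forall r, List.In r rs -> tagged r s = 1) -> B s) ->
  forall s, N s -> B (s ^+ 24).
Proof.
move=> sG sN sB NG NJ NB rsP kerB s Ns.
pose Q := [set t | exists2 l : seq T, (forall x, x \in l -> N x) & t = \prod_(x <- l) x ^+ 24].
have [[G1 GM GV] [N1 NM NV]] := (sG, sN).
have NX n t : N t -> N (t ^+ n).
  by move=> Nt; elim: n => [//|n IH]; rewrite expgS; apply: NM.
have QN t : Q t -> N t.
  case=> l lN ->; rewrite big_seq; elim/big_ind: _ => // x /lN; exact: NX.
apply: (@even_image_commutators G Q B rs) => //; last 1 first.
- by exists [:: s]; rewrite ?big_seq1 // => x; rewrite inE => /eqP->.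
- split.
  + by exists [::]; rewrite ?big_nil.
  + move=> _ _ [l lN ->] [k kN ->]; exists (l ++ k); last by rewrite big_cat.
    by move=> x; rewrite mem_cat => /orP[/lN|/kN].
  + move=> _ [l lN ->]; exists (rev [seq x^-1 | x <- l]).
      by move=> x; rewrite mem_rev => /mapP[y /lN Ny ->]; apply: NV.
    elim: l {lN} => [|x l IHl]; first by rewrite !big_nil invg1.
    by rewrite big_cons invMg IHl map_cons rev_cons -cats1 big_cat big_seq1 expVgn.
- by move=> t /QN/NG.
- move=> _ g [l lN ->] Gg; exists [seq x ^ g | x <- l].
    by move=> _ /mapP[x /lN Nx ->]; apply: NJ.
  rewrite big_map; elim: l {lN} => [|x l IHl]; first by rewrite !big_nil conj1g.
  by rewrite !big_cons conjMg IHl conjXg.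
- by move=> u v /QN Nu /QN Nv; apply: NB.
- move=> r /rsP hr; have [H [_ hM _] _] := hr.
  have rM u v : G u -> G v -> tagged r (u * v) = tagged r u * tagged r v.
    by move=> Gu Gv; apply: hM; apply/asboolP.
  have r1 : tagged r 1 = 1 by apply: (mulgI (tagged r 1)); rewrite -rM // !mulg1.
  have rX n u : N u -> tagged r (u ^+ n) = tagged r u ^+ n.
    move=> Nu; elim: n => // n IHn; rewrite !expgS rM ?IHn //; apply: NG => //; exact: NX.
  split=> //.
    move=> _ [l lN ->]; elim: l lN => [|x l IHl] lN; first by rewrite big_nil r1 odd_perm1.
    have Nx : N x by apply: lN; rewrite mem_head.
    have lN' y : y \in l -> N y by move=> yl; apply: lN; rewrite inE yl orbT.
    rewrite big_cons rM; [|by apply/NG/NX|by apply/NG/QN; exists l].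
    by rewrite odd_permM rX // (expgnDr _ 12 12) odd_permM addbb IHl.
  move=> n5 _ [l lN ->]; elim: l lN => [|x l IHl] lN; first by rewrite big_nil r1.
  have Nx : N x by apply: lN; rewrite mem_head.
  have lN' y : y \in l -> N y by move=> yl; apply: lN; rewrite inE yl orbT.
  rewrite big_cons rM; [|by apply/NG/NX|by apply/NG/QN; exists l].
  by rewrite rX // IHl // mulg1 expg24_small.
- by move=> t /QN Nt; apply: kerB.
Qed.
End SubdirectSymmetric.

Section Kummer.
Implicit Types (K L M : divringClosed algC) (S : set algC) (s t : autC).

Lemma subgrp_galC L : subgrp (galC L).
Proof. by split; [exact: galC1 | exact: galCM | exact: galCV]. Qed.

Lemma root_set_stable L (f : {poly subfield L}) s x : galC L s ->
  x \in adjoin L (root_set f) -> s x \in adjoin L (root_set f).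
Proof.
move=> Ls; apply: aut_stable_adjoin => [y Ly|y ry].
  by rewrite Ls ?sub_adjoin.
by apply: mem_adjoin; rewrite /root_set /= galC_root.
Qed.

(** An automorphism fixing [L] restricts to the splitting field of [f]; reading the
restriction through the given isomorphism yields a permutation. Surjectivity is
the extension of automorphisms of the splitting field to [algC]. *)
Lemma sym_or_alt_galois_hom L (f : {poly subfield L}) : sym_or_alt f ->
  exists2 r : {n & autC -> 'S_n}, sym_or_alt_hom (galC L) r &
    forall s, galC L s -> tagged r s = 1%g -> fixes_pointwise (root_set f) s.
Proof.
case=> n isoG; set M := adjoin L (root_set f) in isoG *.
have [G [phi [bij phiM] GE]] : exists (G : {set 'S_n}),
    exists2 phi : 'S_n -> subfield M -> subfield M,
    set_bij [set g | g \in G] (aut_over L M) phi /\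
    {in G &, forall g h, phi (g * h)%g = phi g \o phi h} &
    (G = 'Sym_('I_n) \/ G = 'Alt_('I_n))%g.
  case: isoG => [[phi phiP]|[phi phiP]].
    by exists ('Sym_('I_n))%g, phi => //; left.
  by exists ('Alt_('I_n))%g, phi => //; right.
have {}phiM : {in G &, forall g h, phi (g * h)%g = phi g \o phi h} by [].
have [phiG phiI phiS] := bij.
have {}phiI g h : g \in G -> h \in G -> phi g = phi h -> g = h.
  by move=> Gg Gh; apply: phiI; apply: mem_set.
have stM s x : galC L s -> x \in M -> s x \in M by apply: root_set_stable.
have ao s : galC L s -> aut_over L M (restr s).
  move=> Ls; apply: restr_aut_over => // x; apply: stM => //; exact: galCV.
have rE s (z : subfield M) : galC L s -> val (restr s z) = s (val z).
  by move=> Ls; apply: restrE; apply: stM => //; apply: valP.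
pose rho s := xget 1%g [set g | g \in G /\ phi g = restr s].
have rhoP s : galC L s -> rho s \in G /\ phi (rho s) = restr s.
  move=> Ls; have [g Gg pg] := phiS _ (ao s Ls).
  by apply: (@xgetPex _ 1%g [set g | g \in G /\ phi g = restr s]); exists g.
have grpG g h : g \in G -> h \in G -> (g * h)%g \in G.
  by case: GE => ->; apply: groupM.
have restrM s t : galC L s -> galC L t -> restr (s * t)%g = restr s \o restr t :> (subfield M -> _).
  move=> Ls Lt; apply: funext => z; apply: val_inj.
  by rewrite rE ?[RHS]rE ?rE ?autM //; apply: galCM.
exists (Tagged (fun n => autC -> 'S_n) rho).
  exists G => //; split.
  - by move=> s /rhoP[].
  - move=> s t /asboolP Ls /asboolP Lt.
    have [Gs ps] := rhoP s Ls; have [Gt pt] := rhoP t Lt.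
    have [Gst pst] := rhoP _ (galCM Ls Lt).
    by apply: phiI => //=; [apply: grpG | rewrite phiM // pst ps pt restrM].
  - move=> h Gh; have [t Lt tP] := aut_over_extend (@sub_adjoin L _) (phiG h Gh).
    exists t => //; have [Gt pt] := rhoP t Lt.
    apply: phiI => //=; rewrite pt; apply: funext => z; apply: val_inj.
    by rewrite rE.
move=> s Ls /= rs x rx; have Mx : x \in M by apply: mem_adjoin.
have [_] := rhoP s Ls; have [_] := rhoP _ (@galC1 L); rewrite rs.
have -> : rho 1%g = 1%g.
  have [G1 p1] := rhoP _ (@galC1 L); apply: (mulgI (rho 1%g)); rewrite mulg1.
  apply: phiI => //; first exact: grpG.
  have r1 (z : subfield M) : restr 1%g z = z.
    by apply: val_inj; rewrite rE //; exact: galC1.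
  by rewrite phiM // p1; apply: funext => z; rewrite /= !r1.
move=> -> /(congr1 (fun f => val (f (Sub x Mx : subfield M)))).
by rewrite !rE //; exact: galC1.
Qed.

(** * Radicals in the tower *)

Definition unity (z : algC) := exists2 n, (0 < n)%N & z ^+ n = 1.

Lemma unityM x y : unity x -> unity y -> unity (x * y).
Proof.
move=> [m m0 xm] [n n0 yn]; exists (m * n)%N; first by rewrite muln_gt0 m0.
by rewrite exprMn exprM xm expr1n mulnC exprM yn expr1n mulr1.
Qed.

Lemma unityV x : unity x -> unity x^-1.
Proof. by move=> [m m0 xm]; exists m => //; rewrite exprVn xm invr1. Qed.

Lemma unityX x k : unity x -> unity (x ^+ k).
Proof. by move=> [m m0 xm]; exists m => //; rewrite exprAC xm expr1n. Qed.

Lemma unity_neq0 x : unity x -> x != 0.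
Proof.
move=> [m m0 xm]; apply: contra_eq_neq xm => ->.
by rewrite expr0n gtn_eqF //= eq_sym oner_eq0.
Qed.

(** An element of the compositum involves finitely many polynomials, so only finitely
many of the symmetric and alternating quotients matter for it. *)
Lemma sa_compositum_finite L M y : y \in adjoin (field_sa L) [set x | x \in M] ->
  exists rs : seq {n & autC -> 'S_n},
    (forall r, List.In r rs -> sym_or_alt_hom (galC L) r) /\
    forall s, galC L s -> galC M s ->
      (forall r, List.In r rs -> tagged r s = 1%g) -> s y = y.
Proof.
pose P y := exists rs : seq {n & autC -> 'S_n},
    (forall r, List.In r rs -> sym_or_alt_hom (galC L) r) /\
    forall s, galC L s -> galC M s ->
      (forall r, List.In r rs -> tagged r s = 1%g) -> s y = y.
have PB u v : P u -> P v -> P (u - v) /\ P (u / v).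
  move=> [ru [ru1 ru2]] [rv [rv1 rv2]]; split; exists (ru ++ rv); split.
  - by move=> r hr; have [/ru1|/rv1] := @List.in_app_or _ _ _ _ hr.
  - move=> s Ls Ms rs; rewrite rmorphB /= ru2 ?rv2 // => r hr; apply: rs;
      apply: List.in_or_app; by [left|right].
  - by move=> r hr; have [/ru1|/rv1] := @List.in_app_or _ _ _ _ hr.
  - move=> s Ls Ms rs; rewrite fmorph_div /= ru2 ?rv2 // => r hr; apply: rs;
      apply: List.in_or_app; by [left|right].
have Psa u : u \in field_sa L -> P u.
  apply: (@adjoin_ind L _ P) => [x Lx|x z Px Pz|x z Px Pz|x [f [_ saf fx]]].
  - by exists [::]; split=> // s Ls _ _; apply: Ls.
  - by have [] := PB x z Px Pz.
  - by have [] := PB x z Px Pz.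
  have [r hr rP] := sym_or_alt_galois_hom saf; exists [:: r]; split=> [_ [<- //|[]]|s Ls Ms rs].
  by apply: rP fx => //; apply: rs; left.
apply: (@adjoin_ind (field_sa L) _ P) => // [u v Pu Pv|u v Pu Pv|x Mx].
- by have [] := PB u v Pu Pv.
- by have [] := PB u v Pu Pv.
- by exists [::]; split=> // s _ Ms _; apply: Ms.
Qed.

(** Let [N] be the group of automorphisms fixing both the abelian closure [L] of [K]
and [M]. For [s] in [N] the quotient [s x / x] is an [n]-th root of unity, and [N]
fixes roots of unity, so [N] acts on [x] through an abelian group. Raising [x] to
the power [d`!] makes the action factor through the symmetric and alternating
quotients, and then 24th powers act trivially. *)
Lemma radical_pow_fixed K M d x n : let L := field_ab K in
  (forall s y, y \in M -> s y \in M) -> (0 < n)%N ->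
  x != 0 -> x \in field_deg (field_sa L) d -> x ^+ n \in M ->
  forall s, galC L s -> galC M s -> s (x ^+ (d`! * 24)) = x ^+ (d`! * 24).
Proof.
move=> L stM n0 x0 Fx xnM; pose y := x ^+ d`!.
pose N : set autC := [set s | galC L s /\ galC M s].
have sN : subgrp N.
  split=> [|s t [Ls Ms] [Lt Mt]|s [Ls Ms]]; split; try exact: galC1; try exact: galCM; exact: galCV.
have zetaP s : N s -> exists z, [/\ unity z, z \in L & s x = z * x].
  move=> [Ls Ms]; pose z := s x / x.
  have zn : z ^+ n = 1.
    by rewrite expr_div_n -rmorphXn /= Ms // divff // expf_neq0.
  exists z; split; [by exists n | exact: unity_mem_ab zn | by rewrite divfK].
have xN s t : N s -> N t -> s (t x) = t (s x).
  move=> Ns Nt; have [z [_ Lz sx]] := zetaP _ Ns; have [w [_ Lw tx]] := zetaP _ Nt.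
  have [[Ls _] [Lt _]] := (Ns, Nt).
  by rewrite tx sx !rmorphM /= (Ls _ Lw) (Lt _ Lz) tx sx mulrCA.
pose B : set autC := [set s | s y = y].
have sB : subgrp B.
  have BE s : B s <-> s y = y by [].
  split=> // [s t /BE Bs /BE Bt|s /BE Bs]; apply/BE; first by rewrite autM Bt.
  by rewrite -{1}Bs autVK.
have BN s : N s -> galC (field_sa L) s -> B s.
  move=> Ns Ls; have [z [_ Lz sx]] := zetaP _ Ns.
  have itx k : (s ^+ k)%g x = z ^+ k * x.
    elim: k => [|k IHk]; first by rewrite expg0 aut1 mul1r.
    by rewrite expgS autM IHk rmorphM rmorphXn /= sx (Ns.1 _ Lz) exprSr mulrA.
  have := @galC_deg _ d s Ls x Fx; rewrite itx -[RHS]mul1r => /(mulIf x0) zd.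
  by rewrite /B /= /y rmorphXn /= sx exprMn zd mul1r.
have ySM : y \in adjoin (field_sa L) [set x | x \in M].
  apply: galC_fixed => s /galC_adjoin[Ls Ms]; apply: BN => //; split=> //.
  by apply: galC_sub Ls; apply: sub_adjoin.
have [rs [rsP rsy]] := sa_compositum_finite ySM.
move=> s Ls Ms; have Ns : N s by [].
have : B (s ^+ 24)%g.
  apply: (pow24_commutators (subgrp_galC L) sN sB _ _ _ rsP) => //.
  - by move=> t [].
  - move=> t g [Lt Mt] Lg; split.
      by rewrite /conjg; apply: galCM; [exact: galCV | apply: galCM].
    by move=> z Mz; rewrite /conjg !autM Mt ?autVK //; apply: stM.
  - move=> t u Nt Nu; have tu : t (u y) = u (t y) by rewrite /y !rmorphXn /= xN.
    by rewrite /B /mkset /commg /conjg !autM tu !autVK.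
  - by move=> t [Lt Mt]; apply: rsy.
have [z [zu Lz sx]] := zetaP _ Ns.
have sy : s y = z ^+ d`! * y by rewrite /y rmorphXn /= sx exprMn.
have y0 : y != 0 by rewrite expf_neq0.
have ity k : (s ^+ k)%g y = (z ^+ d`!) ^+ k * y.
  elim: k => [|k IHk]; first by rewrite expg0 aut1 mul1r.
  by rewrite expgS autM IHk rmorphM /= sy !rmorphXn /= (Ls _ Lz) [_ ^+ k.+1]exprSr mulrA.
move=> B24; have /(mulIf y0) z24 : (z ^+ d`!) ^+ 24 * y = 1 * y by rewrite -ity mul1r.
by rewrite exprM rmorphXn /= sy exprMn z24 mul1r.
Qed.

(** Schinzel's argument. If [s] acts on [n]-th roots of unity as the [k]-th power,
then commutation with every [t] says exactly that [z ^+ k.-1] times a root of unity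
is fixed by all [t], hence in [M]. The exponents of the powers of [z] that lie in [M]
up to a root of unity are the multiples of some [g], so [g] divides [n] and every
[k.-1]; a primitive [g]-th root of unity is then fixed by all [s] and lies in [M],
which bounds [g]. *)
Lemma schinzel_abelian_radical M W z n : (0 < n)%N -> z != 0 -> z ^+ n \in M ->
  (forall s t, galC M s -> galC M t -> s (t z) = t (s z)) ->
  (forall w g, (0 < g)%N -> w \in M -> g.-primitive_root w -> (g <= W)%N) ->
  exists2 w, unity w & z ^+ W`! * w \in M.
Proof.
move=> n0 z0 znM zcomm Wb.
(* The positive part of the ideal of the exponents mentioned above. *)
pose J := [set k | (0 < k)%N /\ exists2 w, unity w & z ^+ k * w \in M].
have Jn : J n by split=> //; exists 1; [exists 1%N; rewrite ?expr1n | rewrite mulr1].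
have exJ : exists k, `[< J k >] by exists n; apply/asboolP.
have [g /asboolP[g0 [w uw gM]] gmin] := ex_minnP exJ.
have w0 := unity_neq0 uw.
have gdvd k : (exists2 w, unity w & z ^+ k * w \in M) -> (g %| k)%N.
  move=> [v uv kM]; rewrite /dvdn eqn0Ngt; apply/negP => r0.
  have : (g <= k %% g)%N.
    apply: gmin; apply/asboolP; split=> //.
    exists (v * (w ^+ (k %/ g))^-1); first by apply: unityM => //; apply/unityV/unityX.
    suff -> : z ^+ (k %% g) * (v * (w ^+ (k %/ g))^-1) = (z ^+ k * v) / (z ^+ g * w) ^+ (k %/ g).
      by rewrite rpred_div ?rpredX.
    have -> : z ^+ k = z ^+ (k %% g) * (z ^+ g) ^+ (k %/ g).
      by rewrite {1}(divn_eq k g) exprD mulrC mulnC exprM.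
    by rewrite exprMn; field; rewrite !expf_neq0.
  by rewrite leqNgt ltn_mod g0.
have [om pom] := C_prim_root_exists n0.
have omn := prim_expr_order pom.
have chiP s : exists2 k, (0 < k)%N & s om = om ^+ k.
  have [k ->] := unity_aut s n0 omn; exists (k + n)%N; first by rewrite addn_gt0 n0 orbT.
  by rewrite exprD omn mulr1.
have chiM s k : galC M s -> (0 < k)%N -> s om = om ^+ k -> (g %| k.-1)%N.
  move=> Ms k0 sk; apply: gdvd.
  have zetaP t : galC M t -> exists2 a, t z = om ^+ a * z & True.
    move=> Mt; have /(prim_rootP pom)[a ta] : (t z / z) ^+ n = 1.
      by rewrite expr_div_n -rmorphXn /= Mt // divff // expf_neq0.
    by exists a => //; rewrite -ta divfK.
  have [a sz _] := zetaP _ Ms.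
  exists (om ^+ a)^-1; first by apply/unityV/unityX; exists n.
  apply: galC_fixed => t Mt; have [b tz _] := zetaP _ Mt.
  rewrite rmorphM fmorphV !rmorphXn /= tz.
  have om0 : om != 0 by apply: unity_neq0; exists n.
  have e0 m : om ^+ m != 0 by rewrite expf_neq0.
  have := zcomm _ _ Ms Mt; rewrite tz sz !rmorphM !rmorphXn /= sk tz sz -exprM.
  rewrite !mulrA => /(mulIf z0) E.
  have E' : om ^+ (b * k.-1) * om ^+ a = t om ^+ a.
    apply: (mulIf (e0 b)); rewrite -E -!exprD; congr (_ ^+ _).
    by rewrite addnAC addnC -mulnSr prednK // addnC mulnC.
  by rewrite -E' exprMn -exprM; field; rewrite !expf_neq0.
have gn : (g %| n)%N by apply: gdvd; have [] := Jn.
have gW : (g <= W)%N.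
  apply: (Wb (om ^+ (n %/ g))) => //; last by apply: dvdn_prim_root.
  apply: galC_fixed => s Ms; have [k k0 sk] := chiP s.
  have /dvdnP[m km] := chiM s k Ms k0 sk.
  rewrite rmorphXn /= sk -(prednK k0) km exprS exprMn -exprM.
  by rewrite -mulnA [(g * _)%N]mulnC divnK // mulnC exprM omn expr1n mulr1.
have /dvdnP[q ->] : (g %| W`!)%N by rewrite dvdn_fact // g0.
exists (w ^+ q); first exact: unityX.
by rewrite mulnC exprM -exprMn rpredX.
Qed.

(** The exponent [e] depends on [d] and on the roots of unity of [M] only, not on [x]
or [n]. Commutators of automorphisms fixing [M] fix the abelian closure of [K], so
the power of [x] fixed by [N] has an abelian Galois closure over [M]. *)
Lemma radical_closure_bound K M d W : {subset K <= M} -> (forall s y, y \in M -> s y \in M) ->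
  (forall w g, (0 < g)%N -> w \in M -> g.-primitive_root w -> (g <= W)%N) ->
  exists2 e, (0 < e)%N &
    forall x n, x \in field_deg (field_sa (field_ab K)) d -> x != 0 ->
    (0 < n)%N -> x ^+ n \in M ->
    exists2 w, unity w & x ^+ e * w \in M.
Proof.
move=> KM stM Wb; exists (d`! * 24 * W`!)%N; first by rewrite !muln_gt0 !fact_gt0.
move=> x n Fx x0 n0 xnM; pose z := x ^+ (d`! * 24).
have fz := radical_pow_fixed stM n0 x0 Fx xnM.
rewrite exprM; apply: (@schinzel_abelian_radical M W z n) => //.
- by rewrite expf_neq0.
- by rewrite /z exprAC rpredX.
move=> s t Ms Mt.
have Ks : galC K s by apply: galC_sub Ms.
have Kt : galC K t by apply: galC_sub Mt.
have : ((t * s)^-1 * (s * t))%g z = z.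
  apply: fz; last by apply: galCM; [apply: galCV; exact: galCM | exact: galCM].
  move=> y Ly; have st : (s * t)%g y = (t * s)%g y.
    by rewrite !autM (galC_ab_comm Ks Kt Ly).
  by rewrite autM st autVK.
by move=> /(canRL (autKV (t * s)%g)).
Qed.

End Kummer.

(** * Pontryagin's criterion for countable groups *)

Section Pontryagin.
Variable A : zmodType.
Implicit Types (s : seq A) (x y a b : A).

Fixpoint zspan s x : Prop :=
  if s is a :: s' then exists k : int, zspan s' (x - a *~ k) else x = 0.

Fixpoint indep s : Prop :=
  if s is a :: s' then indep s' /\ forall k : int, zspan s' (a *~ k) -> k = 0 else True.

Definition pure s := forall x n, (0 < n)%N -> zspan s (x *+ n) -> zspan s x.

Lemma zspan0 s : zspan s 0.
Proof. by elim: s => //= a s IHs; exists 0; rewrite mulr0z subrr. Qed.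

Lemma zspanB s x y : zspan s x -> zspan s y -> zspan s (x - y).
Proof.
elim: s x y => [x y -> ->|a s IHs x y [k sx] [l sy]] /=; first by rewrite subrr.
by exists (k - l); rewrite mulrzBr opprD addrACA -opprD; apply: IHs.
Qed.

Lemma zspanN s x : zspan s x -> zspan s (- x).
Proof. by move=> sx; rewrite -sub0r; apply: zspanB => //; apply: zspan0. Qed.

Lemma zspanD s x y : zspan s x -> zspan s y -> zspan s (x + y).
Proof. by move=> sx sy; rewrite -[y]opprK; apply/zspanB/zspanN. Qed.

Lemma zspanMn s x n : zspan s x -> zspan s (x *+ n).
Proof.
move=> sx; elim: n => [|n IHn]; first by rewrite mulr0n; apply: zspan0.
by rewrite mulrS; apply: zspanD.
Qed.

Lemma zspanMz s x k : zspan s x -> zspan s (x *~ k).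
Proof. by move=> sx; case: k => n; [|apply: zspanN]; apply: zspanMn. Qed.

Lemma zspan_cons a s x : zspan s x -> zspan (a :: s) x.
Proof. by move=> sx /=; exists 0; rewrite mulr0z subr0. Qed.

Lemma zspan_head a s : zspan (a :: s) a.
Proof. by exists 1; rewrite mulr1z subrr; apply: zspan0. Qed.

Lemma zspan_mem s b : b \in s -> zspan s b.
Proof.
elim: s => // a s IHs; rewrite inE => /orP[/eqP->|/IHs]; first exact: zspan_head.
exact: zspan_cons.
Qed.

Lemma zspan_in s (P : A -> Prop) x : P 0 -> (forall x y, P x -> P y -> P (x - y)) ->
  (forall b, b \in s -> P b) -> zspan s x -> P x.
Proof.
move=> P0 PB; elim: s x => [x _ ->//|a s IHs x sP [k sx]].
have PN y : P y -> P (- y) by move=> Py; rewrite -sub0r; apply: PB.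
have PD y z : P y -> P z -> P (y + z).
  by move=> Py Pz; rewrite -[z]opprK; apply: PB => //; apply: PN.
have Pak : P (a *~ k).
  have Pan n : P (a *+ n).
    elim: n => // n IHn; rewrite mulrS; apply: PD => //; apply: sP; exact: mem_head.
  by case: (k) => n; [|apply: PN]; apply: Pan.
rewrite -[x](subrK (a *~ k)); apply: PD => //; apply: IHs sx => b bs.
by apply: sP; rewrite inE bs orbT.
Qed.

Hypothesis tf : forall x n, (0 < n)%N -> x *+ n = 0 -> x = 0.
Hypothesis fg : forall s, exists X : seq A, forall x n, (0 < n)%N -> zspan s (x *+ n) ->
  exists2 y, zspan s y & x - y \in X.

(** The quotient of the pure closure of [a :: s] by the span of [s] is torsion-free
of rank one. As the pure closure is generated by [a :: s] and finitely many further
elements, a common multiple [N] of their denominators clears all of them, and the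
quotient becomes a subgroup of the integers: the coefficient of [a] in [x *+ N]. A
preimage [b] of its least positive element completes the basis. *)
Lemma indep_step s a : indep s -> pure s -> exists s',
  [/\ indep s', pure s', zspan s' a & s' = s \/ exists b, s' = b :: s].
Proof.
move=> ind pur; have [sa|nsa] := EM (zspan s a); first by exists s; split=> //; left.
pose P x := exists2 n, (0 < n)%N & zspan (a :: s) (x *+ n).
have PB x y : P x -> P y -> P (x - y).
  move=> [m m0 mx] [n n0 ny]; exists (m * n)%N; first by rewrite muln_gt0 m0.
  by rewrite mulrnBl mulrnA mulnC mulrnA; apply: zspanB; apply: zspanMn.
have Psp x : zspan (a :: s) x -> P x by exists 1%N.
have P0 : P 0 by apply/Psp/zspan0.
have [X XP] := fg (a :: s).
have [N N0 NX] : exists2 N, (0 < N)%N & forall x, x \in X -> P x -> zspan (a :: s) (x *+ N).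
  elim: X {XP} => [|z X [N N0 IH]]; first by exists 1%N.
  have [[n n0 nz]|nPz] := EM (P z).
    exists (n * N)%N; first by rewrite muln_gt0 n0.
    move=> x; rewrite inE => /orP[/eqP-> _|xX Px].
      by rewrite mulrnA; apply: zspanMn.
    by rewrite mulnC mulrnA; apply: zspanMn; apply: IH.
  by exists N => // x; rewrite inE => /orP[/eqP->//|/IH].
have NP x : P x -> zspan (a :: s) (x *+ N).
  move=> Px; have [n n0 /(XP _ _ n0)[y sy xyX]] := Px.
  rewrite -[x](subrK y) mulrnDl; apply: zspanD; last exact: zspanMn.
  by apply: NX => //; apply: PB => //; apply: Psp.
pose D k := (0 < k)%N /\ exists2 x, P x & zspan s (x *+ N - a *+ k).
(* [D] holds of the positive coefficients of [a] in [x *+ N]; [N] itself comes from [x = a]. *)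
have DN : D N.
  by split=> //; exists a; [apply/Psp/zspan_head | rewrite subrr; apply: zspan0].
have exD : exists k, `[< D k >] by exists N; apply/asboolP.
have [k0 /asboolP[k0p [b Pb bP]] k0min] := ex_minnP exD.
have PD x y : P x -> P y -> P (x + y).
  by move=> Px Py; rewrite -[y]opprK; apply: (PB) => //; rewrite -[- y]sub0r; apply: (PB).
have PMz x k : P x -> P (x *~ k).
  move=> Px; have Pn n : P (x *+ n) by elim: n => // n IHn; rewrite mulrS; apply: PD.
  by case: k => n; [rewrite -pmulrn | rewrite NegzE mulrNz -pmulrn -sub0r; apply: PB].
have bsP x : P x -> zspan (b :: s) x.
  move=> Px; have [k sk] := NP _ Px.
  exists (k %/ k0)%Z; set q := (k %/ k0)%Z; set x' := x - b *~ q.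
  have Px' : P x' by apply: PB => //; apply: PMz.
  have r0 : (0 <= k %% k0)%Z by rewrite modz_ge0 // -lt0n.
  have rk : (k %% k0 < k0)%Z by rewrite ltz_pmod.
  have kE : k = (q * k0 + (k %% k0)%Z)%R := divz_eq k k0.
  have sx' : zspan s (x' *+ N - a *~ (k %% k0)%Z).
    have -> : x' *+ N - a *~ (k %% k0)%Z = (x *+ N - a *~ k) - (b *+ N - a *+ k0) *~ q.
      have -> : (b *+ N - a *+ k0) *~ q = b *~ q *+ N - a *~ (q * k0).
        by rewrite mulrzBl !pmulrn mulrzAC -!mulrzA [k0%:Z * q]mulrC.
      have -> : a *~ k = a *~ (q * k0) + a *~ (k %% k0)%Z by rewrite {1}kE mulrzDr.
      rewrite mulrnBl opprB [a *~ _ + _]addrC opprD !addrA subrK.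
      by rewrite addrAC.
    by apply: zspanB => //; apply: zspanMz.
  move: r0 rk sx'; case: (k %% k0)%Z => // r _; rewrite ltz_nat -pmulrn => rk sx'.
  have : ~~ (0 < r)%N.
    apply/negP => r0; have : (k0 <= r)%N by apply: k0min; apply/asboolP; split=> //; exists x'.
    by rewrite leqNgt rk.
  rewrite -eqn0Ngt => /eqP r0; move: sx'; rewrite r0 mulr0n subr0.
  exact: pur.
exists (b :: s); split.
- split=> // k sbk; apply/eqP/negPn/negP => kn0; apply: nsa.
  have sak : zspan s (a *+ k0 *~ k).
    have -> : a *+ k0 *~ k = b *~ k *+ N - (b *+ N - a *+ k0) *~ k.
      have bk : b *+ N *~ k = b *~ k *+ N by rewrite !pmulrn mulrzAC.
      by rewrite mulrzBl opprB bk addrCA subrr addr0.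
    by apply: zspanB; [apply: zspanMn | apply: zspanMz].
  apply: (pur _ (k0 * `|k|)%N); first by rewrite muln_gt0 k0p absz_gt0.
  rewrite mulrnA; case: k sak {kn0 sbk} => n //=; rewrite ?pmulrn // NegzE mulrNz.
  by move=> /zspanN; rewrite opprK.
- move=> x n n0 sxn; apply: bsP; suff [m m0 mP] : P (x *+ n).
    by exists (n * m)%N; [rewrite muln_gt0 n0 | rewrite mulrnA].
  apply: (@zspan_in (b :: s)) sxn => // c; rewrite inE => /orP[/eqP->//|cs].
  by apply/Psp/zspan_cons/zspan_mem.
- by apply: bsP; apply/Psp/zspan_head.
- by right; exists b.
Qed.

Lemma indep_uniq s : indep s -> uniq s.
Proof.
elim: s => //= a s IHs [/IHs us Na]; rewrite us andbT; apply/negP => /zspan_mem sa.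
by have := Na 1; rewrite mulr1z => /(_ sa).
Qed.

Lemma zspan_sum s x : uniq s -> zspan s x -> exists f : A -> int, x = \sum_(b <- s) b *~ f b.
Proof.
elim: s x => [x _ ->|a s IHs x /= /andP[nas us] [k /(IHs _ us)[f fE]]].
  by exists (fun=> 0); rewrite big_nil.
exists (fun b => if b == a then k else f b).
rewrite big_cons eqxx -[LHS](subrK (a *~ k)) fE addrC; congr (_ + _).
apply: eq_big_seq => b bs; case: eqP => // ba.
by rewrite -ba bs in nas.
Qed.

Lemma sum_zspan s (f : A -> int) : zspan s (\sum_(b <- s) b *~ f b).
Proof.
elim: s => [|a s IHs]; first by rewrite big_nil.
by exists (f a); rewrite big_cons addrAC subrr add0r.
Qed.

Lemma indep_sum s (f : A -> int) : indep s -> \sum_(b <- s) b *~ f b = 0 ->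
  forall b, b \in s -> f b = 0.
Proof.
elim: s => // a s IHs /= [inds Na]; rewrite big_cons => /eqP; rewrite addr_eq0 => /eqP aE.
have fa : f a = 0 by apply: Na; rewrite aE; apply/zspanN/sum_zspan.
move=> b; rewrite inE => /orP[/eqP->//|]; apply: IHs => //.
by apply/eqP; rewrite -oppr_eq0 -aE fa mulr0z.
Qed.

Lemma sum_finsupp s (c : {fsfun A -> int with 0}) : uniq s ->
  (forall b, b \in finsupp c -> b \in s) ->
  \sum_(b <- finsupp c) b *~ c b = \sum_(b <- s) b *~ c b.
Proof.
move=> us cs; rewrite [RHS](bigID (fun b => b \in finsupp c)) /= [X in _ + X]big1 ?addr0.
  rewrite -[RHS]big_filter; apply: perm_big; apply: uniq_perm.
  - exact: fset_uniq.
  - exact: filter_uniq.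
  - by move=> b; rewrite mem_filter; case: (boolP (b \in finsupp c)) => // /cs->.
by move=> b; rewrite mem_finsupp negbK => /eqP->; rewrite mulr0z.
Qed.

(** Enumerate the group and extend the basis one element at a time. Each stage spans a
pure subgroup and keeps the previous basis as a tail, so the union of the stages is
a basis of the whole group. *)
Lemma free_of_finite_rank (e : nat -> A) : (forall x, exists n, e n = x) -> free_abelian A.
Proof.
move=> eP.
pose good := {s | indep s /\ pure s}.
have good0 : indep [::] /\ pure [::] by split=> // x n n0 /=; apply: tf.
pose next_spec (s s' : good) a := zspan (sval s') a /\
  (sval s' = sval s \/ exists b, sval s' = b :: sval s).
have nextP (s : good) a : {s' : good | next_spec s s' a}.
  apply: cid; case: s => s [i p]; have [s' [i' p' sa' ss']] := indep_step a i p.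
  by exists (exist _ s' (conj i' p')).
pose S := fix S n : good := if n is n'.+1 then sval (nextP (S n') (e n')) else exist _ [::] good0.
pose B n := sval (S n).
have Bnext n : zspan (B n.+1) (e n) /\ {subset B n <= B n.+1}.
  have [h1 h2] := svalP (nextP (S n) (e n)); split=> // b bn; rewrite /B /=.
  by case: h2 => [->//|[c ->]]; rewrite inE bn orbT.
have Bmono m n : (m <= n)%N -> {subset B m <= B n}.
  elim: n => [|n IHn]; first by rewrite leqn0 => /eqP->.
  rewrite leq_eqVlt => /orP[/eqP-> //|/IHn mn] b /mn; exact: (Bnext n).2.
have Bind n : indep (B n) := (svalP (S n)).1.
have Bu n : uniq (B n) by apply: indep_uniq.
exists [set b | exists n, b \in B n] => x.
have [n enx] := eP x.
have [f fE] : exists f : A -> int, x = \sum_(b <- B n.+1) b *~ f b.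
  by apply: zspan_sum => //; rewrite -enx; apply: (Bnext n).1.
pose c : {fsfun A -> int with 0} := [fsfun b in seq_fset tt (B n.+1) => f b].
have cB b : b \in finsupp c -> b \in B n.+1.
  by rewrite mem_finsupp fsfunE seq_fsetE; case: (b \in B n.+1); rewrite ?eqxx.
exists c; split.
  split; first by move=> b /cB ?; exists n.+1.
  rewrite (@sum_finsupp (B n.+1)) // fE; apply: eq_big_seq => b bB.
  by rewrite fsfunE seq_fsetE bB.
move=> c' [c'B xc'].
have [m nm c'm] : exists2 m, (n < m)%N & forall b, b \in enum_fset (finsupp c') -> b \in B m.
  have : forall b, b \in enum_fset (finsupp c') -> exists n, b \in B n by move=> b /c'B.
  elim: (enum_fset (finsupp c')) => [|a r IHr] h; first by exists n.+1.
  have [|m nm rm] := IHr; first by move=> b br; apply: h; rewrite inE br orbT.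
  have [k ak] := h a (mem_head _ _); exists (maxn m k); first by rewrite leq_max nm.
  move=> b; rewrite inE => /orP[/eqP->|/rm].
    exact: (Bmono k _ (leq_maxr _ _)).
  exact: (Bmono m _ (leq_maxl _ _)).
have cm b : b \in finsupp c -> b \in B m by move=> /cB; apply: Bmono.
have xc : x = \sum_(b <- B m) b *~ c b.
  rewrite -sum_finsupp // (@sum_finsupp (B n.+1)) // fE; apply: eq_big_seq => b bB.
  by rewrite fsfunE seq_fsetE bB.
have d0 : \sum_(b <- B m) b *~ (c b - c' b) = 0.
  under eq_bigr => b _ do rewrite mulrzBr.
  by rewrite sumrB -xc -sum_finsupp // -xc' subrr.
apply/fsfunP => b; apply/eqP; rewrite -subr_eq0; apply/eqP.
have [bB|nbB] := boolP (b \in B m); first exact: (indep_sum (Bind m) d0).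
rewrite !fsfun_dflt ?subr0 //; first by apply: contra nbB => /c'm.
by apply: contra nbB => /cm.
Qed.
End Pontryagin.

(** * Finiteness in number fields *)

Section NumberFields.
Implicit Types (K L M : divringClosed algC) (S : set algC) (s t : autC).

Lemma ratr_lift (p : {poly subfield Crat}) : exists q : {poly rat}, map_poly ratr q = map_poly val p.
Proof.
have cP (z : subfield Crat) : {a : rat | val z = ratr a}.
  by apply: cid; apply/CratP/valP.
exists (\poly_(i < size p) sval (cP p`_i)); apply/polyP=> i.
rewrite coef_map coef_poly coef_map; case: ltnP => [_|/(nth_default 0)->].
  exact/esym/(svalP (cP _)).
by rewrite !raddf0.
Qed.

Lemma minCpoly_dvd (p : {poly subfield Crat}) x :
  root (map_poly val p) x -> minCpoly x %| map_poly val p.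
Proof.
have [q <-] := ratr_lift p; have [m [-> _] mP] := minCpolyP x.
by rewrite mP => mq; rewrite dvdp_map.
Qed.

Lemma Crat_aut s : galC Crat s.
Proof. by move=> _ /CratP[a ->]; rewrite fmorph_rat. Qed.

Lemma root_minCpoly_conj x y : root (minCpoly x) y <-> exists s : autC, s x = y.
Proof.
split=> [ry|[s <-]]; last by rewrite -(minCpoly_aut s) root_minCpoly.
have [p [irr _ rp _]] := minpoly_subfield Crat x.
have [s _ <-] : exists2 s, galC Crat s & s x = y; last by exists s.
apply: (galC_trans irr rp); have /dvdpP[q ->] := minCpoly_dvd rp.
by rewrite rootM ry orbT.
Qed.

Lemma conj_seq x : exists r : seq algC, forall y, y \in r <-> exists s : autC, s x = y.
Proof.
have [r rE] := closed_field_poly_normal (minCpoly x).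
exists r => y; rewrite -root_minCpoly_conj rE rootZ ?root_prod_XsubC //.
by rewrite lead_coef_eq0 minCpoly_eq0.
Qed.

Lemma stable_perm (l : seq algC) (s : autC) : uniq l -> (forall z, z \in l -> s z \in l) ->
  perm_eq (map s l) l.
Proof.
move=> ul sl; have um : uniq (map s l) by rewrite map_inj_uniq //; apply: fmorph_inj.
have sub : {subset map s l <= l} by move=> _ /mapP[z zl ->]; apply: sl.
have sz : (size l <= size (map s l))%N by rewrite size_map.
by apply: uniq_perm => //; have [] := uniq_min_size um sub sz.
Qed.

Lemma stable_poly_rat (l : seq algC) : uniq l ->
  (forall (s : autC) z, z \in l -> s z \in l) ->
  exists p : {poly subfield Crat}, map_poly val p = \prod_(z <- l) ('X - z%:P).
Proof.
move=> ul sl; apply: lift_poly; apply/polyOverP => i; apply: galC_fixed => s _.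
rewrite -coef_map rmorph_prod; apply: (congr1 (fun p : {poly algC} => p`_i)).
rewrite -[RHS](perm_big _ (stable_perm ul (sl s))) [RHS]big_map; apply: eq_bigr => z _.
by rewrite rmorphB /= map_polyX map_polyC.
Qed.

(** The product of ['X - z] over the conjugates [z] of [x] is invariant, hence
rational, and so is a multiple of the minimal polynomial. *)
Lemma minCpoly_orbit x (r : seq algC) : (forall s : autC, s x \in r) ->
  (size (minCpoly x) <= (size r).+1)%N.
Proof.
move=> rP; have [orb orbP] := conj_seq x.
have oo (s : autC) z : z \in undup orb -> s z \in undup orb.
  by rewrite !mem_undup => /orbP[t <-]; apply/orbP; exists (s * t)%g.
have [p pE] := stable_poly_rat (undup_uniq orb) oo.
have : root (map_poly val p) x.
  by rewrite pE root_prod_XsubC mem_undup; apply/orbP; exists 1%g.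
move=> /minCpoly_dvd; rewrite pE => /dvdp_leq h.
apply: leq_trans (h _) _; first by apply/monic_neq0/monic_prod_XsubC.
rewrite size_prod_XsubC ltnS; apply: uniq_leq_size (undup_uniq _) _ => y.
by rewrite mem_undup => /orbP[s <-].
Qed.

Lemma coef_prod_bound (r : seq algC) (C : nat) i : (forall z, z \in r -> `|z| <= C%:R) ->
  `|(\prod_(z <- r) ('X - z%:P))`_i| <= (C.+1 ^ size r)%:R.
Proof.
elim: r i => [|a r IHr] i rC.
  by rewrite big_nil coef1; case: eqP; rewrite ?normr1 ?normr0 // expn0 ler01.
have {}IHr j := IHr j (fun z zr => rC z (mem_behead (s := a :: r) zr)).
rewrite big_cons mulrBl coefB coefXM coefCM.
apply: le_trans (ler_normB _ _) _; rewrite expnS mulSn natrD natrM; apply: lerD.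
  by case: eqP => _; [rewrite normr0 ler0n | apply: IHr].
by rewrite normrM ler_pM // rC // mem_head.
Qed.

(** The coefficients of the minimal polynomial are integers bounded in terms of [D]
and [C], so there are finitely many minimal polynomials. *)
Lemma northcott (D C : nat) : exists X : seq algC, forall x, x \in Aint ->
  (size (minCpoly x) <= D.+1)%N -> (forall s : autC, `|s x| <= C%:R) -> x \in X.
Proof.
pose B := (C.+1 ^ D)%N.
pose P (f : {ffun 'I_D.+1 -> 'I_(B + B).+1}) : {poly algC} :=
  \poly_(i < D.+1) ((f (inord i))%:R - B%:R).
pose rts (p : {poly algC}) := sval (closed_field_poly_normal p).
exists (flatten [seq rts (P f) | f <- enum {: {ffun 'I_D.+1 -> 'I_(B + B).+1}}]) => x.
rewrite /Aint => xint sx xC.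
have [r rE] := closed_field_poly_normal (minCpoly x).
have mx := minCpoly_monic x; rewrite (monicP mx) scale1r in rE.
have rC z : z \in r -> `|z| <= C%:R.
  by rewrite -root_prod_XsubC -rE => /root_minCpoly_conj[s <-].
have sr : (size r <= D)%N by move: sx; rewrite rE size_prod_XsubC.
have cB i : `|(minCpoly x)`_i| <= B%:R.
  by rewrite rE; apply: le_trans (coef_prod_bound i rC) _; rewrite ler_nat leq_pexp2l.
have fP (i : 'I_D.+1) : exists k : 'I_(B + B).+1, (minCpoly x)`_i = k%:R - B%:R.
  have /intrP[m mE] : (minCpoly x)`_i \is a Num.int by apply: (polyOverP xint).
  have := cB i; rewrite mE -intr_norm -[B%:R]/(B%:Z%:~R) ler_int ler_norml => /andP[mB1 mB2].
  have mB0 : 0 <= m + B%:Z by rewrite -lerBlDr sub0r.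
  have kB : (absz (m + B%:Z)%R < (B + B).+1)%N.
    by rewrite ltnS -lez_nat gez0_abs // PoszD lerD2r.
  exists (Ordinal kB); rewrite /= [_%:R in RHS]pmulrn gez0_abs //.
  by rewrite intrD addrK.
pose f := [ffun i => sval (cid (fP i))].
apply/flattenP; exists (rts (P f)).
  by apply/mapP; exists f; rewrite ?mem_enum.
suff E : P f = minCpoly x.
  have := svalP (closed_field_poly_normal (P f)); rewrite -/(rts _) {1 2}E.
  rewrite (monicP mx) scale1r => Er.
  by rewrite -root_prod_XsubC -Er root_minCpoly.
apply/polyP => i; rewrite coef_poly; case: ltnP => [iD|Di].
  by rewrite ffunE -(svalP (cid (fP (inord i)))) inordK.
by rewrite nth_default // (leq_trans sx).
Qed.

Lemma Aint_root_exp (x : algC) n : (0 < n)%N -> x ^+ n \in Aint -> x \in Aint.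
Proof.
move=> n0 xn; have mx := minCpoly_monic (x ^+ n).
have sX : (1 < size ('X^n : {poly algC}))%N by rewrite size_polyXn ltnS.
apply: (@root_monic_Aint (minCpoly (x ^+ n) \Po 'X^n)).
- by rewrite /root horner_comp hornerXn; apply: root_minCpoly.
- by rewrite monicE lead_coef_comp // (monicP mx) lead_coefXn expr1n mulr1.
- by apply: polyOver_comp; [exact: xn | rewrite rpredX // polyOverX].
Qed.

(** Number fields that are Galois over the rationals, in the only form that is
needed: stability, and a bound for the degrees of the elements. This spares any
computation of degrees of composite fields. *)
Definition finite_galois M := [/\ forall (s : autC) y, y \in M -> s y \in M &
  exists D, forall x, x \in M -> (size (minCpoly x) <= D.+1)%N].

(** The field generated by all the conjugates of the given elements. The conjugates
of one of its elements are determined by the permutation of the generators, so their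
number is bounded. *)
Lemma finite_galois_ex (r : seq algC) : exists2 M, finite_galois M & forall x, x \in r -> x \in M.
Proof.
pose cs x := sval (cid (conj_seq x)).
have csP x y : y \in cs x <-> exists s : autC, s x = y := svalP (cid (conj_seq x)) y.
pose S := flatten [seq cs x | x <- r].
have SP y : y \in S <-> exists2 x, x \in r & exists s : autC, s x = y.
  split=> [/flattenP[_ /mapP[x xr ->] /csP h]|[x xr /csP h]]; first by exists x.
  by apply/flattenP; exists (cs x) => //; apply/mapP; exists x.
have stS (s : autC) y : y \in S -> s y \in S.
  move=> /SP[x xr [t <-]]; apply/SP; exists x => //; by exists (s * t)%g.
pose M : divringClosed algC := gen_field [set x | x \in S].
have SM y : y \in S -> y \in M by move=> yS; apply: mem_gen_field.
exists M; last by move=> x xr; apply/SM/SP; exists x => //; exists 1%g.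
split=> [s y|].
  apply: (@gen_field_ind _ [set y | s y \in M]) => /=.
  - by rewrite rmorph1 rpred1.
  - by move=> u v su sv; rewrite rmorphB rpredB.
  - by move=> u v su sv; rewrite fmorph_div rpred_div.
  - by move=> x /= /stS/SM.
pose T := {ffun seq_sub S -> seq_sub S}.
pose realizes (f : T) (s : autC) := forall x : seq_sub S, s (val x) = val (f x).
pose pick f := xget 1%g [set s | realizes f s].
exists #|T| => x xM.
have -> : #|T| = size [seq pick f x | f <- enum {: T}] by rewrite size_map -cardE.
apply: minCpoly_orbit => s.
pose f : T := [ffun z => SeqSub (stS s _ (valP z))].
have fs : realizes f s by move=> z; rewrite ffunE.
have fp : realizes f (pick f) by apply: (@xgetPex _ 1%g [set s | realizes f s]); exists s.
apply/mapP; exists f; first by rewrite mem_enum.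
move: x xM; apply: gen_field_ind => /=.
- by rewrite !rmorph1.
- by move=> u v su sv; rewrite !rmorphB /= su sv.
- by move=> u v su sv; rewrite !fmorph_div /= su sv.
- by move=> y /= yS; rewrite (fs (SeqSub yS)) (fp (SeqSub yS)).
Qed.

Lemma number_field_fg K : number_field K -> exists r : seq algC,
  forall M, (forall x, x \in r -> x \in M) -> {subset K <= M}.
Proof.
move=> [n [_ [e [eK eP]]]]; exists [seq e i | i <- enum 'I_n] => M rM x /eP[c [-> _]].
apply: rpred_sum => i _; apply: rpredM; first by apply/Crat_sub/valP.
by apply: rM; apply/mapP; exists i; rewrite ?mem_enum.
Qed.

Lemma unity_norm z : unity z -> `|z| = 1.
Proof.
move=> [n n0 zn]; apply/eqP; rewrite -(@pexpr_eq1 _ _ n) //; by rewrite -normrX zn normr1.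
Qed.

Lemma unity_aut_unity (s : autC) z : unity z -> unity (s z).
Proof. by move=> [n n0 zn]; exists n; rewrite // -rmorphXn zn rmorph1. Qed.

Lemma unity_Aint z : unity z -> z \in Aint.
Proof. by move=> [n n0 zn]; apply: (Aint_root_exp n0); rewrite zn. Qed.

(** The powers of a root of unity are algebraic integers all of whose conjugates have modulus one. *)
Lemma finite_galois_unity M : finite_galois M -> exists W,
  forall w g, (0 < g)%N -> w \in M -> g.-primitive_root w -> (g <= W)%N.
Proof.
move=> [_ [D DP]]; have [X XP] := northcott D 1.
exists (size X) => w g g0 wM pw; pose l := [seq w ^+ i | i <- iota 0 g].
have ul : uniq l.
  rewrite map_inj_in_uniq ?iota_uniq // => i j; rewrite !mem_iota /= !add0n => ig jg.
  by move/eqP; rewrite (eq_prim_root_expr pw) !modn_small // => /eqP.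
rewrite -(size_iota 0 g) -(size_map (fun i => w ^+ i)).
apply: (uniq_leq_size ul) => _ /mapP[i _ ->].
have uw : unity (w ^+ i) by apply: unityX; exists g => //; apply: prim_expr_order pw.
apply: XP; [exact: unity_Aint | by apply: DP; rewrite rpredX |].
by move=> s; rewrite unity_norm //; apply: unity_aut_unity.
Qed.

(** Multiplicative counterpart of [zspan]: the subgroup generated by [r] and by all
the roots of unity. *)
Fixpoint uspan (r : seq algC) (a : algC) : Prop :=
  if r is x :: r' then exists k : int, uspan r' (a / x ^ k) else unity a.

(** Products of powers of the elements of [r] with exponents less than [N], up to a root
of unity. *)
Fixpoint box N (r : seq algC) (a : algC) : Prop :=
  if r is x :: r' then exists2 k : nat, (k < N)%N & box N r' (a / x ^+ k) else unity a.

Lemma unity1 : unity 1. Proof. by exists 1%N. Qed.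

(** Euclidean division of the exponents by [N]. *)
Lemma uspan_box N r M a : (forall x, x \in r -> x != 0 /\ x \in M) -> (0 < N)%N ->
  uspan r a -> exists v, [/\ uspan r v, v != 0, v \in M & box N r (a / v ^+ N)].
Proof.
move=> + N0; elim: r a => [a _ ua|x r IHr a rP /= [k kr]].
  by exists 1; split; [exact: unity1 | exact: oner_neq0 | exact: rpred1 | rewrite expr1n divr1].
have [x0 xM] := rP x (mem_head _ _).
have [|v [rv v0 vM bv]] := IHr _ _ kr.
  by move=> y yr; apply: rP; rewrite inE yr orbT.
pose q := (k %/ N)%Z; have kE : k = q * N + (k %% N)%Z := divz_eq k N.
have r0 : (0 <= k %% N)%Z by rewrite modz_ge0 // -lt0n.
have rk : (k %% N < N)%Z by rewrite ltz_pmod.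
exists (v * x ^ q); split.
- by exists q; rewrite mulfK // expfz_neq0.
- by rewrite mulf_neq0 ?expfz_neq0.
- by rewrite rpredM //; case: (q) => n; rewrite ?rpredV rpredX.
move: kE r0 rk; case: (k %% N)%Z => // n kE _ nN; exists n => //.
suff -> : a / (v * x ^ q) ^+ N / x ^+ n = a / x ^ k / v ^+ N by [].
have -> : x ^ k = (x ^ q) ^+ N * x ^+ n by rewrite kE expfzDr // -exprz_exp -!exprnP.
have : x ^ q != 0 by rewrite expfz_neq0.
by move: (x ^ q) => y y0; rewrite exprMn; field; rewrite !expf_neq0.
Qed.

Lemma norm_bound_seq (orb : seq algC) : exists c : nat, forall y, y \in orb -> `|y| <= c%:R.
Proof.
elim: orb => [|z orb [c cP]]; first by exists 0%N.
exists (maxn c (Num.bound `|z|)) => y; rewrite inE => /orP[/eqP->|/cP h].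
  by apply: le_trans (ltW (archi_boundP (normr_ge0 z))) _; rewrite ler_nat leq_maxr.
by apply: le_trans h _; rewrite ler_nat leq_maxl.
Qed.

(** If [m] clears the denominators of the minimal polynomial [p] of [x], of degree
[n], then [m%:R ^+ (n - i) * p`_i] are the coefficients of a monic integral
polynomial that vanishes at [m%:R * x]. *)
Lemma Aint_denominator x : exists2 m, (0 < m)%N & m%:R * x \in Aint.
Proof.
have [p [pE mp] _] := minCpolyP x.
have [q [a a0 qE]] := rat_poly_scale p.
pose m := `|a|%N; have m0 : (0 < m)%N by rewrite absz_gt0.
have mint i : m%:R * (minCpoly x)`_i \is a Num.int.
  rewrite pE qE linearZ /= coefZ !coef_map /= ratr_int mulrA.
  rewrite fmorphV /= ratr_int.
  have -> : m%:R = (sgz a)%:~R * a%:~R :> algC by rewrite -intrM -abszEsg pmulrn.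
  by rewrite mulfK ?intr_eq0 // -intrM rpred_int.
exists m => //; pose n := (size (minCpoly x)).-1.
have sE : size (minCpoly x) = n.+1 by rewrite prednK // ltnW // size_minCpoly.
have lc : (minCpoly x)`_n = 1 by have /monicP := minCpoly_monic x.
pose g := \poly_(i < n.+1) (m%:R ^+ (n - i) * (minCpoly x)`_i).
have sg : size g = n.+1 by rewrite size_poly_eq // subnn lc expr0 mul1r oner_neq0.
apply: (@root_monic_Aint g).
- rewrite /root horner_poly.
  have := root_minCpoly x; rewrite rootE horner_coef sE => /eqP h.
  rewrite (_ : \sum_(i < _) _ = m%:R ^+ n * \sum_(i < n.+1) (minCpoly x)`_i * x ^+ i).
    by rewrite h mulr0.
  rewrite mulr_sumr; apply: eq_bigr => i _; rewrite exprMn.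
  have -> : m%:R ^+ n = m%:R ^+ (n - i) * m%:R ^+ i :> algC.
    by rewrite -exprD subnK // -ltnS.
  by ring.
- by rewrite monicE lead_coefE sg coef_poly ltnSn subnn lc expr0 mul1r.
- apply/polyOverP => i; rewrite coef_poly; case: ltnP => // iN; last exact: rpred0.
  have [->|ni] := eqVneq i n; first by rewrite lc mulr1 rpredX // rpred_nat.
  have : (0 < n - i)%N by rewrite subn_gt0 ltn_neqAle ni.
  case: (n - i)%N => // j _; rewrite exprSr -mulrA rpredM //.
  by rewrite rpredX // rpred_nat.
Qed.

(** The bounds are [N]-th powers of constants, so they pass to [N]-th roots of the
elements of the box. *)
Lemma box_bound r : (forall x, x \in r -> x != 0) -> exists m c : nat, (0 < m)%N /\
  forall N b, box N r b -> m%:R ^+ N * b \in Aint /\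
    forall s : autC, `|s (m%:R ^+ N * b)| <= c%:R ^+ N.
Proof.
elim: r => [_|x r IHr r0].
  exists 1%N, 1%N; split=> // N b /= ub; rewrite !expr1n mul1r; split; first exact: unity_Aint.
  by move=> s; rewrite unity_norm //; apply: unity_aut_unity.
have [|m [c [m0 mcP]]] := IHr; first by move=> y yr; apply: r0; rewrite inE yr orbT.
have x0 : x != 0 by apply: r0; apply: mem_head.
have [d d0 dx] := Aint_denominator x.
have [orb orbP] := conj_seq (d%:R * x); have [f fP] := norm_bound_seq orb.
pose f' := maxn d f.
exists (m * d)%N, (c * f')%N; split=> [|N b /= [k kN /mcP[h1 h2]]]; first by rewrite muln_gt0 m0.
have E : (m * d)%:R ^+ N * b = m%:R ^+ N * (b / x ^+ k) * ((d%:R * x) ^+ k * d%:R ^+ (N - k)).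
  rewrite natrM exprMn -{2}(subnKC (ltnW kN)) exprD exprMn; field.
  by rewrite expf_neq0.
rewrite E; split=> [|s].
  by rewrite rpredM // rpredM // rpredX // Aint_Cnat // rpred_nat.
rewrite rmorphM normrM natrM [(_ * f'%:R) ^+ N]exprMn.
apply: ler_pM; rewrite ?normr_ge0 //; first exact: h2.
rewrite rmorphM !rmorphXn /= rmorph_nat normrM !normrX normr_nat.
have -> : f'%:R ^+ N = f'%:R ^+ k * f'%:R ^+ (N - k) :> algC.
  by rewrite -exprD subnKC // ltnW.
apply: ler_pM; rewrite ?exprn_ge0 ?ler0n ?normr_ge0 //.
  apply: lerXn2r; rewrite ?nnegrE ?normr_ge0 ?ler0n //.
  apply: le_trans (fP _ _) _; first by apply/orbP; exists s.
  by rewrite ler_nat leq_maxr.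
by apply: lerXn2r; rewrite ?nnegrE ?ler0n // ler_nat leq_maxl.
Qed.

(** Dividing [u] by a product of powers of the elements of [r] brings [u ^+ N] in the
box of side [N], so that [u] has bounded denominator and bounded conjugates and
Northcott's theorem applies. *)
Lemma finite_galois_pure_fg M r : finite_galois M -> (forall x, x \in r -> x != 0 /\ x \in M) ->
  exists X : seq algC, forall u N, u \in M -> u != 0 -> (0 < N)%N -> uspan r (u ^+ N) ->
    exists v, [/\ uspan r v, v != 0, v \in M & u / v \in X].
Proof.
move=> [_ [D DP]] rP.
have [|m [c [m0 mcP]]] := @box_bound r; first by move=> x /rP[].
have [X XP] := northcott D c.
exists [seq y / m%:R | y <- X] => u N uM u0 N0 /(uspan_box rP N0)[v [rv v0 vM bv]].
exists v; split=> //; apply/mapP; exists (m%:R * (u / v)); last first.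
  by rewrite [RHS]mulrC mulKf // pnatr_eq0 -lt0n.
have E : m%:R ^+ N * (u ^+ N / v ^+ N) = (m%:R * (u / v)) ^+ N.
  by rewrite exprMn expr_div_n.
have [h1 h2] := mcP _ _ bv; rewrite E in h1 h2.
apply: XP.
- exact: Aint_root_exp h1.
- by apply: DP; rewrite rpredM ?rpred_nat ?rpred_div.
- move=> s; have := h2 s; rewrite rmorphXn normrX.
  by rewrite ler_pXn2r // ?nnegrE ?normr_ge0 ?ler0n.
Qed.

End NumberFields.

(** * The multiplicative group is free modulo torsion *)

Fixpoint bounded_combinations (A : zmodType) e (s : seq A) : seq A :=
  if s is b :: s' then [seq b *+ k + t | k <- iota 0 e, t <- bounded_combinations e s'] else [:: 0].

Lemma zspan_reduce (A : zmodType) e (s : seq A) z : (0 < e)%N -> zspan s z ->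
  exists2 y, zspan s y & z - y *+ e \in bounded_combinations e s.
Proof.
move=> e0; elim: s z => [z ->|b s IHs z [k /IHs[y sy yc]]].
  by exists 0 => //; rewrite mul0rn subrr mem_head.
pose q := (k %/ e)%Z; have kE : k = q * e + (k %% e)%Z := divz_eq k e.
have r0 : (0 <= k %% e)%Z by rewrite modz_ge0 // -lt0n.
have rk : (k %% e < e)%Z by rewrite ltz_pmod.
exists (y + b *~ q); first by exists q; rewrite addrK.
move: kE r0 rk; case: (k %% e)%Z => // n kE _ ne.
apply/allpairsP; exists (n, z - b *~ k - y *+ e); split=> //=.
  by rewrite mem_iota.
have -> : b *~ k = b *~ q *+ e + b *+ n by rewrite kE mulrzDr mulrzA.
rewrite mulrnDl [RHS]addrC [RHS]addrAC [- (_ + b *+ n)]opprD addrA subrK.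
by rewrite opprD addrA addrAC.
Qed.

Section MultiplicativeGroup.
Variables (K : divringClosed algC) (d : nat).
Hypothesis nfK : number_field K.
Hypothesis d0 : (0 < d)%N.
Let F := field_deg (field_sa (field_ab K)) d.
Let A := mod_tors (Gm (subfield F)).
Let Q : zmodQuotType _ _ _ _ := Quotient.quot (@tors (Gm (subfield F))).
Let pA (g : Gm (subfield F)) : A := (\pi_Q g)%qT.

Lemma pA_B g h : pA (g - h) = pA g - pA h.
Proof. exact: (raddfB (\pi_Q)%qT). Qed.

Lemma pA_surj x : exists g, x = pA g.
Proof. by exists (generic_quotient.repr (x : Q)); rewrite /pA reprK. Qed.

Lemma pA_eq0 g : pA g = 0 <-> exists2 n, (0 < n)%N & g *+ n = 0.
Proof.
have E : (pA g == 0) = (g \in @tors (Gm (subfield F))).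
  have pi0 : (\pi_Q 0)%qT = 0 by rewrite raddf0.
  by rewrite -[in RHS](subr0 g) Quotient.idealrBE pi0.
by split=> [/eqP|h]; [rewrite E => /asboolP | apply/eqP; rewrite E; apply/asboolP].
Qed.

(** [cls x a] says that the class [x] is represented by the algebraic number [a]. It
translates between the additive notation of the quotient and products of algebraic
numbers. *)
Definition cls (x : A) (a : algC) := exists2 g : Gm (subfield F), x = pA g & a = val (val g).

Lemma cls_mem x a : cls x a -> a \in F /\ a != 0.
Proof.
by move=> [g _ ->]; split; [apply: valP | have := valP g; apply: contraNneq => h; apply/eqP/val_inj].
Qed.

Lemma cls_of a : a \in F -> a != 0 -> exists x, cls x a.
Proof.
move=> aF a0; have h : (Sub a aF : subfield F) != 0.
  by apply: contraNneq a0 => /(congr1 val) h; apply/eqP.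
pose g : Gm (subfield F) := exist (fun z : subfield F => is_true (z != 0)) _ h.
by exists (pA g), g.
Qed.

Lemma cls_ex x : exists a, cls x a.
Proof. by have [g xg] := pA_surj x; exists (val (val g)), g. Qed.

Lemma clsB x y a b : cls x a -> cls y b -> cls (x - y) (a / b).
Proof.
move=> [g -> ->] [h -> ->]; exists (g - h); first by rewrite pA_B.
by [].
Qed.

Lemma cls0 : cls 0 1.
Proof. by exists 0 => //; rewrite -[X in pA X](subrr 0) pA_B subrr. Qed.

Lemma clsN x a : cls x a -> cls (- x) a^-1.
Proof. by move=> xa; rewrite -sub0r -div1r; apply: clsB => //; apply: cls0. Qed.

Lemma clsD x y a b : cls x a -> cls y b -> cls (x + y) (a * b).
Proof. by move=> xa yb; rewrite -[y]opprK -[b]invrK; apply/clsB/clsN. Qed.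

Lemma clsMn x a n : cls x a -> cls (x *+ n) (a ^+ n).
Proof.
move=> xa; elim: n => [|n IHn]; first exact: cls0.
by rewrite mulrS exprS; apply: clsD.
Qed.

Lemma clsMz x a k : cls x a -> cls (x *~ k) (a ^ k).
Proof. by move=> xa; case: k => n; [|apply: clsN]; apply: clsMn. Qed.

Lemma cls_unity x a : cls x a -> x = 0 <-> unity a.
Proof.
move=> [g -> ->].
have vX n : val (val (g *+ n)) = val (val g) ^+ n.
  elim: n => [|n IHn]; first by rewrite expr0.
  by rewrite exprS -IHn mulrS -rmorphM.
split=> [/pA_eq0[n n0 gn]|[n n0 gn]].
  by exists n => //; rewrite -vX gn.
apply/pA_eq0; exists n => //.
by do 2!apply: val_inj; rewrite vX gn.
Qed.

Lemma cls_inj x y a : cls x a -> cls y a -> x = y.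
Proof.
move=> xa ya; have [_ a0] := cls_mem xa; apply/eqP; rewrite -subr_eq0; apply/eqP.
by apply/(cls_unity (clsB xa ya)); rewrite divff //; apply: unity1.
Qed.

Lemma unity_cls z : unity z -> cls 0 z.
Proof.
move=> uz; have zF : z \in F.
  have [n n0 zn] := uz; do 2!apply: sub_adjoin; exact: unity_mem_ab zn.
have [x xz] := cls_of zF (unity_neq0 uz).
by rewrite -((cls_unity xz).2 uz).
Qed.

Lemma mod_tors_tf (x : A) n : (0 < n)%N -> x *+ n = 0 -> x = 0.
Proof.
move=> n0 xn; have [a xa] := cls_ex x; apply/(cls_unity xa).
have [m m0 am] := (cls_unity (clsMn n xa)).1 xn.
by exists (n * m)%N; rewrite ?exprM // muln_gt0 n0.
Qed.

Let rep (x : A) := sval (cid (cls_ex x)).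
Let repP x : cls x (rep x) := svalP (cid (cls_ex x)).

Lemma zspan_uspan s x a : cls x a -> zspan s x <-> uspan (map rep s) a.
Proof.
elim: s x a => [|b s IHs] x a xa /=; first exact: cls_unity.
by split=> -[k]; move=> /(IHs _ _ (clsB xa (clsMz k (repP b)))) h; exists k.
Qed.

Lemma uspan_cls s v : uspan (map rep s) v -> exists2 z, cls z v & zspan s z.
Proof.
elim: s v => [v uv|b s IHs v /= [k /IHs[z zv sz]]].
  by exists 0; [apply: unity_cls|].
exists (z + b *~ k).
  have [_ b0] := cls_mem (clsMz k (repP b)).
  by rewrite -[v](divfK b0); apply: clsD zv (clsMz k (repP b)).
by exists k; rewrite addrK.
Qed.

(** For [x] in the pure closure of [s], the class [x *+ e] comes from a number field
[M] that contains representatives of [s]; there it differs from the span of [s] by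
finitely many classes. Dividing the coefficients by [e] and using that division by
[e] is unique in a torsion-free group, the same holds for [x] itself. *)
Lemma mod_tors_fg (s : seq A) : exists X : seq A, forall x n, (0 < n)%N -> zspan s (x *+ n) ->
  exists2 y, zspan s y & x - y \in X.
Proof.
pose r := map rep s.
have [rK rKP] := number_field_fg nfK.
have [M gM rM] := finite_galois_ex (r ++ rK).
have KM : {subset K <= M} by apply: rKP => x xr; apply: rM; rewrite mem_cat xr orbT.
have r0 x : x \in r -> x != 0 /\ x \in M.
  move=> xr; split; last by apply: rM; rewrite mem_cat xr.
  by case/mapP: xr => y _ ->; have [] := cls_mem (repP y).
have [W WP] := finite_galois_unity gM; have [stM _] := gM.
have [e e0 eP] := radical_closure_bound d KM stM WP.
have [X XP] := finite_galois_pure_fg gM r0.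
pose cl xi := xget 0 [set x | cls x xi].
have clE x xi : cls x xi -> cl xi = x.
  by move=> h; apply: (cls_inj (@xgetI _ 0 [set x | cls x xi] x h) h).
pose rt z : A := xget 0 [set x | x *+ e = z].
have rtE x z : x *+ e = z -> rt z = x.
  move=> h; have /= h' : rt z *+ e = z := @xgetI _ 0 [set x | x *+ e = z] x h.
  by apply/eqP; rewrite -subr_eq0; apply/eqP/(mod_tors_tf e0); rewrite mulrnBl h h' subrr.
exists [seq rt (cl xi + t) | xi <- X, t <- bounded_combinations e s] => x n n0 sxn.
pose a := rep x; have xa : cls x a := repP x.
have [aF a0] := cls_mem xa.
have anr : uspan r (a ^+ n) by apply/(zspan_uspan s (clsMn n xa)).
have [k k0 akM] : exists2 k, (0 < k)%N & (a ^+ n) ^+ k \in M.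
  elim: (r) (a ^+ n) r0 anr => [b _ [k k0 bk]|b r' IHr c r0 /= [l /IHr[|k k0 kM]]].
  - by exists k => //; rewrite bk rpred1.
  - by move=> z zr; apply: r0; rewrite inE zr orbT.
  - have [b0 bM] := r0 b (mem_head _ _).
    exists k => //; rewrite -[c](divfK (expfz_neq0 l b0)) exprMn rpredM //.
    by rewrite rpredX //; case: (l) => m; rewrite ?rpredV rpredX.
have [w uw wM] : exists2 w, unity w & a ^+ e * w \in M.
  by apply: (eP a (n * k)%N) => //; rewrite ?muln_gt0 ?n0 // exprM.
have [m m0 wm] := uw; pose u := a ^+ e * w.
have u0 : u != 0 by rewrite mulf_neq0 ?expf_neq0 // unity_neq0.
have xu : cls (x *+ e) u by rewrite -[_ *+ e]addr0; apply: clsD (clsMn e xa) (unity_cls uw).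
have ru : uspan r (u ^+ (n * m)).
  apply/(zspan_uspan s (clsMn (n * m) xu)).
  by rewrite -mulrnA mulnCA mulrnA; apply: zspanMn.
have [v [rv v0 vM uvX]] := XP u (n * m)%N wM u0 (ltac:(by rewrite muln_gt0 n0)) ru.
have [z zv sz] := uspan_cls rv.
have [y sy yc] := zspan_reduce e0 sz.
exists y => //; apply/allpairsP; exists (u / v, z - y *+ e); split=> //=.
apply/esym/rtE; rewrite (clE _ _ (clsB xu zv)) mulrnBl.
by rewrite addrA subrK.
Qed.

Lemma mod_tors_free : free_abelian A.
Proof.
pose e n : A := if (choice.unpickle n : option algC) is Some a then xget 0 [set x | cls x a] else 0.
apply: (@free_of_finite_rank A mod_tors_tf mod_tors_fg e) => x.
have [a xa] := cls_ex x; exists (choice.pickle a); rewrite /e choice.pickleK.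
exact: (cls_inj (@xgetI _ 0 [set x | cls x a] x xa) xa).
Qed.
End MultiplicativeGroup.

(** * Landau's inequality *)

Section Landau.
Variable C : numClosedFieldType.
Implicit Types (p q g h : {poly C}) (a z : C).

Definition norm2 p := \sum_(i < size p) `|p`_i| ^+ 2.

Lemma norm2E n p : (size p <= n)%N -> norm2 p = \sum_(i < n) `|p`_i| ^+ 2.
Proof.
move=> pn; rewrite /norm2 (big_ord_widen n (fun i => `|p`_i| ^+ 2)) // big_mkcond.
apply: eq_bigr => i _; case: ltnP => // /(nth_default 0) ->.
by rewrite normr0 expr0n.
Qed.

(** Coefficient by coefficient the squares differ by the increments of
[(`|a| ^+ 2 - 1) * `|g`_i| ^+ 2], which telescope to zero. *)
Lemma norm2_reflect a g : norm2 (('X - a%:P) * g) = norm2 ((a^* *: 'X - 1) * g).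
Proof.
pose n := (size g).+1.
have s1 : (size (('X - a%:P) * g)%R <= n)%N.
  by apply: leq_trans (size_polyMleq _ _) _; rewrite size_XsubC.
have s2 : (size ((a^* *: 'X - 1) * g)%R <= n)%N.
  have sX : (size (a^* *: 'X - 1)%R <= 2)%N.
    apply: leq_trans (size_polyD _ _) _; rewrite geq_max size_polyN size_poly1 andbT.
    by apply: leq_trans (size_scale_leq _ _) _; rewrite size_polyX.
  by apply: leq_trans (size_polyMleq _ _) _; rewrite /n; lia.
rewrite (norm2E s1) (norm2E s2); apply/eqP; rewrite -subr_eq0 -sumrB; apply/eqP.
(* The shift by one makes the increments [t i.+1 - t i] telescope. *)
pose t i := if i is i'.+1 then `|g`_i'| ^+ 2 else 0.
rewrite (eq_bigr (fun i : 'I_n => (`|a| ^+ 2 - 1) * (t i.+1 - t i))); last first.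
  move=> i _; rewrite !mulrBl mul1r !coefB coefXM -scalerAl coefZ coefXM coefCM.
  rewrite !normCK; case: (nat_of_ord i) => [|j] /=; rewrite !rmorphB !rmorphM ?rmorph0 /= ?normCK ?conjCK; ring.
rewrite -mulr_sumr -(big_mkord xpredT (fun i => t i.+1 - t i)) telescope_sumr //.
by rewrite /t /n nth_default // normr0 expr0n subrr mulr0.
Qed.

Definition mahler (r : seq C) := \prod_(z <- r) (if `|z| <= 1 then 1 else `|z|).

(** Reflecting the roots outside the unit disc turns their moduli into the leading
coefficient, without changing the norm. *)
Lemma mahler_lead r h : exists q, norm2 q = norm2 (h * \prod_(z <- r) ('X - z%:P)) /\
  `|lead_coef q| = `|lead_coef h| * mahler r.
Proof.
rewrite /mahler; elim: r h => [|z r IHr] h; first by exists h; rewrite !big_nil !mulr1.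
rewrite !big_cons; case: ifP => [_|z1].
  have [q [q1 q2]] := IHr (h * ('X - z%:P)).
  exists q; split; first by rewrite q1 mulrA.
  by rewrite q2 lead_coefM lead_coefXsubC mulr1 mul1r.
have [q [q1 q2]] := IHr (h * (z^* *: 'X - 1)).
have z0 : z^* != 0.
  by rewrite conjC_eq0; apply: contraFneq z1 => ->; rewrite normr0 ler01.
exists q; split; first by rewrite q1 -!mulrA mulrCA -norm2_reflect mulrCA.
rewrite q2 lead_coefM normrM -!mulrA; congr (_ * (_ * _)).
rewrite lead_coefDl ?lead_coefZ ?lead_coefX ?mulr1 ?norm_conjC //.
by rewrite size_polyN size_poly1 size_scale // size_polyX.
Qed.

Lemma landau_inequality r : mahler r ^+ 2 <= norm2 (\prod_(z <- r) ('X - z%:P)).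
Proof.
have [q [q1 q2]] := mahler_lead r 1.
rewrite mul1r in q1; rewrite lead_coef1 normr1 mul1r in q2.
rewrite -q1 -q2 /norm2 lead_coefE.
have [q0|qn0] := eqVneq (size q) 0%N.
  by rewrite q0 nth_default ?q0 // normr0 expr0n big_ord0.
have sq : ((size q).-1 < size q)%N by rewrite ltn_predL lt0n.
rewrite (bigD1 (Ordinal sq)) //= lerDl; apply: sumr_ge0 => i _.
by rewrite exprn_ge0.
Qed.
End Landau.

(** * An upper bound for the height of an algebraic integer *)

Lemma sum_sub_seq (R : numDomainType) (J : eqType) (phi : J -> R) (l r : seq J) :
  (forall j, 0 <= phi j) -> uniq l -> {subset l <= r} ->
  \sum_(j <- l) phi j <= \sum_(j <- r) phi j.
Proof.
move=> phi0; elim: l r => [r _ _|a l IHl r /= /andP[al ul] lr].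
  by rewrite big_nil sumr_ge0.
have ar : a \in r by apply: lr; rewrite mem_head.
rewrite big_cons (perm_big _ (perm_to_rem ar)) big_cons lerD2l; apply: IHl => // b bl.
have : b \in r by apply: lr; rewrite inE bl orbT.
rewrite (perm_mem (perm_to_rem ar)) inE => /orP[/eqP ba|//].
by rewrite -ba bl in al.
Qed.

Lemma fsbig_le_seq (R : numDomainType) (I : choiceType) (J : eqType) (A : set I)
    (ev : I -> J) (phi : J -> R) (r : seq J) :
  (forall j, 0 <= phi j) -> (forall i j, A i -> A j -> ev i = ev j -> i = j) ->
  (forall i, A i -> ev i \in r) ->
  \sum_(i \in A) phi (ev i) <= \sum_(j <- r) phi j.
Proof.
move=> phi0 inj Ar; case: finite_supportP => [_|X XA _ _].
  by rewrite big_nil sumr_ge0.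
rewrite -(big_map ev predT phi); apply: sum_sub_seq => //.
  rewrite map_inj_in_uniq ?fset_uniq // => i j iX jX; apply: inj; exact: XA.
by move=> _ /mapP[i iX ->]; apply: Ar; apply: XA.
Qed.

Section WeilHeight.
Variable R : realType.

Lemma mahler_normc (r : seq R[i]) :
  mahler r = (\prod_(z <- r) Num.max 1 (ComplexField.Normc.normc z))%:C%C.
Proof.
rewrite /mahler rmorph_prod; apply: eq_bigr => z _.
have -> : `|z| = (ComplexField.Normc.normc z)%:C%C by [].
by rewrite -[1]/(1%:C%C) lecR; case: leP.
Qed.

(** An embedding of the field generated by [x] is determined by the image of [x], a
complex root of [q]; the sum is thus at most the logarithm of the Mahler measure. *)
Lemma embeddings_sum (x : algC) (q : {poly int}) (B : nat) :
  q \is monic -> root (map_poly intr q) x -> (forall i, `|q`_i| <= B%:Z) ->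
  \sum_(s \in embeddings R (gen_field [set x]))
     ln (Num.max 1 (ComplexField.Normc.normc (s (Sub x (mem_gen_field (erefl : [set x] x))))))
  <= ln ((B ^ 2 * size q)%:R : R).
Proof.
move=> mq qx qB; set M := gen_field [set x].
set xs : subfield M := Sub x _.
have qxs : root (map_poly intr q) xs.
  have := qx; rewrite -[x]/(val xs) -(fmorph_root (\val : {rmorphism subfield M -> algC})).
  by rewrite -map_poly_comp (eq_map_poly (g := intr)) // => z; exact: rmorph_int.
pose qC : {poly R[i]} := map_poly intr q.
have mqC : qC \is monic by apply: monic_map.
have [r rE] := closed_field_poly_normal qC; rewrite (monicP mqC) scale1r in rE.
have sxr s : embeddings R M s -> s xs \in r.
  move=> [sB sM]; pose f : {rmorphism subfield M -> R[i]} := HB.pack s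
    (GRing.isZmodMorphism.Build _ _ s sB) (GRing.isMonoidMorphism.Build _ _ s sM).
  rewrite -root_prod_XsubC -rE -[s xs]/(f xs).
  have -> : qC = map_poly f (map_poly intr q).
    by rewrite -map_poly_comp; apply: eq_map_poly => z; exact/esym/rmorph_int.
  by rewrite fmorph_root.
have sinj s t : embeddings R M s -> embeddings R M t -> s xs = t xs -> s = t.
  move=> [sB sM] [tB tM] st.
  pose f : {rmorphism subfield M -> R[i]} := HB.pack s
    (GRing.isZmodMorphism.Build _ _ s sB) (GRing.isMonoidMorphism.Build _ _ s sM).
  pose g : {rmorphism subfield M -> R[i]} := HB.pack t
    (GRing.isZmodMorphism.Build _ _ t tB) (GRing.isMonoidMorphism.Build _ _ t tM).
  have fg y : y \in M -> exists2 z : subfield M, val z = y & f z = g z.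
    apply: (@gen_field_ind _ [set y | exists2 z : subfield M, val z = y & f z = g z]).
    - by exists 1; [by [] | rewrite (rmorph1 f) (rmorph1 g)].
    - by move=> _ _ [u <- hu] [v <- hv]; exists (u - v);
        [by [] | rewrite (rmorphB f) (rmorphB g) hu hv].
    - by move=> _ _ [u <- hu] [v <- hv]; exists (u / v);
        [by [] | rewrite (fmorph_div f) (fmorph_div g) hu hv].
    - by move=> _ ->; exists xs.
  by apply: funext => z; have [z' /val_inj -> ] := fg _ (valP z).
pose phi (z : R[i]) := ln (Num.max 1 (ComplexField.Normc.normc z)).
have max1 (z : R[i]) : 1 <= Num.max 1 (ComplexField.Normc.normc z) by rewrite le_max lexx.
have phi0 z : 0 <= phi z by apply: ln_ge0.
apply: le_trans (fsbig_le_seq phi0 sinj sxr) _.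
pose m := \prod_(z <- r) Num.max 1 (ComplexField.Normc.normc z).
have m1 : 1 <= m.
  rewrite /m; elim/big_ind: _ => // [u v u1 v1]; exact: mulr_ege1.
have -> : \sum_(z <- r) phi z = ln m.
  rewrite /m; elim: (r) => [|z r' IH]; first by rewrite !big_nil ln1.
  rewrite !big_cons lnM ?posrE ?IH //; first exact: lt_le_trans ltr01 _.
  apply: lt_le_trans ltr01 _; elim/big_ind: _ => // [u v u1 v1]; exact: mulr_ege1.
have m0 : 0 < m by apply: lt_le_trans m1.
(* Landau's inequality bounds the square of [m], which is at least [m]. *)
have mm : m <= m ^+ 2 by rewrite expr2 ler_peMl // ltW.
suff h : m ^+ 2 <= (B ^ 2 * size q)%:R.
  by rewrite ler_ln ?posrE //; [apply: le_trans h | apply: lt_le_trans h; apply: exprn_gt0].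
rewrite -lecR rmorphXn /= -mahler_normc; apply: le_trans (landau_inequality r) _.
have sq : size qC = size q by apply: size_map_inj_poly => //; apply: intr_inj.
rewrite -rE /norm2 sq rmorph_nat mulnC natrM mulr_natl -[X in _ *+ X](card_ord (size q)) -sumr_const.
apply: ler_sum => i _; rewrite coef_map /= -intr_norm natrX.
rewrite lerXn2r ?nnegrE ?ler0n ?ler0z ?normr_ge0 //.
by rewrite -[B%:R]/(B%:Z%:~R) ler_int.
Qed.

(** If [v xs] were negative, then [xs^-1] would lie in the valuation ring, and the
equation divided by a power of [xs] would express [xs] as an element of this ring. *)
Lemma valuation_int_ge0 (M : divringClosed algC) v (xs : subfield M) (q : {poly int}) :
  valuations M v -> q \is monic -> root (map_poly intr q) xs -> 0 <= v xs.
Proof.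
move=> [v0 vM vD _] mq qx.
have [->|x0] := eqVneq xs 0; first by rewrite v0.
have vMul y z : y != 0 -> z != 0 -> v (y * z) = v y + v z by move=> y0 z0; apply: vM.
have v1 : v 1 = 0.
  by apply: (addrI (v 1)); rewrite -vMul ?oner_neq0 // mulr1 addr0.
have vD' y z : 0 <= v y -> 0 <= v z -> 0 <= v (y + z).
  move=> y0 z0; have [->|yn0] := eqVneq y 0; first by rewrite add0r.
  have [->|zn0] := eqVneq z 0; first by rewrite addr0.
  have [->|yzn0] := eqVneq (y + z) 0; first by rewrite v0.
  by apply: le_trans (vD _ _ yn0 zn0 yzn0); rewrite le_min y0.
have vM' y z : 0 <= v y -> 0 <= v z -> 0 <= v (y * z).
  move=> y0 z0; have [->|yn0] := eqVneq y 0; first by rewrite mul0r v0.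
  have [->|zn0] := eqVneq z 0; first by rewrite mulr0 v0.
  by rewrite vMul // addr_ge0.
have vN1 : v (-1) = 0.
  have h : v (-1) + v (-1) = 0 by rewrite -vMul ?oppr_eq0 ?oner_neq0 // mulrNN mulr1.
  by apply/eqP; move/eqP: h; rewrite -mulr2n mulrn_eq0.
have vnat n : 0 <= v n%:R.
  by elim: n => [|n IHn]; rewrite ?v0 // -natr1; apply: vD'; rewrite ?v1.
have vint (z : int) : 0 <= v z%:~R.
  case: z => n; first exact: vnat.
  by rewrite NegzE mulrNz -mulN1r; apply: vM'; rewrite ?vN1 //; apply: vnat.
rewrite leNgt; apply/negP => vx.
pose u := xs^-1; have u0 : u != 0 by rewrite invr_eq0.
have vu : 0 <= v u.
  have : v xs + v u = 0 by rewrite -vMul // mulfV.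
  by move=> /eqP; rewrite addrC addr_eq0 => /eqP->; rewrite oppr_ge0 ltW.
have vX n : 0 <= v (u ^+ n).
  by elim: n => [|n IHn]; rewrite ?expr0 ?v1 // exprS; apply: vM'.
have sqC : size (map_poly (intr : int -> subfield M) q) = size q.
  by apply: size_map_poly_id0; rewrite (monicP mq); apply: oner_neq0.
have : (1 < size q)%N.
  by rewrite -sqC; apply: root_size_gt1 qx; rewrite monic_neq0 // monic_map.
case E : (size q) => [|[|m]] // _.
have qn : q`_m.+1 = 1 by have := monicP mq; rewrite lead_coefE E.
have qCn : (map_poly (intr : int -> subfield M) q)`_m.+1 = 1.
  by rewrite coef_map qn; exact: mulr1z.
move: qx; rewrite rootE horner_coef sqC E big_ord_recr /= qCn mul1r.
rewrite addrC addr_eq0 => /eqP xE.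
have : xs = - \sum_(i < m.+1) (q`_i)%:~R * u ^+ (m - i).
  apply: (mulIf (expf_neq0 m x0)); rewrite -exprS xE mulNr mulr_suml; congr (- _).
  apply: eq_bigr => i _; rewrite coef_map -mulrA; congr (_ * _).
  have -> : xs ^+ m = xs ^+ (m - i) * xs ^+ i by rewrite -exprD subnK // -ltnS.
  by rewrite mulrA -exprMn mulVf // expr1n mul1r.
move=> xsE; suff : 0 <= v xs by rewrite leNgt vx.
rewrite xsE -mulN1r; apply: (vM' _ _); first by rewrite vN1.
elim/big_ind: _ => [||i _]; [by rewrite v0 | exact: vD' | by apply: vM'].
Qed.

(** Finite places do not contribute. For the archimedean part only the inequality
between the degree of the field generated by [x] and the degree of [q] matters; were
the degree to take its default value [0], the height would be [0]. *)
Lemma weil_height_le (x : algC) (q : {poly int}) (B : nat) :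
  q \is monic -> minCpoly x = map_poly intr q -> (forall i, `|q`_i| <= B%:Z) -> (0 < B)%N ->
  weil_height R x <= (size q).-1%:R^-1 * ln ((B ^ 2 * size q)%:R : R).
Proof.
move=> mq xq qB B0; rewrite /weil_height /height_in.
have rqx : root (map_poly intr q) x by rewrite -xq root_minCpoly.
set M := gen_field [set x]; set xs : subfield M := Sub x _.
have sqC : size (map_poly (intr : int -> algC) q) = size q.
  by apply: size_map_poly_id0; rewrite (monicP mq); apply: oner_neq0.
have sq1 : (1 < size q)%N by rewrite -sqC -xq size_minCpoly.
have ln0 : 0 <= ln ((B ^ 2 * size q)%:R : R).
  by apply: ln_ge0; rewrite ler1n muln_gt0 expn_gt0 B0 ltnW.
rewrite [X in _ + X]fsbig1 ?addr0; last first.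
  move=> v Mv; have : 0 <= v xs.
    apply: (valuation_int_ge0 Mv mq).
    have := rqx; rewrite -[x]/(val xs) -(fmorph_root (\val : {rmorphism subfield M -> algC})).
    by rewrite -map_poly_comp (eq_map_poly (g := intr)) // => z; exact: rmorph_int.
  case: (v xs) => // n _; rewrite -exprnN.
  suff h : ((residue_card v)%:R ^- n : R) <= 1 by rewrite max_l ?ln1.
  case: (residue_card v) => [|k].
    by case: n => [|n]; rewrite ?expr0 ?invr1 // expr0n invr0 ler01.
  by rewrite invf_le1 ?exprn_gt0 ?ltr0Sn // exprn_ege1 // ler1n.
have le_emb := embeddings_sum mq rqx qB.
have emb0 : 0 <= \sum_(s \in embeddings R M) ln (Num.max 1 (ComplexField.Normc.normc (s xs))).
  by apply: sumr_ge0 => s _; apply: ln_ge0; rewrite le_max lexx.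
rewrite /degree; case: xgetP => [D _ hD|_]; last first.
  by rewrite invr0 mul0r mulr_ge0 ?invr_ge0 ?ler0n.
have Dq : ((size q).-1 <= D)%N.
  have [p [p0 sp rp]] := has_degree_poly hD (valP xs).
  rewrite -ltnS prednK ?(ltnW sq1) // -sqC -xq; apply: leq_trans sp.
  rewrite -(size_map_poly (\val : {rmorphism subfield Crat -> algC})).
  by apply: dvdp_leq (minCpoly_dvd rp); rewrite map_poly_eq0.
apply: ler_pM; [by rewrite invr_ge0 ler0n | exact: emb0 | | exact: le_emb].
rewrite lef_pV2 ?posrE ?ltr0n ?ler_nat //; first by apply: leq_trans Dq; rewrite -ltnS prednK // ltnW.
by rewrite -ltnS prednK // ltnW.
Qed.
End WeilHeight.

(** * Frobenius elements *)

(** A maximal ideal containing [a], given by Zorn's lemma. The empty set is admitted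
among the candidates as an upper bound of the empty chain. *)
Lemma residue_field_ex (R : comNzRingType) (a : R) : (forall b, b * a != 1) ->
  exists (k : fieldType) (phi : {rmorphism R -> k}), phi a = 0.
Proof.
move=> na.
pose proper (I : set R) := [/\ I a, forall x y, I x -> I y -> I (x + y),
  forall b x, I x -> I (b * x) & ~ I 1].
(* [set0] bounds the empty chain, and is not maximal. *)
pose P (I : set R) := I = set0 \/ proper I.
have [F FP totF|I [PI maxI]] := @Zorn_bigcup _ P.
  have [[J FJ J0]|nF] := pselect (exists2 J, F J & proper J); last first.
    left; apply/seteqP; split=> // x [J FJ Jx]; case: (FP J FJ) => [J0|pJ].
      by rewrite J0 in Jx.
    by case: nF; exists J.
  right; have Fp G x : F G -> G x -> proper G.
    by move=> /FP[->|//].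
  split.
  - by exists J => //; case: J0.
  - move=> x y [G FG Gx] [H FH Hy]; have [GH|HG] := totF _ _ FG FH.
      by exists H => //; have [_ + _ _] := Fp _ _ FH Hy; apply=> //; apply: GH.
    by exists G => //; have [_ + _ _] := Fp _ _ FG Gx; apply=> //; apply: HG.
  - by move=> b x [G FG Gx]; exists G => //; have [_ _ + _] := Fp _ _ FG Gx; apply.
  - by move=> [G FG G1]; have [_ _ _] := Fp _ _ FG G1; apply.
pose I0 : set R := [set x | exists b, x = b * a].
have pI0 : proper I0.
  split; first by exists 1; rewrite mul1r.
  - by move=> _ _ [b ->] [c ->]; exists (b + c); rewrite mulrDl.
  - by move=> b _ [c ->]; exists (b * c); rewrite mulrA.
  - by case=> b /eqP; rewrite eq_sym; apply/negP.
have [Ia ID IM I1] : proper I.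
  case: PI => // I00; exfalso; apply: (maxI I0); last by right.
  split=> [x|h]; first by rewrite I00.
  by have : I a; [apply: h; case: pI0 | rewrite I00].
pose S : {pred R} := [pred x | `[< I x >]].
have I0' : I 0 by rewrite -(mul0r a); apply: IM.
have Scl : idealr_closed S.
  split; [exact/asboolP | exact/asboolP |] => b x y /asboolP Ix /asboolP Iy.
  by apply/asboolP; apply: ID => //; apply: IM.
pose SI : idealr R := HB.pack S (isIdealr.Build R S Scl).
pose Q : comNzRingType := {ideal_quot SI}.
have piQ : exists pi : {rmorphism R -> Q}, (forall x, pi x = 0 <-> I x) /\ forall y, exists x, y = pi x.
  pose pi : {rmorphism R -> Q} := (\pi_{ideal_quot SI})%qT.
  exists pi; split=> [x|y]; last first.
    by exists (generic_quotient.repr (y : {ideal_quot SI})); rewrite /pi /= reprK.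
  have E : (pi x == 0) = (x \in SI).
    by rewrite -[in RHS](subr0 x) Quotient.idealrBE -(rmorph0 pi).
  by split=> [/eqP|h]; [rewrite E => /asboolP | apply/eqP; rewrite E; apply/asboolP].
have [pi [pi0 piS]] := piQ.
have invP (y : Q) : exists z, y != 0 -> z * y = 1.
  have [x ->] := piS y; have [Ix|nIx] := pselect (I x).
    by exists 0; rewrite (pi0 x).2 ?eqxx.
  pose J : set R := [set u | exists b c, I c /\ u = b * x + c].
  have IJ c : I c -> J c by move=> Ic; exists 0, c; rewrite mul0r add0r.
  have [[b [c [Ic E]]]|nJ1] := pselect (J 1).
    by exists (pi b) => _; rewrite -rmorphM -(rmorph1 pi) E rmorphD (pi0 c).2 // addr0.
  exfalso; apply: (maxI J).
    split=> [|JI]; first exact: IJ.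
    by apply: nIx; apply: JI; exists 1, 0; rewrite mul1r addr0.
  right; split => //; first exact: IJ.
  - move=> _ _ [b [c [Ic ->]]] [b' [c' [Ic' ->]]]; exists (b + b'), (c + c').
    by split; [apply: ID | rewrite mulrDl addrACA].
  - move=> e _ [b [c [Ic ->]]]; exists (e * b), (e * c).
    by split; [apply: IM | rewrite mulrDr mulrA].
pose inv1 (y : Q) := sval (cid (invP y)).
have inv1P (y : Q) : y != 0 -> inv1 y * y = 1 := svalP (cid (invP y)).
pose inv (y : Q) := if y == 0 then 0 else inv1 y.
have mulVf (y : Q) : y != 0 -> inv y * y = 1.
  by move=> y0; rewrite /inv (negPf y0) inv1P.
have inv0 : inv 0 = 0 by rewrite /inv eqxx.
pose k : fieldType := HB.pack (Quotient.quot SI) (GRing.ComNzRing_isField.Build Q mulVf inv0).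
by exists k, pi; apply/pi0.
Qed.

Definition algint := {x : algC | x \in Aint}.
HB.instance Definition _ := SubChoice.on algint.
HB.instance Definition _ := [SubChoice_isSubComNzRing of algint by <:].

Lemma aut_perm n (r : 'I_n -> algC) : injective r ->
  (forall (s : autC) i, exists j, s (r i) = r j) ->
  forall s : autC, exists w : 'S_n, forall i, s (r i) = r (w i).
Proof.
move=> rinj st s; pose f i := sval (cid (st s i)).
have fE i : s (r i) = r (f i) := svalP (cid (st s i)).
have finj : injective f.
  by move=> i j /(congr1 r); rewrite -!fE => /fmorph_inj/rinj.
by exists (perm finj) => i; rewrite permE.
Qed.

Definition gal_perms n (r : 'I_n -> algC) : {set 'S_n} :=
  [set w : 'S_n | `[< exists s : autC, forall i, s (r i) = r (w i) >]]%SET.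

Lemma gal_permsP n (r : 'I_n -> algC) (w : 'S_n) :
  reflect (exists s : autC, forall i, s (r i) = r (w i)) (w \in gal_perms r).
Proof. by rewrite inE; apply: asboolP. Qed.

Lemma gal_perms_group n (r : 'I_n -> algC) : group_set (gal_perms r).
Proof.
apply/group_setP; split; first by apply/gal_permsP; exists 1%g => i; rewrite perm1.
move=> u v /gal_permsP[s sP] /gal_permsP[t tP]; apply/gal_permsP; exists (t * s)%g => i.
by rewrite permM autM sP tP.
Qed.

Canonical gal_perms_grp n (r : 'I_n -> algC) := Group (gal_perms_group r).

(** Kronecker's argument. The polynomial whose roots are the sums
[\sum_i r (w i) *: 'X^i], for [w] in the Galois group, has integer coefficients, so
its reduction is the same under [phi] and under [phi] followed by the Frobenius map.
Hence the Frobenius image of the sum for the identity is the [phi]-image of the sum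
for some [w], and coefficients can be compared. *)
Lemma frobenius_lift n (r : 'I_n -> algint) (k : idomainType) (phi : {rmorphism algint -> k}) p :
  injective r -> (forall (s : autC) i, exists j, s (val (r i)) = val (r j)) ->
  p \in [pchar k] ->
  exists2 w : 'S_n, w \in gal_perms (val \o r) & forall i, phi (r (w i)) = phi (r i) ^+ p.
Proof.
move=> rinj st charkp.
have vrinj : injective (val \o r) by move=> i j /val_inj/rinj.
pose G := gal_perms (val \o r).
pose a (w : 'S_n) : {poly algint} := \sum_(i < n) r (w i) *: 'X^i.
pose P : {poly {poly algint}} := \prod_(w in G) ('X - (a w)%:P).
pose ac (w : 'S_n) : {poly algC} := \sum_(i < n) val (r (w i)) *: 'X^i.
pose Pc : {poly {poly algC}} := \prod_(w in G) ('X - (ac w)%:P).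
have mapP (R1 R2 : comNzRingType) (f : {rmorphism R1 -> R2}) (b : 'S_n -> {poly R1}) :
    map_poly (map_poly f) (\prod_(w in G) ('X - (b w)%:P)) =
    \prod_(w in G) ('X - (map_poly f (b w))%:P).
  by rewrite rmorph_prod; apply: eq_bigr => w _; rewrite rmorphB /= map_polyX map_polyC.
have map_a (R2 : comNzRingType) (f : {rmorphism algint -> R2}) w :
    map_poly f (a w) = \sum_(i < n) f (r (w i)) *: 'X^i.
  by rewrite rmorph_sum; apply: eq_bigr => i _; rewrite /= map_polyZ map_polyXn.
have PcE : map_poly (map_poly (\val : {rmorphism algint -> algC})) P = Pc.
  by rewrite mapP; apply: eq_bigr => w _; rewrite map_a.
have Pcs (s : autC) : map_poly (map_poly s) Pc = Pc.
  rewrite mapP; have [v vP] := aut_perm vrinj st s.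
  have Gv : v \in G by apply/gal_permsP; exists s.
  rewrite /Pc [RHS](reindex_inj (mulIg v)) /=; apply: eq_big => w.
    by rewrite groupMr.
  move=> _; congr ('X - _%:P); rewrite rmorph_sum; apply: eq_bigr => i _.
  by rewrite /= map_polyZ map_polyXn permM; congr (_ *: _); apply: vP.
have Pint i j : exists z : int, P`_i`_j = z%:~R.
  pose c := val (P`_i`_j).
  have cE : c = Pc`_i`_j by rewrite -PcE !coef_map.
  have cQ : c \in Crat.
    apply: galC_fixed => s _; rewrite cE; rewrite -{2}(Pcs s).
    by rewrite !coef_map.
  have /intrP[z cz] : c \in Num.int by apply: Cint_rat_Aint => //; apply: valP.
  by exists z; apply: val_inj; rewrite -/c cz; exact/esym/(rmorph_int (\val : {rmorphism algint -> algC})).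
pose phi' : {rmorphism algint -> k} := pFrobenius_aut charkp \o phi.
have PP : map_poly (map_poly phi') P = map_poly (map_poly phi) P.
  apply/polyP => i; rewrite !coef_map; apply/polyP => j; rewrite !coef_map.
  have [z ->] := Pint i j; transitivity (z%:~R : k); [exact: rmorph_int | exact: (esym (rmorph_int phi z))].
have G1 : 1%g \in G by apply: (group1 (gal_perms_grp (val \o r))).
have : (map_poly (map_poly phi) P).[map_poly phi' (a 1%g)] == 0.
  rewrite -PP mapP horner_prod; apply/prodf_eq0; exists 1%g => //.
  by rewrite hornerXsubC subrr.
rewrite mapP horner_prod => /prodf_eq0[w Gw]; rewrite hornerXsubC subr_eq0 => /eqP E.
exists w => // i; have := congr1 (fun f : {poly k} => f`_i) E.
have coefa (f : 'I_n -> k) : (\sum_(j < n) f j *: 'X^j)`_i = f i.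
  rewrite coef_sum (bigD1 i) //= coefZ coefXn eqxx mulr1 big1 ?addr0 // => j ji.
  rewrite coefZ coefXn; case: eqP => [/ord_inj ij|_]; last by rewrite mulr0.
  by rewrite ij eqxx in ji.
by rewrite !map_a !coefa perm1 /= => <-.
Qed.

(** * Irreducible polynomials over prime fields *)

Section FrobeniusOrbits.
Variables (p : nat) (k : fieldType).
Hypothesis charkp : p \in [pchar k].

Let p_pr : prime p := pcharf_prime charkp.

Lemma natr_modp n : (n %% p)%:R = n%:R :> k.
Proof. by rewrite {2}(divn_eq n p) natrD natrM (pcharf0 charkp) mulr0 add0r. Qed.

(** The embedding of the prime field. The characteristic is an argument so that the
ring morphism structure can be inferred from the term. *)
Definition Fp_emb (_ : p \in [pchar k]) (a : 'F_p) : k := (a : nat)%:R.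
Local Notation emb := (Fp_emb charkp).

Let Fp_emb_nat_mod n : emb n%:R = n%:R.
Proof. by rewrite /Fp_emb (val_Fp_nat p_pr) natr_modp. Qed.

Fact Fp_emb_zmod : zmod_morphism emb.
Proof.
have D (c d : 'F_p) : emb (c + d) = emb c + emb d.
  by rewrite -[c in LHS]natr_Zp -[d in LHS]natr_Zp -natrD Fp_emb_nat_mod natrD.
by move=> a b; apply/eqP; rewrite eq_sym subr_eq -D subrK.
Qed.

Fact Fp_emb_monoid : monoid_morphism emb.
Proof.
split=> [|a b]; first exact: (Fp_emb_nat_mod 1).
by rewrite -[a in LHS]natr_Zp -[b in LHS]natr_Zp -natrM Fp_emb_nat_mod natrM.
Qed.

HB.instance Definition _ := GRing.isZmodMorphism.Build 'F_p k emb Fp_emb_zmod.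
HB.instance Definition _ := GRing.isMonoidMorphism.Build 'F_p k emb Fp_emb_monoid.

Lemma expfp_inj n : injective (fun x : k => x ^+ (p ^ n)).
Proof.
elim: n => [x y|n IHn x y] /=; first by rewrite expn0 !expr1.
rewrite expnS !exprM => /IHn; exact: (fmorph_inj (pFrobenius_aut charkp)).
Qed.

Lemma Fp_fixed c : c ^+ p = c -> exists a, c = emb a.
Proof.
move=> cp; have : (map_poly emb ('X^#|'F_p| - 'X)).[c] == 0.
  by rewrite card_Fp // rmorphB /= map_polyXn map_polyX !hornerE cp subrr.
rewrite finField_genPoly rmorph_prod horner_prod => /prodf_eq0[a _].
rewrite rmorphB /= map_polyX map_polyC !hornerE subr_eq0 => /eqP ca.
by exists a.
Qed.

Lemma Fp_stable_poly (g : {poly k}) : map_poly (pFrobenius_aut charkp) g = g ->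
  exists g0, map_poly emb g0 = g.
Proof.
move=> gs; have cP i : {a | g`_i = emb a}.
  by apply: cid; apply: Fp_fixed; rewrite -{2}gs coef_map.
exists (\poly_(i < size g) sval (cP i)); apply/polyP=> i; rewrite coef_map coef_poly.
case: ltnP => [_|/(nth_default 0)->]; last exact: raddf0.
exact/esym/(svalP (cP i)).
Qed.

Variables (f : {poly 'F_p}) (x : k).
Hypothesis irr : irreducible_poly f.
Hypothesis fx : root (map_poly emb f) x.

(** The product of ['X - x ^+ (p ^ i)] for [i < j] is invariant by the Frobenius map, so
it is a polynomial over the prime field that vanishes at [x]. *)
Lemma orbit_degree j : (0 < j)%N -> x ^+ (p ^ j) = x -> ((size f).-1 <= j)%N.
Proof.
case: j => // j _ xj; pose F i : {poly k} := 'X - (x ^+ (p ^ i))%:P.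
have [|g0 g0E] := @Fp_stable_poly (\prod_(i < j.+1) F i).
  rewrite rmorph_prod (eq_bigr (fun i : 'I_j.+1 => F i.+1)); last first.
    by move=> i _; rewrite rmorphB /= map_polyX map_polyC /= pFrobenius_autE -exprM -expnSr.
  rewrite big_ord_recr big_ord_recl /= mulrC; congr (_ * _).
  by rewrite /F xj expn0 expr1.
have g0x : root (map_poly emb g0) x.
  by rewrite g0E big_ord_recl rootM root_XsubC expn0 expr1 eqxx.
have fg : f %| g0.
  apply: contraT; rewrite -irreducible_poly_coprime // => cfg.
  have : coprimep (map_poly emb f) (map_poly emb g0) by rewrite coprimep_map.
  by move=> /coprimep_root/(_ fx); rewrite (rootP g0x) eqxx.
have sg0 : size g0 = j.+2.
  by rewrite -(size_map_poly emb) g0E -(big_mkord xpredT F) size_prod_XsubC size_iota subn0.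
have g00 : g0 != 0 by rewrite -size_poly_gt0 sg0.
by have := dvdp_leq g00 fg; rewrite sg0; case: (size f).
Qed.

Lemma orbit_inj i j : (i < j)%N -> x ^+ (p ^ i) = x ^+ (p ^ j) -> ((size f).-1 <= j - i)%N.
Proof.
move=> ij E; apply: orbit_degree; first by rewrite subn_gt0.
by apply: (@expfp_inj i); rewrite -exprM -expnD subnK // ltnW.
Qed.

Lemma orbit_root i : root (map_poly emb f) (x ^+ (p ^ i)).
Proof.
elim: i => [|i IHi]; first by rewrite expn0 expr1.
rewrite expnSr exprM -(pFrobenius_autE charkp).
rewrite -(fmorph_root (pFrobenius_aut charkp)) in IHi.
rewrite -map_poly_comp (eq_map_poly (g := emb)) // in IHi => a.
by rewrite /= /Fp_emb pFrobenius_aut_nat.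
Qed.

Lemma orbit_uniq : uniq [seq x ^+ (p ^ i) | i <- iota 0 (size f).-1].
Proof.
apply/(uniqP 0) => i j; rewrite !inE size_map size_iota => im jm.
wlog ij : i j im jm / (i <= j)%N.
  by case: (leqP i j) => [|/ltnW] ij H; [apply: H | move=> /esym E; apply/esym/H].
rewrite !(nth_map 0%N) ?size_iota // !nth_iota // !add0n => E.
move: ij; rewrite leq_eqVlt => /orP[/eqP //|/orbit_inj/(_ E)].
by rewrite leqNgt (leq_ltn_trans (leq_subr _ _)).
Qed.

Lemma orbit_cycle : x ^+ (p ^ (size f).-1) = x.
Proof.
have f1 : (1 < size f)%N := irr.1.
pose rs := [seq x ^+ (p ^ i) | i <- iota 0 (size f)].
have [urs|/(uniqPn 0)] := boolP (uniq rs).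
  have: (size rs < size (map_poly emb f))%N.
    apply: max_poly_roots => //; first by rewrite map_poly_eq0 irredp_neq0.
    by apply/allP => _ /mapP[i _ ->]; apply: orbit_root.
  by rewrite size_map size_iota size_map_poly ltnn.
move=> [i [j [ij]]]; rewrite size_map size_iota => jn.
rewrite !(nth_map 0%N) ?size_iota ?(ltn_trans ij) // !nth_iota ?(ltn_trans ij) //.
rewrite !add0n => E; have h := orbit_inj ij E.
have i0 : i = 0%N.
  by apply/eqP; rewrite -leqn0; move: h jn ij f1; lia.
have jE : j = (size f).-1 by move: h jn; rewrite i0; lia.
by rewrite -jE -E i0 expn0 expr1.
Qed.
End FrobeniusOrbits.

(** The minimal polynomial of a generator of the multiplicative group of the field
with [p ^ n] elements: if its degree is [m], the order of the generator divides
[(p ^ m).-1]. *)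
Lemma irreducible_Fp_ex p n : prime p -> (0 < n)%N ->
  exists f : {poly 'F_p}, [/\ irreducible_poly f, f \is monic & size f = n.+1].
Proof.
move=> pp n0; have [F charF cF] := pPrimePowerField pp n0.
have /cyclicP[u uE] := field_unit_group_cyclic [set: {unit F}]%G.
pose x := val u.
have ou : #[u]%g = (p ^ n).-1.
  by rewrite orderE -uE card_finField_unit cF.
have xn : x ^+ (p ^ n) = x by rewrite -cF expf_card.
have pn1 : (1 < p ^ n)%N by rewrite -{1}(expn0 p) ltn_exp2l // prime_gt1.
have [|f [irr mf fx _]] := @minpoly_rmorph _ _ (Fp_emb charF) x.
  exists ('X^(p ^ n) - 'X).
    by rewrite -size_poly_eq0 size_polyDl size_polyXn // size_polyN size_polyX ltnS.
  by rewrite /root rmorphB /= map_polyXn map_polyX !hornerE xn subrr.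
exists f; split=> //; have f1 : (1 < size f)%N := irr.1.
have le1 := orbit_degree irr fx n0 xn.
have xm := orbit_cycle irr fx.
set m := (size f).-1 in le1 xm *.
have : ((p ^ n).-1 %| (p ^ m).-1)%N.
  rewrite -ou order_dvdn; apply/eqP/val_inj.
  rewrite FinRing.val_unitX /=; apply: (mulIf (x := x)); last first.
    by rewrite mul1r -exprSr prednK ?expn_gt0 ?prime_gt0.
  by rewrite -unitfE (valP u).
have p1 := prime_gt1 pp; have m0 : (0 < m)%N by rewrite /m -ltnS prednK // ltnW.
have pm1 : (1 < p ^ m)%N by rewrite -{1}(expn0 p) ltn_exp2l.
have pm0 : (0 < (p ^ m).-1)%N by rewrite -subn1 subn_gt0.
move=> /(dvdn_leq pm0) h.
have le2 : (n <= m)%N 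
  by rewrite -(leq_exp2l _ _ p1) -(prednK (ltnW pm1)) -(prednK (ltnW pn1)) ltnS.
have mn : m = n by apply/eqP; rewrite eqn_leq le1 le2.
by rewrite -mn /m prednK // ltnW.
Qed.

(** * Integral polynomials with symmetric Galois group *)

Lemma algint_residue_field p : prime p -> exists (k : fieldType) (phi : {rmorphism algint -> k}), p \in [pchar k].
Proof.
move=> pp; have [b|k [phi phip]] := @residue_field_ex algint p%:R.
  apply/negP => /eqP /(congr1 val).
  rewrite (rmorphM (\val : {rmorphism algint -> algC})) rmorph_nat rmorph1 => bp.
  have p0 : p%:R != 0 :> algC by rewrite pnatr_eq0 -lt0n prime_gt0.
  have bE : val b = p%:R^-1 by apply: (mulIf p0); rewrite bp mulVf.
  have : val b \in Num.int.
    apply: Cint_rat_Aint; last exact: valP.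
    by rewrite bE rpredV rpred_nat.
  move=> /intrP[m mE]; have : (m * p%:Z)%:~R = 1%:~R :> algC by rewrite intrM -mE -pmulrn bp.
  move=> /intr_inj/(congr1 absz)/eqP; rewrite abszM muln_eq1 => /andP[_ /eqP p1].
  by move: pp; rewrite -[p]/(absz p) p1.
exists k, phi; rewrite inE /= pp -(rmorph_nat phi) phip eqxx //.
Qed.

(** As many distinct roots as the degree: they exhaust the family [rho], which is thus
injective. The reduction of a root family modulo a prime is separable for this
reason. *)
Lemma roots_codom (k : fieldType) n (rho : 'I_n -> k) (t : seq k) : uniq t -> size t = n ->
  (forall z, z \in t -> root (\prod_(i < n) ('X - (rho i)%:P)) z) ->
  injective rho /\ forall z, z \in t <-> exists i, z = rho i.
Proof.
move=> ut st rt; have sub : {subset t <= codom rho}.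
  move=> z /rt; rewrite -(big_map rho xpredT (fun a => 'X - a%:P)) root_prod_XsubC.
  by rewrite codomE enumT.
have sc : (size (codom rho) <= size t)%N by rewrite size_codom card_ord st.
split; first by apply/injectiveP; apply: leq_size_uniq sub sc.
have [_ E] := uniq_min_size ut sub sc.
by move=> z; rewrite E; split=> [/codomP//|[i ->]]; apply: codom_f.
Qed.

Lemma permX_frob (k : fieldType) n (rho : 'I_n -> k) p (w : 'S_n) :
  (forall i, rho (w i) = rho i ^+ p) -> forall j i, rho ((w ^+ j)%g i) = rho i ^+ (p ^ j).
Proof.
move=> wP; elim=> [|j IHj] i; first by rewrite expg0 perm1 expn0 expr1.
by rewrite expgSr permM wP IHj -exprM expnSr.
Qed.

Lemma root_split (k : fieldType) n (rho : 'I_n -> k) (d : {poly k}) :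
  (1 < size d)%N -> d %| \prod_(i < n) ('X - (rho i)%:P) -> exists i, root d (rho i).
Proof.
move=> d1; rewrite -big_enum => /dvdp_prod_XsubC[m dE].
case E : (mask m (enum 'I_n)) dE => [|i l] dE.
  by have := eqp_size dE; rewrite big_nil size_poly1 => d1'; rewrite d1' in d1.
by exists i; rewrite (eqp_root dE) big_cons rootM root_XsubC eqxx.
Qed.

Section FrobeniusCycles.
Variables (n : nat) (k : fieldType) (rho : 'I_n -> k) (w : 'S_n).

(** Modulo an irreducible polynomial the Frobenius map permutes the roots in a single
cycle. *)
Lemma frob_cycle (char2 : 2 \in [pchar k]) (f : {poly 'F_2}) :
  prime n -> irreducible_poly f -> size f = n.+1 ->
  map_poly (Fp_emb char2) f = \prod_(i < n) ('X - (rho i)%:P) ->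
  injective rho /\ ((forall i, rho (w i) = rho i ^+ 2) -> #[w]%g = n).
Proof.
move=> pn irr sf fE.
have fr i : root (map_poly (Fp_emb char2) f) (rho i).
  by rewrite fE (bigD1 i) //= rootM root_XsubC eqxx.
pose i0 : 'I_n := Ordinal (prime_gt0 pn).
have [rinj _] : injective rho /\ forall z, z \in [seq rho i0 ^+ (2 ^ i) | i <- iota 0 (size f).-1] <-> exists i, z = rho i.
  apply: roots_codom; first exact: orbit_uniq.
    by rewrite size_map size_iota sf.
  by move=> _ /mapP[i _ ->]; rewrite -fE; apply: orbit_root.
split=> // wP; apply: nt_prime_order => //.
  apply/permP => i; apply: (rinj _ _); rewrite (permX_frob wP) perm1.
  by have := orbit_cycle irr (fr i); rewrite sf.
apply/eqP => w1; have := wP i0; rewrite w1 perm1 => E.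
have := @orbit_degree _ _ char2 _ _ irr (fr i0) 1 isT; rewrite expn1 sf /= => /(_ (esym E)).
by rewrite leqNgt prime_gt1.
Qed.

(** Modulo a product of irreducible polynomials of degrees two and [n - 2], the
Frobenius map is the product of a transposition and a disjoint cycle of odd length
[n - 2]; its power of exponent [n - 2] is the transposition. *)
Lemma frob_transp (char3 : 3 \in [pchar k]) (g h : {poly 'F_3}) :
  odd n -> (4 < n)%N -> irreducible_poly g -> irreducible_poly h -> size g = 3 -> size h = n.-1 ->
  map_poly (Fp_emb char3) (g * h) = \prod_(i < n) ('X - (rho i)%:P) ->
  (forall i, rho (w i) = rho i ^+ 3) ->
  exists i j, i != j /\ (w ^+ (n - 2))%g = tperm i j.
Proof.
move=> on n4 ig ih sg sh ghE wP.
pose e := Fp_emb char3.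
have [ix gx] : exists i, root (map_poly e g) (rho i).
  apply: root_split; first by rewrite size_map_poly sg.
  by rewrite -ghE rmorphM dvdp_mulr.
have [iy hy] : exists i, root (map_poly e h) (rho i).
  apply: root_split; first by rewrite size_map_poly sh; lia.
  by rewrite -ghE rmorphM dvdp_mull.
set x := rho ix in gx; set y := rho iy in hy.
have cgh : coprimep g h.
  rewrite irreducible_poly_coprime //; apply/negP => gh.
  have /eqp_size : g %= h by apply: ih => //; rewrite sg.
  by rewrite sg sh; lia.
have ngh z : root (map_poly e g) z -> root (map_poly e h) z -> False.
  move=> gz hz; have : coprimep (map_poly e g) (map_poly e h) by rewrite coprimep_map.
  by move=> /coprimep_root/(_ gz); rewrite (rootP hz) eqxx.
pose tx := [seq x ^+ (3 ^ i) | i <- iota 0 (size g).-1].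
pose ty := [seq y ^+ (3 ^ i) | i <- iota 0 (size h).-1].
have txg z : z \in tx -> root (map_poly e g) z by case/mapP => i _ ->; apply: orbit_root.
have tyh z : z \in ty -> root (map_poly e h) z by case/mapP => i _ ->; apply: orbit_root.
have [rinj tP] : injective rho /\ forall z, z \in tx ++ ty <-> exists i, z = rho i.
  apply: roots_codom.
  - rewrite cat_uniq !orbit_uniq // andbT; apply/hasPn => z zty; apply/negP => ztx.
    exact: ngh (txg _ ztx) (tyh _ zty).
  - by rewrite size_cat !size_map !size_iota sg sh; lia.
  - move=> z; rewrite mem_cat -ghE rmorphM rootM => /orP[/txg->//|/tyh->].
    by rewrite orbT.
have txE : tx = [:: x; x ^+ 3] by rewrite /tx sg /= expn0 expr1 expn1.
have [jx jxE] : exists j, x ^+ 3 = rho j by apply/tP; rewrite mem_cat txE !inE eqxx orbT.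
have x9 : x ^+ 3 ^+ 3 = x by have := orbit_cycle ig gx; rewrite sg /= -exprM.
have nx : x != x ^+ 3.
  by have := orbit_uniq ig gx; rewrite -/tx txE /= inE andbT.
have xw z : z ^+ 3 ^+ 3 = z -> z ^+ (3 ^ (n - 2)) = z ^+ 3.
  move=> z9; have -> : (n - 2 = ((n - 3)./2 * 2).+1)%N by lia.
  rewrite expnS mulnC exprM; congr (_ ^+ _).
  elim: (n - 3)./2 => [|m IHm]; first by rewrite mul0n expn0 expr1.
  by rewrite mulSn expnD exprM (_ : (3 ^ 2 = 3 * 3)%N) // exprM z9.
exists ix, jx; split.
  by apply: contra_neq nx => ij; rewrite jxE -ij.
apply/permP => i; apply: (rinj _ _); rewrite (permX_frob wP).
have : rho i \in tx ++ ty by apply/tP; exists i.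
rewrite mem_cat txE !inE -orbA => /or3P[/eqP ri|/eqP ri|riy].
- have -> : i = ix by apply: rinj.
  by rewrite tpermL -jxE xw.
- have -> : i = jx by apply: rinj; rewrite ri.
  by rewrite tpermR -jxE xw x9.
rewrite tpermD; first by have := orbit_cycle ih (tyh _ riy); rewrite sh (_ : n.-1.-1 = n - 2)%N //; lia.
  by apply/eqP => E; apply: (@ngh (rho i)); [rewrite -E | apply: tyh].
apply/eqP => E; apply: (@ngh (rho i)); last exact: tyh.
by rewrite -E -jxE; apply: txg; rewrite txE !inE eqxx orbT.
Qed.
End FrobeniusCycles.

Lemma intr_Fp_emb p (k : fieldType) (chark : p \in [pchar k]) (q : {poly int}) :
  map_poly (Fp_emb chark) (map_poly intr q) = map_poly intr q.
Proof. by rewrite -map_poly_comp; apply: eq_map_poly => z; exact: rmorph_int. Qed.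

(** The coefficients are lifted by the Chinese remainder theorem to integers from [0]
to [5]. The leading one is set to [1] separately to keep the lift monic. *)
Lemma lift_Fp_pair n (f : {poly 'F_2}) (g : {poly 'F_3}) :
  f \is monic -> size f = n.+1 -> g \is monic -> size g = n.+1 ->
  exists q : {poly int}, [/\ q \is monic, size q = n.+1, forall i, `|q`_i| <= 5%:Z,
    map_poly intr q = f & map_poly intr q = g].
Proof.
move=> mf sf mg sg; pose c i := (chinese 2 3 (f`_i)%R (g`_i)%R %% 6)%N.
pose q : {poly int} := \poly_(i < n.+1) (if i == n then 1 else (c i)%:Z).
have qi i : q`_i = if i == n then 1 else if (i < n)%N then (c i)%:Z else 0.
  by rewrite coef_poly ltnS leq_eqVlt; case: eqP.
have sq : size q = n.+1 by rewrite size_poly_eq // eqxx oner_neq0.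
have fp p (a : 'F_p) m : prime p -> m = a %[mod p] -> m%:R = a.
  by move=> pp E; apply: ord_inj; rewrite val_Fp_nat // E -val_Fp_nat // natr_Zp.
have top (R : nzRingType) (h : {poly R}) : h \is monic -> size h = n.+1 -> h`_n = 1.
  by move=> mh sh; have /monicP := mh; rewrite lead_coefE sh.
exists q; split=> //.
- by rewrite monicE lead_coefE sq qi eqxx.
- move=> i; rewrite qi; case: ifP => // _; case: ifP => // _.
  by rewrite /c; have := ltn_pmod (chinese 2 3 (f`_i)%R (g`_i)%R) (isT : 0 < 6)%N; lia.
- apply/polyP => i; rewrite coef_map qi; case: eqP => [->|/eqP ni].
    by rewrite top //; exact: mulr1z.
  case: ltnP => ni'; last by rewrite [RHS]nth_default ?sf ?ltn_neqAle 1?eq_sym ?ni.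
  by apply: fp => //; rewrite /c modn_dvdm // chinese_modl.
- apply/polyP => i; rewrite coef_map qi; case: eqP => [->|/eqP ni].
    by rewrite top //; exact: mulr1z.
  case: ltnP => ni'; last by rewrite [RHS]nth_default ?sg ?ltn_neqAle 1?eq_sym ?ni.
  by apply: fp => //; rewrite /c modn_dvdm // chinese_modr.
Qed.

(** A transposition and a cycle of prime length [n] generate the symmetric group on
[n] letters. The bound on the coefficients, uniform in [n], is what makes the height
of the roots small. *)
Lemma sym_poly_ex n : prime n -> (4 < n)%N ->
  exists (q : {poly int}) (r : 'I_n -> algC),
    [/\ q \is monic, size q = n.+1 & forall i, `|q`_i| <= 5%:Z] /\
    [/\ injective r, map_poly intr q = \prod_(i < n) ('X - (r i)%:P) &
      gal_perms r = [set: 'S_n]%SET].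
Proof.
move=> pn n4.
have on : odd n by case: (even_prime pn) => // n2; rewrite n2 in n4.
have [f [irf mf sf]] := @irreducible_Fp_ex 2 n isT (prime_gt0 pn).
have [g [irg mg sg]] := @irreducible_Fp_ex 3 2 isT isT.
have [|h [irh mh sh]] := @irreducible_Fp_ex 3 (n - 2) isT; first by lia.
have sgh : size (g * h) = n.+1 by rewrite size_monicM ?monic_neq0 // sg sh; lia.
have mgh : g * h \is monic by rewrite monicMl.
have [q [mq sq qB qf qg]] := lift_Fp_pair mf sf mgh sgh.
have [rs rsE] := closed_field_poly_normal (map_poly intr q : {poly algC}).
have mqC : map_poly (intr : int -> algC) q \is monic by rewrite monic_map.
rewrite (monicP mqC) scale1r in rsE.
have srs : size rs = n.
  apply: succn_inj; rewrite -(size_prod_XsubC rs id) -rsE -sq.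
  by rewrite size_map_inj_poly //; apply: intr_inj.
have rsA z : z \in rs -> z \in Aint.
  move=> zr; apply: (@root_monic_Aint (map_poly intr q)) => //.
    by rewrite rsE root_prod_XsubC.
  by apply/polyOverP => i; rewrite coef_map /= rpred_int.
have rA (i : 'I_n) : nth 0 rs i \in Aint by apply: rsA; rewrite mem_nth // srs.
pose r (i : 'I_n) : algint := Sub (nth 0 rs i) (rA i).
have qE : map_poly intr q = \prod_(i < n) ('X - (val (r i))%:P).
  rewrite rsE (big_nth 0) srs big_mkord; apply: eq_bigr => i _.
  by congr ('X - _%:P).
have qA : map_poly intr q = \prod_(i < n) ('X - (r i)%:P).
  apply: (map_inj_poly val_inj (rmorph0 (\val : {rmorphism algint -> algC}))).
  rewrite -map_poly_comp (eq_map_poly (g := intr)); last by move=> z; exact: rmorph_int.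
  rewrite qE rmorph_prod; apply: eq_bigr => i _.
  exact/esym/map_polyXsubC.
have qk (k : fieldType) (phi : {rmorphism algint -> k}) :
    map_poly intr q = \prod_(i < n) ('X - (phi (r i))%:P).
  rewrite -(eq_map_poly (f := phi \o intr)); last by move=> z; exact: rmorph_int.
  rewrite map_poly_comp qA rmorph_prod; apply: eq_bigr => i _.
  exact: map_polyXsubC.
have [k2 [phi2 char2]] := @algint_residue_field 2 isT.
have [k3 [phi3 char3]] := @algint_residue_field 3 isT.
have f2E : map_poly (Fp_emb char2) f = \prod_(i < n) ('X - (phi2 (r i))%:P).
  by rewrite -qf intr_Fp_emb (qk _ phi2).
have f3E : map_poly (Fp_emb char3) (g * h) = \prod_(i < n) ('X - (phi3 (r i))%:P).
  by rewrite -qg intr_Fp_emb (qk _ phi3).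
have rinj : injective r.
  have [inj2 _] := frob_cycle 1%g pn irf sf f2E.
  by move=> i j /(congr1 phi2)/inj2.
have st (s : autC) i : exists j, s (val (r i)) = val (r j).
  have : root (map_poly intr q) (s (val (r i))).
    rewrite -(eq_map_poly (f := s \o intr)); last by move=> z; exact: rmorph_int.
    by rewrite map_poly_comp fmorph_root qE (bigD1 i) //= rootM root_XsubC eqxx.
  by rewrite qE rootE horner_prod => /prodf_eq0[j _]; rewrite hornerXsubC subr_eq0 => /eqP ->; exists j.
have [w2 Gw2 w2P] := frobenius_lift phi2 rinj st char2.
have [w3 Gw3 w3P] := frobenius_lift phi3 rinj st char3.
have [_ /(_ w2P) ow2] := frob_cycle w2 pn irf sf f2E.
have sh' : size h = n.-1.
  by rewrite sh -[in RHS](subnK (ltnW (ltnW (ltnW n4)))) addn2.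
have [i [j [ij w3E]]] := frob_transp on n4 irg irh sg sh' f3E w3P.
exists q, (val \o r); split; split=> //; first by move=> a b /val_inj/rinj.
apply/eqP; rewrite finset.eqEsubset finset.subsetT /=.
have := @gen_tperm_circular_shift 'I_n i j w2; rewrite card_ord => /(_ pn ij ow2).
rewrite -w3E => E; have sT : [set: 'S_n]%SET = ('Sym_('I_n))%g by [].
rewrite sT -E gen_subG; apply/fintype.subsetP => w; rewrite finset.in_set2 => /orP[]/eqP->.
  exact: (@groupX _ (gal_perms_grp (val \o r)) w3 (n - 2) Gw3).
exact: Gw2.
Qed.

(** * Roots of small height *)

Section SmallHeights.
Implicit Types (K L M : divringClosed algC) (S : set algC) (s t : autC).

(** An automorphism acts on [K] through the images of a basis, for which there are
finitely many possibilities. This is the finiteness of the index of the automorphisms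
fixing [K]. *)
Lemma number_field_cosets K : number_field K ->
  exists (T : finType) (f : autC -> T), forall s t, f s = f t -> galC K (s^-1 * t)%g.
Proof.
move=> [n [_ [e [eK eP]]]].
pose orb i := sval (cid (conj_seq (e i))).
have orbP i s : s (e i) \in orb i by apply/(svalP (cid (conj_seq (e i)))); exists s.
pose T := {ffun 'I_n -> 'I_(\max_(i < n) size (orb i)).+1}.
pose f s : T := [ffun i => inord (index (s (e i)) (orb i))].
exists T, f => s t /ffunP st.
have ste i : s (e i) = t (e i).
  have := st i; rewrite !ffunE => /(congr1 val) /=.
  have lt u : (index (u (e i)) (orb i) < (\max_(i < n) size (orb i)).+1)%N.
    rewrite ltnS; apply: leq_trans (index_size _ _) _; exact: leq_bigmax.
  by rewrite !inordK // => h; rewrite -(nth_index 0 (orbP i s)) h nth_index.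
move=> x xK; suff tx : t x = s x by rewrite autM tx autVK.
have [c [-> _]] := eP x xK; rewrite !rmorph_sum; apply: eq_bigr => i _.
by rewrite !rmorphM /= ste !(Crat_aut _ (valP (c 0 i))).
Qed.

(** The Galois group over [L] of a polynomial with roots [r], as a group of permutations. *)
Definition perms_over L n (r : 'I_n -> algC) : {set 'S_n} :=
  [set w : 'S_n | `[< exists2 s : autC, galC L s & forall i, s (r i) = r (w i) >]]%SET.

Lemma perms_overP L n (r : 'I_n -> algC) (w : 'S_n) :
  reflect (exists2 s : autC, galC L s & forall i, s (r i) = r (w i)) (w \in perms_over L r).
Proof. by rewrite inE; apply: asboolP. Qed.

Lemma perms_over_group L n (r : 'I_n -> algC) : group_set (perms_over L r).
Proof.
apply/group_setP; split; first by apply/perms_overP; exists 1%g => // i; rewrite perm1.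
move=> u v /perms_overP[s Ls sP] /perms_overP[t Lt tP]; apply/perms_overP.
by exists (t * s)%g => [|i]; [apply: galCM | rewrite permM autM sP tP].
Qed.

Canonical perms_over_grp L n (r : 'I_n -> algC) := Group (perms_over_group L r).

Section AlternatingOverAbelian.
Variables (K : divringClosed algC) (n : nat) (r : 'I_n -> algC) (T : finType) (f : autC -> T).
Hypothesis fK : forall s t, f s = f t -> galC K (s^-1 * t)%g.
Hypothesis pn : prime n.
Hypothesis Tn : (#|T| < n)%N.
Hypothesis n4 : (4 < n)%N.
Hypothesis rinj : injective r.
Hypothesis rsym : gal_perms r = [set: 'S_n]%SET.

(** By the pigeonhole principle some power of exponent [0 < k < n] of any lift of [w]
fixes [K]; as [n] is prime, [w] is a power of [w ^+ k]. *)
Lemma cycle_perms_over (w : 'S_n) : #[w]%g = n -> w \in perms_over K r.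
Proof.
move=> ow; have /gal_permsP[s sP] : w \in gal_perms r by rewrite rsym inE.
have spow k i : (s ^+ k)%g (r i) = r ((w ^+ k)%g i).
  elim: k i => [|k IHk] i; first by rewrite !expg0 perm1.
  by rewrite expgSr autM sP IHk expgS permM.
have : ~~ injectiveb (fun i : 'I_(#|T|).+1 => f (s ^+ i)%g).
  apply/injectiveP => /leq_card; rewrite card_ord ltnn //.
case/injectivePn => i [j ij fij].
wlog {ij} ij : i j fij / (i < j)%N.
  move=> H; have := ij; rewrite neq_ltn => /orP[] ; [exact: H | apply: H; exact/esym].
have Kk : galC K (s ^+ (j - i))%g.
  have := fK fij; suff -> : ((s ^+ i)^-1 * s ^+ j = s ^+ (j - i))%g by [].
  by rewrite -{1}(subnKC (ltnW ij)) expgnDr mulKg.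
have wk : (w ^+ (j - i))%g \in perms_over K r.
  by apply/perms_overP; exists (s ^+ (j - i))%g => // a; apply: spow.
have cop : coprime n (j - i).
  rewrite prime_coprime // gtnNdvd ?subn_gt0 //.
  apply: leq_ltn_trans (leq_subr _ _) _; apply: leq_ltn_trans Tn; rewrite -ltnS; exact: ltn_ord.
have /eqP E : generator <[w]>%g (w ^+ (j - i))%g by rewrite generator_coprime ow.
have : w \in <[w]>%g by apply: cycle_id.
by rewrite E; apply: fintype.subsetP; rewrite cycle_subG.
Qed.

(** The elements of order [n] generate a normal subgroup of the simple group of even
permutations; Cauchy's theorem provides one. *)
Lemma Alt_perms_over : ('Alt_('I_n))%g \subset perms_over K r.
Proof.
pose D := [set w : 'S_n | #[w]%g == n]%SET.
have on : odd n by case: (even_prime pn) => // n2; move: n4; rewrite n2.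
have DK : <<D>>%g \subset perms_over K r.
  rewrite gen_subG; apply/fintype.subsetP => w; rewrite inE => /eqP; exact: cycle_perms_over.
suff <- : (<<D>> = 'Alt_('I_n))%g by [].
have DA : <<D>>%g \subset ('Alt_('I_n))%g.
  rewrite gen_subG; apply/fintype.subsetP => w; rewrite inE Alt_even => /eqP ow.
  have := congr1 (@odd_perm _) (expg_order w); rewrite ow odd_perm1.
  have oX k : odd_perm (w ^+ k)%g = odd k && odd_perm w.
    elim: k => [|k IHk]; first by rewrite expg0 odd_perm1.
    by rewrite expgS odd_permM IHk /=; case: (odd k); case: (odd_perm w).
  by rewrite oX on /= => ->.
have nD : normal <<D>>%g ('Alt_('I_n))%g.
  apply/andP; split=> //; apply: norms_gen; apply/fintype.subsetP => g _; rewrite inE.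
  by apply/fintype.subsetP => _ /imsetP[w + ->]; rewrite !inE orderJ.
have sA : simple ('Alt_('I_n))%g by apply: simple_Alt5; rewrite card_ord.
have [_ /(_ _ nD)[D1|//]] := simpleP _ sA.
have [w _ ow] : {w : 'S_n | w \in [set: 'S_n]%SET & #[w]%g = n}.
  by apply: (@Cauchy _ n [set: 'S_n]%G) => //; rewrite cardsT card_Sn dvdn_fact // prime_gt0 /=.
have : w \in <<D>>%g by rewrite mem_gen // inE ow.
by rewrite D1 => /set1P w1; move: ow pn; rewrite w1 order1 => <-.
Qed.

(** The alternating group is generated by its commutators, and commutators of
automorphisms fixing [K] fix the abelian closure. *)
Lemma Alt_perms_over_ab : ('Alt_('I_n))%g \subset perms_over (field_ab K) r.
Proof.
rewrite -(Alt_perfect n4) gen_subG; apply/fintype.subsetP => _ /imset2P[u v Au Av ->].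
have /perms_overP[s Ks sP] := fintype.subsetP Alt_perms_over _ Au.
have /perms_overP[t Kt tP] := fintype.subsetP Alt_perms_over _ Av.
have sV i : (s^-1)%g (r i) = r ((u^-1)%g i).
  by apply: (can_inj (autVK s)); rewrite autKV sP permKV.
have tV i : (t^-1)%g (r i) = r ((v^-1)%g i).
  by apply: (can_inj (autVK t)); rewrite autKV tP permKV.
apply/perms_overP; exists (t * (s * (t^-1 * s^-1)))%g => [y Ly|i].
  rewrite !autM (galC_ab_comm (galCV Kt) (galCV Ks) Ly).
  by rewrite autKV autKV.
by rewrite !autM sV tV sP tP /commg /conjg !permM.
Qed.

Lemma perms_over_ab : perms_over (field_ab K) r = ('Sym_('I_n))%g \/
  perms_over (field_ab K) r = ('Alt_('I_n))%g.
Proof.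
set H := perms_over _ _.
have [[w Hw ow]|ne] := pselect (exists2 w : 'S_n, w \in H & odd_perm w).
  left; apply/eqP; rewrite finset.eqEsubset finset.subsetT; apply/fintype.subsetP => v _.
  have [ov|ev] := boolP (odd_perm v); last first.
    by apply: (fintype.subsetP Alt_perms_over_ab); rewrite Alt_even.
  rewrite -[v](mulgKV w); apply: (@groupM _ (perms_over_grp (field_ab K) r)) => //.
  by apply: (fintype.subsetP Alt_perms_over_ab); rewrite Alt_even odd_permM odd_permV ov ow.
right; apply/eqP; rewrite finset.eqEsubset Alt_perms_over_ab andbT; apply/fintype.subsetP => v Hv.
by rewrite Alt_even; apply/negP => ov; apply: ne; exists v.
Qed.
End AlternatingOverAbelian.

(** A permutation in the group is lifted to an automorphism, which is then restricted
to the splitting field. The inverse compensates for the fact that permutations compose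
from left to right. *)
Lemma perms_over_sa L n (r : 'I_n -> algC) (f : {poly subfield L}) :
  injective r -> (forall x, root_set f x <-> exists i, x = r i) ->
  perms_over L r = ('Sym_('I_n))%g \/ perms_over L r = ('Alt_('I_n))%g ->
  sym_or_alt f.
Proof.
move=> rinj fr HH; exists n.
set M := adjoin L (root_set f).
suff : gal_isog L M (perms_over L r) by case: HH => ->; [left|right].
pose lf (w : 'S_n) := xget 1%g [set s | galC L s /\ forall i, s (r i) = r (w i)].
have lfP w : w \in perms_over L r -> galC L (lf w) /\ forall i, lf w (r i) = r (w i).
  move=> /perms_overP[s Ls sP].
  by apply: (@xgetPex _ 1%g [set s | galC L s /\ forall i, s (r i) = r (w i)]); exists s.
have rM i : r i \in M by apply: mem_adjoin; apply/fr; exists i.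
have stM s x : galC L s -> x \in M -> s x \in M by apply: root_set_stable.
have rE s (z : subfield M) : galC L s -> val (restr s z) = s (val z).
  by move=> Ls; apply: restrE; apply: stM => //; apply: valP.
have ao s : galC L s -> aut_over L M (restr s).
  move=> Ls; apply: restr_aut_over => // x; apply: stM => //; exact: galCV.
have HV w : w \in perms_over L r -> (w^-1)%g \in perms_over L r.
  by rewrite (@groupV _ (perms_over_grp L r)).
have HM u v : u \in perms_over L r -> v \in perms_over L r -> (u * v)%g \in perms_over L r.
  exact: (@groupM _ (perms_over_grp L r)).
have eqM s t : galC L s -> galC L t -> (forall i, s (r i) = t (r i)) ->
    restr s = restr t :> (subfield M -> subfield M).
  move=> Ls Lt st; apply: funext => z; apply: val_inj; rewrite !rE //.
  apply: (@aut_eq_adjoin L (root_set f)) (valP z) => [x Lx|x /fr[i ->]]; last exact: st.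
  by rewrite Ls ?Lt.
(* Products of permutations act from left to right, compositions from right to left. *)
pose phi (w : 'S_n) : subfield M -> subfield M := restr (lf (w^-1)%g).
exists phi; split.
  split.
  - by move=> w /HV/lfP[Lw _]; apply: ao.
  - move=> u v /set_mem/HV Hu /set_mem/HV Hv uv; apply: invg_inj.
    have [[Lu uP] [Lv vP]] := (lfP _ Hu, lfP _ Hv).
    apply/permP => i; apply: (rinj); rewrite -uP -vP.
    pose ri : subfield M := Sub (r i) (rM i).
    have E : val (phi u ri) = val (phi v ri) by rewrite uv.
    exact: etrans (esym (rE _ ri Lu)) (etrans E (rE _ ri Lv)).
  - move=> s so; have [t Lt tP] := aut_over_extend (@sub_adjoin L _) so.
    have tr i : exists j, t (r i) = r j.
      by apply/fr; rewrite /root_set /= galC_root //; apply/fr; exists i.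
    pose g i := sval (cid (tr i)); have gE i : t (r i) = r (g i) := svalP (cid (tr i)).
    have ginj : injective g by move=> i j /(congr1 r); rewrite -!gE => /fmorph_inj/rinj.
    have Ht : perm ginj \in perms_over L r.
      by apply/perms_overP; exists t => // i; rewrite permE.
    exists (perm ginj)^-1%g; first exact: HV.
    rewrite /phi invgK; have [Ll lP] := lfP _ Ht.
    have lt : restr (lf (perm ginj)) = restr t :> (subfield M -> subfield M).
      by apply: eqM => // i; rewrite lP permE gE.
    by rewrite lt; apply: funext => z; apply: val_inj; rewrite -tP; apply: rE.
move=> u v Hu Hv.
have [[Lu uP] [Lv vP]] := (lfP _ (HV _ Hu), lfP _ (HV _ Hv)).
have [Luv uvP] := lfP _ (HV _ (HM _ _ Hu Hv)).
rewrite /phi (@eqM _ (lf (u^-1)%g * lf (v^-1)%g)%g) //; [|exact: galCM|].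
  apply: funext => z; apply: val_inj; rewrite rE; last exact: galCM.
  by rewrite autM [RHS]rE //= rE.
by move=> i; rewrite uvP autM vP uP invMg permM.
Qed.

Lemma Alt_move n (i j : 'I_n) : (2 < n)%N -> exists2 w : 'S_n, w \in ('Alt_('I_n))%g & w i = j.
Proof.
move=> n2; have [->|ij] := eqVneq i j.
  by exists 1%g; rewrite ?group1 ?perm1.
have [k ki kj] : exists2 k : 'I_n, k != i & k != j.
  have : (0 < #|~: [set i; j]|)%N by rewrite cardsCs finset.setCK cards2 card_ord ij; lia.
  by case/card_gt0P => k; rewrite !inE negb_or => /andP[]; exists k.
exists (tperm i k * tperm k j)%g; last by rewrite permM !tpermL.
by rewrite Alt_even odd_permM !odd_tperm eq_sym ki kj.
Qed.

(** The polynomial is taken to be the minimal polynomial of one root: the alternating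
group is transitive, so the other roots are among its roots. *)
Lemma root_poly_irr L n (r : 'I_n -> algC) (q : {poly int}) : injective r -> (2 < n)%N ->
  map_poly intr q = \prod_(i < n) ('X - (r i)%:P) -> ('Alt_('I_n))%g \subset perms_over L r ->
  exists2 f : {poly subfield L}, irreducible_poly f &
    forall x, root_set f x <-> exists i, x = r i.
Proof.
move=> rinj n2 qE AL; pose i0 : 'I_n := Ordinal (ltnW (ltnW n2) : (0 < n)%N).
have [f [irr mf fr fP]] := minpoly_subfield L (r i0).
exists f => // x; split=> [rx|[j ->]]; last first.
  have [w Aw wj] := Alt_move i0 j n2.
  have /perms_overP[s Ls sP] := fintype.subsetP AL _ Aw.
  by rewrite /root_set /= -wj -sP galC_root.
have qL : map_poly val (map_poly intr q : {poly subfield L}) = \prod_(i < n) ('X - (r i)%:P).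
  by rewrite -qE -map_poly_comp; apply: eq_map_poly => z; exact: rmorph_int.
have rq i : root (\prod_(i < n) ('X - (r i)%:P)) (r i).
  by rewrite (bigD1 i) //= rootM root_XsubC eqxx.
have /dvdpP[g gE] : f %| map_poly intr q by apply: fP; rewrite qL.
have : root (\prod_(i < n) ('X - (r i)%:P)) x by rewrite -qL gE rmorphM rootM rx orbT.
by rewrite rootE horner_prod => /prodf_eq0[j _]; rewrite hornerXsubC subr_eq0 => /eqP ->; exists j.
Qed.

Lemma minCpoly_sym n (r : 'I_n -> algC) (q : {poly int}) i : injective r -> q \is monic ->
  map_poly intr q = \prod_(i < n) ('X - (r i)%:P) -> gal_perms r = [set: 'S_n]%SET ->
  minCpoly (r i) = map_poly intr q.
Proof.
move=> rinj mq qE rsym.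
have conj j : root (minCpoly (r i)) (r j).
  have /gal_permsP[s sP] : tperm i j \in gal_perms r by rewrite rsym inE.
  by apply/root_minCpoly_conj; exists s; rewrite sP tpermL.
have mqC : map_poly (intr : int -> algC) q \is monic by rewrite monic_map.
apply/eqP; rewrite -eqp_monic ?minCpoly_monic //; apply/andP; split.
  have [p [-> _] pP] := minCpolyP (r i).
  have E : map_poly intr q = map_poly (ratr : rat -> algC) (map_poly intr q).
    by rewrite -map_poly_comp; apply: eq_map_poly => z; rewrite /= ratr_int.
  rewrite E dvdp_map -pP -E qE (bigD1 i) //= rootM root_XsubC eqxx //.
rewrite qE -(big_map r xpredT (fun a => 'X - a%:P)) /=; apply: uniq_roots_dvdp.
  by apply/allP => _ /mapP[j _ ->]; apply: conj.
by rewrite uniq_rootsE map_inj_uniq // /index_enum -enumT enum_uniq.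
Qed.

(** Automorphisms commute on roots of unity, but the transpositions [(i j)] and [(j k)]
move [i] to different places according to the order in which they are applied. *)
Lemma sym_not_unity n (r : 'I_n -> algC) i m : (2 < n)%N -> injective r ->
  gal_perms r = [set: 'S_n]%SET -> (0 < m)%N -> r i ^+ m != 1.
Proof.
move=> n2 rinj rsym m0; apply/eqP => rm.
have [j [k [ij ik jk]]] : exists j k : 'I_n, [/\ j != i, k != i & j != k].
  have : (1 < #|~: [set i]|)%N by rewrite cardsCs finset.setCK cards1 card_ord; lia.
  by case/card_gt1P => j [k [+ + jk]]; rewrite !inE => ji ki; exists j, k.
have /gal_permsP[s sP] : tperm i j \in gal_perms r by rewrite rsym inE.
have /gal_permsP[t tP] : tperm j k \in gal_perms r by rewrite rsym inE.
have [a sa] := unity_aut s m0 rm; have [b tb] := unity_aut t m0 rm.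
have : s (t (r i)) = t (s (r i)).
  by rewrite tb sa !rmorphXn /= sa tb -!exprM mulnC.
rewrite tP (tpermD ij ik) sP tpermL tP tpermL => /rinj/eqP.
exact/negP.
Qed.

Lemma ln_small (R : realType) (eps : R) : 0 < eps -> exists N : nat, forall n, (N < n)%N ->
  n%:R^-1 * ln ((5 ^ 2 * n.+1)%:R : R) < eps.
Proof.
move=> e0; (* With [s ^+ 2 = n.+1] the logarithm is [2 * ln (5 * s)], less than [10 * s]; and
   [(10 * s) ^+ 2] is at most [200 * n]. *)
pose N := Num.bound (200 / eps ^+ 2); exists N => n Nn.
have n0 : (0 < n)%N by apply: leq_ltn_trans Nn.
have nR : 0 < n%:R :> R by rewrite ltr0n.
have NR : 200 < eps ^+ 2 * n%:R.
  have h : 200 / eps ^+ 2 < n%:R.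
    apply: lt_le_trans (archi_boundP _) _; first by rewrite divr_ge0 ?exprn_ge0 ?ltW // ltr0n.
    by rewrite ler_nat ltnW.
  by rewrite mulrC -ltr_pdivrMr // exprn_gt0.
pose s := Num.sqrt (n.+1%:R : R).
have s0 : 0 < s by rewrite sqrtr_gt0 ltr0n.
have s2 : s ^+ 2 = n.+1%:R by rewrite sqr_sqrtr // ler0n.
have -> : (5 ^ 2 * n.+1)%:R = (5 * s) ^+ 2 :> R by rewrite natrM natrX exprMn s2.
have s50 : 0 < 5 * s by rewrite mulr_gt0 // ltr0n.
rewrite lnXn // mulrC ltr_pdivrMr // mulr2n.
have := ln_sublinear s50; set l := ln _ => l5.
suff h : 10 * s <= eps * n%:R by lra.
rewrite -(@ler_pXn2r _ 2) ?nnegrE ?mulr_ge0 ?ltW //.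
rewrite !exprMn s2 -[n.+1]addn1 natrD.
have n1 : 1 <= n%:R :> R by rewrite ler1n.
nra.
Qed.

(** The roots of the polynomials with symmetric group over the rationals lie in the
second layer of the tower, for every large prime degree. *)
Lemma not_bogomolov (R : realType) K d : number_field K ->  (0 < d)%N ->
  ~ bogomolov R (field_deg (field_sa (field_ab K)) d).
Proof.
move=> nK d0 [eps e0 bog].
have [T [f fK]] := number_field_cosets nK.
have [N NP] := ln_small e0.
have [n mn pn] := prime_above (maxn #|T| (maxn 4 N)).
have [Tn n4 Nn] : [/\ (#|T| < n)%N, (4 < n)%N & (N < n)%N].
  by move: mn; rewrite !gtn_max => /andP[-> /andP[-> ->]].
have n2 : (2 < n)%N by apply: leq_trans n4.
have [q [r [[mq sq qB] [rinj qE rsym]]]] := sym_poly_ex pn n4.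
have AL := Alt_perms_over_ab fK pn Tn n4 rsym.
have HH := perms_over_ab fK pn Tn n4 rsym.
have [g irr gr] := root_poly_irr rinj n2 qE AL.
have sag := perms_over_sa rinj gr HH.
pose i0 : 'I_n := Ordinal (ltnW (ltnW n2) : (0 < n)%N).
have xF : r i0 \in field_deg (field_sa (field_ab K)) d.
  apply: sub_adjoin; apply: mem_adjoin; exists g; split=> //.
  by apply/gr; exists i0.
have x0 : r i0 != 0.
  apply/eqP => r0; have /gal_permsP[s sP] : tperm i0 (Ordinal (ltnW n2 : (1 < n)%N)) \in gal_perms r.
    by rewrite rsym inE.
  have := sP i0; rewrite r0 rmorph0 -{1}r0 tpermL => /rinj/(congr1 val) //.
have := bog _ xF x0 (fun m m0 => sym_not_unity i0 n2 rinj rsym m0).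
apply/negP; rewrite -ltNge; apply: le_lt_trans (NP n Nn).
have := @weil_height_le R (r i0) q 5 mq (minCpoly_sym i0 rinj mq qE rsym) qB isT.
by rewrite sq.
Qed.


End SmallHeights.

Theorem proposition3p1 (R : realType) (K : divringClosed algC) (d : nat) :
  number_field K -> (0 < d)%N ->
  let F := field_deg (field_sa (field_ab K)) d in
  free_abelian (mod_tors (Gm (subfield F))) /\ ~ bogomolov R F.
Proof.
move=> nK d0 F; split; first exact: mod_tors_free.
exact: not_bogomolov.
Qed.
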